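(* Let $B : L^2(\Omega)\to L^2(\Omega)$ be Lipschitz continuous and bounded. Let $\Theta^u,\Theta^\ell : C\to[0,r]$ be continuous with $0\le\Theta^\ell(\varphi)\le\Theta^u(\varphi)\le r$ for all $\varphi\in C$, and let $\eta : C\to[0,r]$ be continuous and such that for all $\varphi,\psi\in C$: if $\psi(\theta)=\varphi(\theta)$ for all $\theta\in[-\Theta^u(\varphi),-\Theta^\ell(\varphi)]$, then $\eta(\psi)=\eta(\varphi)$. Assume that at least one of the following holds: (a) $\Theta^\ell(\varphi)>0$ for all $\varphi\in C$; (b) with $Z=\{\varphi\in C:\Theta^\ell(\varphi)=0\}$: there is a constant $L$ such that $Z\subset\left\{\varphi\in C:\ \sup_{t\neq s}\frac{\|\varphi(t)-\varphi(s)\|}{|t-s|}\le L\right\}$ (supremum over $t,s\in[-r,0]$); $\eta(\varphi)>0$ for all $\varphi\in Z$; and there exist $\omega>0$, $L_\eta>0$ such that $|\eta(\varphi)-\eta(\psi)|\le L_\eta\|\varphi-\psi\|_C$ for all $\varphi,\psi\in U_\omega(Z)=\{\chi\in C:\exists\,\nu\in Z,\ \|\chi-\nu\|_C\le\omega\}$. Let $(S_t,C)$ be the dynamical system defined by $S_t\varphi=u_t$, $t\ge 0$, where $u$ is the unique global mild solution of $$\frac{\partial}{\partial t}u(t,x)+Au(t,x)+d\,u(t,x)=\big(B(u(t-\eta(u_t)))\big)(x),\quad x\in\Omega,\ t>0,\qquad u|_{[-r,0]}=\varphi .$$ Then $(S_t,C)$ has a compact global attractor $\mathcal{A}$, and $\mathcal{A}$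 is a compact set in every space $C_\delta= C([-r,0];D(A^\delta))$, $\delta\in[0,\tfrac12)$.
   Context: Setting: $\Omega\subset\mathbb{R}^{n_0}$ is a smooth bounded domain; $r>0$ and $d\ge0$ are constants; $A$ is a densely defined self-adjoint positive linear operator with domain $D(A)\subset L^2(\Omega)$ and compact resolvent, so that $-A$ generates the analytic semigroup $e^{-At}$ on $L^2(\Omega)$; $D(A^\delta)$ is the domain of the fractional power $A^\delta$ with its usual norm. Notation: $C= C([-r,0];L^2(\Omega))$ with the sup-norm $\|\cdot\|_C$; $\|\cdot\|$ is the norm of $L^2(\Omega)$. For a function $u$ on an interval containing $[t-r,t]$, $u_t\in C$ is defined by $u_t(\theta)=u(t+\theta)$, $\theta\in[-r,0]$. The delay term is $F(\varphi)=B(\varphi(-\eta(\varphi)))$, $\varphi\in C$. ''$B$ Lipschitz continuous'' means $\|B(v^1)-B(v^2)\|\le L_B\|v^1-v^2\|$ for all $v^1,v^2\in L^2(\Omega)$ with some constant $L_B$; ''$B$ bounded'' means $\sup_{v\in L^2(\Omega)}\|B(v)\|<\infty$. Mild solution: $u\in C([-r,T];L^2(\Omega))$ is a mild solution on $[-r,T]$ of the initial value problem if $u|_{[-r,0]}=\varphi$ and $$u(t)=e^{-At}\varphi(0)+\int_0^t e^{-A(t-s)}\{F(u_s)-d\,u(s)\}\,ds,\quad t\in[0,T].$$ A global mild solution is $u\in C([-r,+\infty);L^2(\Omega))$ whose restriction to $[-r,T]$ is a mild solution for every $T>0$. Under the hypotheses of the claim, the global mild solution exists and is unique for every $\varphi\in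 C$, and $S_t$ is a strongly continuous semigroup of continuous maps on $C$. A compact global attractor of $(S_t,C)$ is a compact set $\mathcal{A}\subset C$ with $S_t\mathcal{A}=\mathcal{A}$ for all $t\ge0$ that attracts every bounded set $D\subset C$: $\sup_{\varphi\in D}\mathrm{dist}_C(S_t\varphi,\mathcal{A})\to0$ as $t\to\infty$. *)

(* Defs.v *)
From HB Require Import structures.
From mathcomp Require Import all_boot all_order all_algebra.
From mathcomp Require Import all_classical all_reals all_analysis.
From mathcomp Require Import measurable_realfun.
Set Implicit Arguments.
Unset Strict Implicit.
Unset Printing Implicit Defensive.
Import Order.TTheory GRing.Theory Num.Theory.
Import numFieldNormedType.Exports.
Local Open Scope classical_set_scope.
Local Open Scope ring_scope.

Section L2.
Context d (T : measurableType d) (R : realType).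
Variable mu : {measure set T -> \bar R}.
Local Notation mf := ({mfun T >-> measurableTypeR R}).
Local Notation qf := ({mfun_ mu, T >-> measurableTypeR R}).
Definition L2 : Type := LspaceType2 mu.
HB.instance Definition _ := gen_eqMixin L2.
HB.instance Definition _ := gen_choiceMixin L2.
Definition L2fun (f : L2) : T -> R := repr (LebesgueSpace.sort f).
Lemma L2fun_Lfun (f : L2) : L2fun f \in Lfun mu 2%:E.
Proof.
apply/andP; split; rewrite inE.
  exact: (@measurable_funPT _ _ _ _ (repr (LebesgueSpace.sort f) : mf)).
exact: (@Lebesgue_finite _ _ _ _ _ _ f).
Qed.
Lemma Lfun_measurable f : f \in Lfun mu 2%:E -> measurable_fun setT f.
Proof. by move=> /andP[+ _]; rewrite inE. Qed.
Lemma ae_eq_Lnorm2 (f g : T -> R) :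
  measurable_fun setT f -> measurable_fun setT g -> f = g %[ae mu] ->
  ('N[mu]_2%:E [EFin \o f] = 'N[mu]_2%:E [EFin \o g])%E.
Proof.
move=> mf mg fg; rewrite unlock; congr poweR.
apply: ae_eq_integral => //.
- apply: (@measurableT_comp _ _ _ _ _ _ (fun x : \bar R => (x `^ 2)%E)) => //.
    exact: measurable_poweR.
  by apply: measurableT_comp => //; exact/measurable_EFinP.
- apply: (@measurableT_comp _ _ _ _ _ _ (fun x : \bar R => (x `^ 2)%E)) => //.
    exact: measurable_poweR.
  by apply: measurableT_comp => //; exact/measurable_EFinP.
by apply: filterS fg => x /= + _ => /(_ I) ->.
Qed.

Local Open Scope quotient_scope.
Section toL2.
Variables (f : T -> R) (fL : f \in Lfun mu 2%:E).
Let fm : mf := @mfun_Sub _ _ T (measurableTypeR R) f (mem_set (Lfun_measurable fL)).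
Let fq : qf := \pi_qf fm.
Let fqE : (fq : T -> R) = f %[ae mu].
Proof.
have : repr fq = fm %[mod qf] by rewrite reprK.
by move/eqmodP => /asboolP.
Qed.
Let fq_finite : finite_norm mu 2%:E fq.
Proof.
rewrite /finite_norm (ae_eq_Lnorm2 _ _ fqE).
- by move: fL => /andP[_]; rewrite inE.
- exact: (@measurable_funPT _ _ _ _ (repr fq : mf)).
- exact: Lfun_measurable.
Qed.
HB.instance Definition _ := isFinLebesgue.Build _ _ _ mu _ (lee1n 2) fq fq_finite.
Definition toL2 : L2 := (fq : LspaceType2 mu).
Lemma toL2K : L2fun toL2 = f %[ae mu].
Proof. exact: fqE. Qed.
End toL2.
Lemma L2P (f g : L2) : L2fun f = L2fun g %[ae mu] -> f = g.
Proof.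
rewrite /L2fun => fg.
have : LebesgueSpace.sort f = LebesgueSpace.sort g.
  by rewrite -[LHS]reprK -[RHS]reprK; apply/eqmodP; apply/asboolP.
case: f g {fg} => [f [[Pf]]] [g [[Pg]]] /= fg.
rewrite fg in Pf *; congr {| LebesgueSpace.class := _ |}.
congr LebesgueSpace.Class; congr isFinLebesgue.Axioms_; exact: Prop_irrelevance.
Qed.

Lemma Lfun2D (f g : T -> R) : f \in Lfun mu 2%:E -> g \in Lfun mu 2%:E ->
  (fun x => f x + g x) \in Lfun mu 2%:E.
Proof. by have [_] := Lfun_addr_closed mu (lee1n 2); exact. Qed.
Lemma Lfun2Z a (f : T -> R) : f \in Lfun mu 2%:E ->
  (fun x => a * f x) \in Lfun mu 2%:E.
Proof.
move=> fL; have -> : (fun x => a * f x) = a \o* f by apply/funext => x; rewrite mulrC.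
by apply: Lfun_scale => //; rewrite ler1n.
Qed.
Lemma Lfun20 : (cst 0 : T -> R) \in Lfun mu 2%:E.
Proof. by have [] := Lfun_addr_closed mu (lee1n 2). Qed.

Definition L2zero : L2 := toL2 Lfun20.
Definition L2add (f g : L2) : L2 := toL2 (Lfun2D (L2fun_Lfun f) (L2fun_Lfun g)).
Definition L2scale (a : R) (f : L2) : L2 := toL2 (Lfun2Z a (L2fun_Lfun f)).
Definition L2opp (f : L2) : L2 := L2scale (-1) f.

Lemma L2zeroE : \forall x \ae mu, L2fun L2zero x = 0.
Proof. by have := toL2K Lfun20; apply: filterS => x /(_ I). Qed.
Lemma L2addE f g : \forall x \ae mu, L2fun (L2add f g) x = L2fun f x + L2fun g x.
Proof.
by have := toL2K (Lfun2D (L2fun_Lfun f) (L2fun_Lfun g)); apply: filterS => x /(_ I).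
Qed.
Lemma L2scaleE a f : \forall x \ae mu, L2fun (L2scale a f) x = a * L2fun f x.
Proof. by have := toL2K (Lfun2Z a (L2fun_Lfun f)); apply: filterS => x /(_ I). Qed.

Lemma L2aeP (f g : L2) : (\forall x \ae mu, L2fun f x = L2fun g x) -> f = g.
Proof. by move=> fg; apply: L2P; apply: filterS fg => x ? _. Qed.


Lemma L2addA : associative L2add.
Proof.
move=> f g h; apply: L2aeP; near=> x.
rewrite (near (L2addE f (L2add g h)) x)// (near (L2addE g h) x)//.
by rewrite (near (L2addE (L2add f g) h) x)// (near (L2addE f g) x)// addrA.
Unshelve. all: by end_near. Qed.

Lemma L2addC : commutative L2add.
Proof.
move=> f g; apply: L2aeP; near=> x.
by rewrite (near (L2addE f g) x)// (near (L2addE g f) x)// addrC.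
Unshelve. all: by end_near. Qed.

Lemma L2add0 : left_id L2zero L2add.
Proof.
move=> f; apply: L2aeP; near=> x.
by rewrite (near (L2addE L2zero f) x)// (near L2zeroE x)// add0r.
Unshelve. all: by end_near. Qed.

Lemma L2addN : left_inverse L2zero L2opp L2add.
Proof.
move=> f; apply: L2aeP; near=> x.
rewrite (near (L2addE (L2opp f) f) x)// (near (L2scaleE (-1) f) x)//.
by rewrite (near L2zeroE x)// mulN1r addNr.
Unshelve. all: by end_near. Qed.

HB.instance Definition _ := GRing.isZmodule.Build L2 L2addA L2addC L2add0 L2addN.

Lemma L2scaleA a b f : L2scale a (L2scale b f) = L2scale (a * b) f.
Proof.
apply: L2aeP; near=> x.
rewrite (near (L2scaleE a (L2scale b f)) x)// (near (L2scaleE b f) x)//.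
by rewrite (near (L2scaleE (a * b) f) x)// mulrA.
Unshelve. all: by end_near. Qed.

Lemma L2scale1 : left_id 1 L2scale.
Proof.
by move=> f; apply: L2aeP; near=> x; rewrite (near (L2scaleE 1 f) x)// mul1r.
Unshelve. all: by end_near. Qed.

Lemma L2scaleDr : right_distributive L2scale +%R.
Proof.
move=> a f g; apply: L2aeP; near=> x.
rewrite (near (L2scaleE a (f + g)) x)// (near (L2addE f g) x)//.
rewrite (near (L2addE (L2scale a f) (L2scale a g)) x)//.
by rewrite (near (L2scaleE a f) x)// (near (L2scaleE a g) x)// mulrDr.
Unshelve. all: by end_near. Qed.

Lemma L2scaleDl f : {morph L2scale^~ f : a b / a + b}.
Proof.
move=> a b; apply: L2aeP; near=> x.
rewrite (near (L2scaleE (a + b) f) x)//.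
rewrite (near (L2addE (L2scale a f) (L2scale b f)) x)//.
by rewrite (near (L2scaleE a f) x)// (near (L2scaleE b f) x)// mulrDl.
Unshelve. all: by end_near. Qed.

HB.instance Definition _ := GRing.Zmodule_isLmodule.Build R L2
  L2scaleA L2scale1 L2scaleDr L2scaleDl.

Definition L2norm (f : L2) : R := fine ('N[mu]_2%:E [EFin \o L2fun f]).

Lemma L2normE (f : L2) : (L2norm f)%:E = ('N[mu]_2%:E [EFin \o L2fun f])%E.
Proof. exact: (finite_norm_fine (Lfun_Sub (lee1n 2) (L2fun_Lfun f))). Qed.

Lemma L2normD f g : L2norm (f + g) <= L2norm f + L2norm g.
Proof.
rewrite -lee_fin EFinD !L2normE.
rewrite (ae_eq_Lnorm2 _ _ (toL2K (Lfun2D (L2fun_Lfun f) (L2fun_Lfun g)))).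
- by apply: eminkowski; rewrite ?lee1n//; apply: Lfun_measurable; exact: L2fun_Lfun.
- by apply: Lfun_measurable; exact: L2fun_Lfun.
- by apply: Lfun_measurable; exact: (Lfun2D (L2fun_Lfun f) (L2fun_Lfun g)).
Qed.

Lemma L2normZ a f : L2norm (a *: f) = `|a| * L2norm f.
Proof.
apply: EFin_inj; rewrite EFinM !L2normE.
rewrite (ae_eq_Lnorm2 _ _ (toL2K (Lfun2Z a (L2fun_Lfun f)))).
- exact: (LnormZ (Lfun_Sub (lee1n 2) (L2fun_Lfun f)) a).
- by apply: Lfun_measurable; exact: L2fun_Lfun.
- by apply: Lfun_measurable; exact: (Lfun2Z a (L2fun_Lfun f)).
Qed.

Lemma L2norm_eq0 f : L2norm f = 0 -> f = 0.
Proof.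
move=> /(fine_Lnormr_eq0 (f := Lfun_Sub (lee1n 2) (L2fun_Lfun f))) f0.
apply: L2aeP; apply: filterS2 f0 L2zeroE => x /(_ I) + ->; exact.
Qed.

HB.instance Definition _ := Lmodule_isNormed.Build R L2
  L2normD L2normZ L2norm_eq0.

Definition L2dot (f g : L2) : R := \int[mu]_(x in setT) (L2fun f x * L2fun g x).

End L2.

Section image_measure.
Local Open Scope ereal_scope.
Context d d' (T1 : measurableType d) (T2 : measurableType d') (R : realType).
Variables (m : {measure set T1 -> \bar R}) (f : T1 -> T2).
Hypothesis mf : measurable_fun [set: T1] f.
Definition image_measure of measurable_fun setT f := pushforward m f.
Local Notation im := (image_measure mf).
Let im0 : im set0 = 0.
Proof. by rewrite /image_measure /pushforward preimage_set0 measure0. Qed.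
Let im_ge0 A : 0 <= im A.
Proof. exact: measure_ge0. Qed.
Let im_sigma_additive : semi_sigma_additive im.
Proof.
move=> F mF tF mUF; rewrite /image_measure /pushforward preimage_bigcup.
apply: measure_semi_sigma_additive.
- by move=> n; rewrite -[X in measurable X]setTI; exact: mf.
- apply/trivIsetP => /= i j _ _ ij; rewrite -preimage_setI.
  by move/trivIsetP : tF => /(_ _ _ _ _ ij) ->//; rewrite preimage_set0.
- by rewrite -preimage_bigcup -[X in measurable X]setTI; exact: mf.
Qed.
HB.instance Definition _ := isMeasure.Build _ _ _ im im0 im_ge0 im_sigma_additive.
End image_measure.

Section prod_sigma_finite.
Local Open Scope ereal_scope.
Context d1 d2 (T1 : measurableType d1) (T2 : measurableType d2) (R : realType).
Variable m1 : {sigma_finite_measure set T1 -> \bar R}.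
Variable m2 : {sigma_finite_measure set T2 -> \bar R}.
Lemma prod_sigma_finite : sigma_finite setT (m1 \x m2).
Proof.
have /sigma_finiteP[F [TF ndF Foo]] := sigma_finiteT m1.
have /sigma_finiteP[G [TG ndG Goo]] := sigma_finiteT m2.
exists (fun n => F n `*` G n).
 rewrite -setXTT TF TG predeqE => -[x y]; split.
    move=> [/= [n _ Fnx] [k _ Gky]]; exists (maxn n k) => //; split.
    - by move: x Fnx; exact/subsetPset/ndF/leq_maxl.
    - by move: y Gky; exact/subsetPset/ndG/leq_maxr.
  by move=> [n _ []/= ? ?]; split; exists n.
move=> k; have [? ?] := Foo k; have [? ?] := Goo k.
split; first exact: measurableX.
by rewrite product_measure1E// lte_mul_pinfty// ge0_fin_numE.
Qed.
End prod_sigma_finite.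

Section lebesgue_Rn_def.
Context {R : realType}.
Local Notation RT := (measurableTypeR R).
Section step.
Variables (n : nat) (m : {sigma_finite_measure set (n.-tuple RT) -> \bar R}).
Definition tcons (x : RT * n.-tuple RT) : n.+1.-tuple RT := [tuple of x.1 :: x.2].
Lemma measurable_tcons : measurable_fun setT tcons.
Proof. exact: measurable_cons. Qed.
Definition lebS : set (n.+1.-tuple RT) -> \bar R := 
  image_measure (product_measure1 (@lebesgue_measure R) m) measurable_tcons.
HB.instance Definition _ := Measure.on lebS.
Lemma lebS_sigma_finite : sigma_finite setT lebS.
Proof.
have [F TF Foo] := prod_sigma_finite (@lebesgue_measure R) m.
pose g (x : n.+1.-tuple RT) : RT * n.-tuple RT := (thead x, [tuple of behead x]).
exists (fun k => g @^-1` F k).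
  by rewrite -preimage_bigcup -TF.
move=> k; have [mF Fk] := Foo k; split.
  rewrite -[_ @^-1` _]setTI; apply: measurable_fun_pair => //.
    exact: measurable_tnth.
  exact: measurable_behead.
rewrite /lebS /image_measure /pushforward (_ : _ @^-1` _ = F k)//.
rewrite (_ : tcons @^-1` _ = (g \o tcons) @^-1` F k)// (_ : g \o tcons = id)//.
apply/funext => -[x t]; congr pair.
exact/val_inj.
Qed.
HB.instance Definition _ := Measure_isSigmaFinite.Build _ _ _ lebS lebS_sigma_finite.
End step.
Section base.
Definition leb0 : set (0.-tuple RT) -> \bar R := dirac [tuple].
HB.instance Definition _ := SigmaFiniteMeasure.on leb0.
End base.
(* n-fold product of the Lebesgue measure of the line *)
Fixpoint lebt n : {sigma_finite_measure set (n.-tuple RT) -> \bar R} :=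
  if n is k.+1 then lebS (lebt k) else leb0.

(* R^n with its Borel sigma-algebra; the carrier is ['rV[R]_n]. *)
Definition Rn n := g_sigma_algebraType (@open 'rV[R]_n).
Definition row_of_tuple n (t : n.-tuple RT) : Rn n := \row_i tnth t i.

Lemma measurable_row_of_tuple n : measurable_fun setT (@row_of_tuple n).
Proof.
apply: (@measurability _ _ _ (Rn n) setT (@row_of_tuple n) (@open 'rV[R]_n) erefl).
move=> _ [U oU <-]; rewrite setTI.
pose box (q : 'rV[rat]_n * nat) : set (n.-tuple RT) :=
  \bigcap_(i in [set: 'I_n])
    ((@tnth n RT)^~ i @^-1` ball (ratr (q.1 ord0 i) : R) (q.2.+1%:R^-1)).
have mbox q : measurable (box q).
  apply: fin_bigcap_measurable => // i _.
  rewrite -[X in measurable X]setTI; apply: measurable_tnth => //.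
  exact: measurable_ball.
have -> : @row_of_tuple n @^-1` U =
    \bigcup_(q in [set q | box q `<=` @row_of_tuple n @^-1` U]) box q.
  apply/seteqP; split=> [t Ut|t [q qU]]; last exact: qU.
  have /nbhs_ballP[e /= e0 eU] : nbhs (row_of_tuple t : 'rV[R]_n) U.
    exact: open_nbhs_nbhs.
  have [k ke] : exists k : nat, (k.+1%:R^-1 : R) < e / 2.
    near \oo => k; exists k.
    by near: k; apply: (near_infty_natSinv_lt (PosNum (divr_gt0 e0 (ltr0Sn R 1)))).
  have qP i : exists q : rat, ball (ratr q : R) (k.+1%:R^-1) (tnth t i).
    have /rat_in_itvoo[q] : tnth t i - k.+1%:R^-1 < tnth t i + k.+1%:R^-1 :> R.
      by rewrite ltrD2l gtrN ?invr_gt0.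
    by rewrite in_itv/= => tq; exists q; rewrite /ball/= ltr_distl.
  have [q qP'] := choice qP.
  exists (\row_i q i, k) => /=; last by move=> i _ /=; rewrite mxE.
  move=> u bu; apply: eU; split=> // i j; rewrite !mxE.
  have := bu j I; have := qP' j; rewrite /= mxE => b1 b2.
  have := ball_triangle (ball_sym b1) b2; apply: le_ball.
  by rewrite (splitr e) lerD// ltW.
rewrite bigcup_mkcond; apply: countable_bigcupT_measurable => // q.
by case: ifP.
Unshelve. all: by end_near. Qed.

Definition lebesgue_Rn n : set (Rn n) -> \bar R :=
  image_measure (lebt n) (@measurable_row_of_tuple n).
HB.instance Definition _ n := Measure.on (@lebesgue_Rn n).
End lebesgue_Rn_def.

Section domain.
Context {R : realType}.
Implicit Type n : nat.

Fixpoint Ck n (k : nat) (f : 'rV[R]_n -> R) : Prop :=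
  if k is k'.+1 then
    [/\ continuous f,
        forall i x, derivable f x (delta_mx ord0 i) &
        forall i, Ck k' (fun x => 'D_(delta_mx ord0 i) f x)]
  else continuous f.

Definition smooth n (f : 'rV[R]_n -> R) := forall k, Ck k f.

(* Near each boundary point the set is a sublevel set [rho < 0] of a smooth
   function whose gradient does not vanish at that point. *)
Definition smooth_boundary n (O : set 'rV[R]_n) :=
  forall p, (closure O `\` O^°) p ->
  exists U (rho : 'rV[R]_n -> R),
    [/\ open U, U p, smooth rho,
        exists i, 'D_(delta_mx ord0 i) rho p != 0 &
        O `&` U = [set x | rho x < 0] `&` U].

Record smooth_bounded_domain n := SmoothBoundedDomain {
  dom_set :> set 'rV[R]_n ;
  dom_nonempty : dom_set !=set0 ;
  dom_open : open dom_set ;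
  dom_connected : connected dom_set ;
  dom_bounded : bounded_set dom_set ;
  dom_smooth : smooth_boundary dom_set }.

Lemma dom_measurable n (O : smooth_bounded_domain n) :
  measurable (O : set (@Rn R n)).
Proof. by apply: sub_sigma_algebra; exact: dom_open. Qed.

Definition lebesgue_dom n (O : smooth_bounded_domain n) :
    {measure set (@Rn R n) -> \bar R} :=
  mrestr (@lebesgue_Rn R n) (dom_measurable O).

End domain.
Arguments smooth_bounded_domain : clear implicits.

Section operators.
Context d (T : measurableType d) (R : realType).
Variable mu : {measure set T -> \bar R}.
Local Notation H := (L2 mu).
Implicit Types (u v w : H).

(* The value of [uop] outside [uop_dom] carries no meaning. *)
Record unbounded_op := UnboundedOp { uop_dom : set H ; uop :> H -> H }.
Implicit Type A : unbounded_op.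

Definition linear_op A :=
  uop_dom A 0 /\
  forall (a : R) u v, uop_dom A u -> uop_dom A v ->
    uop_dom A (a *: u + v) /\ A (a *: u + v) = a *: A u + A v.

Definition densely_defined A := dense (uop_dom A).

(* equality of [A] with its adjoint, domains included *)
Definition self_adjoint A := forall v w,
  (forall u, uop_dom A u -> L2dot (A u) v = L2dot u w) <->
  (uop_dom A v /\ w = A v).

Definition positive_op A := forall u, uop_dom A u -> u != 0 -> 0 < L2dot (A u) u.

Definition is_resolvent A (lam : R) (K : H -> H) :=
  [/\ continuous K,
      forall v, uop_dom A (K v) /\ A (K v) - lam *: K v = v &
      forall u, uop_dom A u -> K (A u - lam *: u) = u].

Definition compact_resolvent A := exists (lam : R) (K : H -> H),
  is_resolvent A lam K /\
  forall X : set H, bounded_set X -> precompact (K @` X).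

Definition C0_semigroup (E : R -> H -> H) :=
  [/\ forall t : R, 0 <= t -> continuous (E t) /\
        forall (a : R) u v, E t (a *: u + v) = a *: E t u + E t v,
      forall u, E 0 u = u,
      forall (s t : R) u, 0 <= s -> 0 <= t -> E (s + t) u = E s (E t u) &
      forall u, E t u @[t --> 0^'+] --> u].

(* [E t] is e^{-At}: a C0-semigroup with infinitesimal generator -A. *)
Definition generated_by_opp A (E : R -> H -> H) := C0_semigroup E /\
  forall v w, (h^-1 *: (E h v - v) @[h --> (0 : R)^'+] --> w) <->
              (uop_dom A v /\ w = - A v).

Definition eigenbasis A (e : nat -> H) (lam : nat -> R) :=
  [/\ forall k, uop_dom A (e k) /\ A (e k) = lam k *: e k,
      forall j k, L2dot (e j) (e k) = (j == k)%:R &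
      forall v, (\sum_(0 <= k < n) L2dot v (e k) *: e k) @[n --> \oo] --> v].

(* [frac_power A delta v w] : [v] is in the domain of A^delta, w = A^delta v.
   The relation does not depend on the eigenbasis. *)
Definition frac_power A (delta : R) v w :=
  exists e lam, eigenbasis A e lam /\
    (\sum_(0 <= k < n) (lam k `^ delta * L2dot v (e k)) *: e k)
      @[n --> \oo] --> w.

Definition frac_op A (delta : R) v : H := xget 0 [set w | frac_power A delta v w].

Definition frac_dom A (delta : R) := {v : H | exists w, frac_power A delta v w}.

HB.instance Definition _ A (delta : R) := gen_eqMixin (frac_dom A delta).
HB.instance Definition _ A (delta : R) := gen_choiceMixin (frac_dom A delta).
(* D(A^delta) has the metric of its norm v |-> |A^delta v|. *)
HB.instance Definition _ A (delta : R) := PseudoMetric.copy (frac_dom A delta)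
  (@initial_topology (frac_dom A delta) H (fun x => frac_op A delta (sval x))).

(* Riemann integral of an [H]-valued function; [xi] is the sequence of tags. *)
Definition is_Riemann_integral (f : R -> H) (a b : R) w :=
  forall eps : R, 0 < eps -> exists2 delta : R, 0 < delta &
  forall (s : seq R) (xi : nat -> R), itv_partition a b s ->
    (forall i, (i < size s)%N ->
      nth b s i - nth b (a :: s) i < delta /\
      nth b (a :: s) i <= xi i <= nth b s i) ->
    `| \sum_(0 <= i < size s) (nth b s i - nth b (a :: s) i) *: f (xi i) - w |
      < eps.

End operators.

(* C([-r,0]; M) with the metric of uniform convergence. *)
Definition Cspace (R : realType) (r : R) (M : pseudoMetricType R) : Type :=
  continuousType (set_type `[- r, 0]%classic) M.

HB.instance Definition _ (R : realType) (r : R) (M : pseudoMetricType R) :=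
  Choice.copy (Cspace r M) (continuousType (set_type `[- r, 0]%classic) M).
HB.instance Definition _ (R : realType) (r : R) (M : pseudoMetricType R) :=
  PseudoMetric.copy (Cspace r M) (@initial_topology (Cspace r M)
    (arrow_uniform_type (set_type `[- r, 0]%classic) M)
    (fun phi => (phi : set_type `[- r, 0]%classic -> M))).

Section delay_equation.
Context d (T : measurableType d) (R : realType).
Variable mu : {measure set T -> \bar R}.
Variable r : R.
Local Notation H := (L2 mu).
Local Notation C := (Cspace r H).
Implicit Types (phi psi : C).

Definition normC phi : R := sup (range (fun th => `|phi th|)).
Definition distC phi psi : R := sup (range (fun th => `|phi th - psi th|)).
Definition set_distC phi (K : set C) : \bar R :=
  ereal_inf [set (distC phi psi)%:E | psi in K].

(* [phi] extended by 0 outside of [-r,0] *)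
Definition Ceval phi (s : R) : H := if insub s is Some th then phi th else 0.

(* the history segment u_t (0 when u(t + .) is not continuous on [-r,0]) *)
Definition segment (u : R -> H) (t : R) : C :=
  @xget C (cst 0 : continuousType (set_type `[- r, 0]%classic) H)
    [set phi : C | forall th, phi th = u (t + val th)].

Definition delay_term (B : H -> H) (eta : C -> R) phi : H :=
  B (Ceval phi (- eta phi)).

Definition mild_solution (E : R -> H -> H) (B : H -> H) (eta : C -> R) (c : R)
    phi (tmax : R) (u : R -> H) :=
  [/\ {within `[- r, tmax], continuous u},
      forall th, u (val th) = phi th &
      forall t : R, 0 <= t <= tmax -> exists2 w,
        is_Riemann_integral
          (fun s => E (t - s) (delay_term B eta (segment u s) - c *: u s)) 0 t w &
        u t = E t (Ceval phi 0) + w].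

Definition global_mild_solution (E : R -> H -> H) (B : H -> H) (eta : C -> R)
    (c : R) phi (u : R -> H) :=
  {within `[- r, +oo[, continuous u} /\
  forall tmax, 0 < tmax -> mild_solution E B eta c phi tmax u.

Definition solution_operator (E : R -> H -> H) (B : H -> H) (eta : C -> R)
    (c : R) (S : R -> C -> C) :=
  forall phi, exists u, global_mild_solution E B eta c phi u /\
    forall t : R, 0 <= t -> S t phi = segment u t.

(* [set_distC phi set0] is +oo, so the empty set attracts nothing. *)
Definition compact_global_attractor (S : R -> C -> C) (K : set C) :=
  [/\ compact K,
      forall t : R, 0 <= t -> S t @` K = K &
      forall D : set C, (exists M, forall phi, D phi -> normC phi <= M) ->
        forall eps : R, 0 < eps -> \forall t \near +oo,
          (ereal_sup [set set_distC (S t phi) K | phi in D] <= eps%:E)%E].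

(* [K] is included in C([-r,0]; D(A^delta)) and compact for its topology *)
Definition compact_in_Cdelta (A : unbounded_op mu) (delta : R) (K : set C) :=
  (forall phi, K phi -> exists psi : Cspace r (frac_dom A delta),
     forall th, sval (psi th) = phi th) /\
  compact [set psi : Cspace r (frac_dom A delta) |
    exists2 phi, K phi & forall th, sval (psi th) = phi th].

(* [t] and [s] range over [-r,0]: the first clause bounds the supremum of the
   difference quotients, for all [phi] in Z uniformly. *)
Definition delay_condition_b (Thl eta : C -> R) :=
  let Z := [set phi | Thl phi = 0] in
  [/\ exists L : R, forall phi, Z phi ->
        forall t s, t != s -> `|phi t - phi s| / `|val t - val s| <= L,
      forall phi, Z phi -> 0 < eta phi &
      exists omega L : R, [/\ 0 < omega, 0 < L &
        let U := [set chi | exists2 nu, Z nu & distC chi nu <= omega] in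
        forall phi psi, U phi -> U psi ->
          `|eta phi - eta psi| <= L * distC phi psi]].

End delay_equation.

Notation L2dom Omega := (L2 (lebesgue_dom Omega)).

(* Main.v *)
(* A compact resolvent and the infinite dimension of L^2(Omega) give an
   orthonormal eigenbasis e_k of A with eigenvalues lam_k -> oo, on which e^{-At}
   acts by e^{-lam_k t}. All regularity is measured by the energy
   sum_k lam_k <v, e_k>^2 = |A^{1/2} v|^2, which e^{-At} makes at most |v|^2 / t
   and the Duhamel integral over an interval of length h with integrand bounded
   by M makes at most h M^2. Since B is bounded and lam_k >= l0 > 0, solutions
   decay exponentially into a fixed ball; one time unit later their energy is
   bounded, and then they are uniformly 1/2-Hoelder. This gives a compact
   absorbing set BB (Arzela-Ascoli), although S_t is not compact for small t.
   Uniqueness holds because, along two solutions with a common past, (a) or (b)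
   makes the delay term locally Lipschitz for a short time; S_t is continuous on
   BB because, by compactness, any limit of solutions is a solution. The attractor
   is the intersection of the S_{n T0} BB. Its elements have bounded energy and
   lam^{2 delta} <= M^{2 delta} + M^{2 delta - 1} lam for delta < 1/2, so on it the
   norms of L^2 and D(A^delta) define the same topology. *)
Require Import Defs.
From HB Require Import structures.
From mathcomp Require Import all_boot all_order all_algebra.
From mathcomp Require Import all_classical all_reals all_analysis.
From mathcomp Require Import measurable_realfun ring lra.
Set Implicit Arguments.
Unset Strict Implicit.
Unset Printing Implicit Defensive.
Import Order.TTheory GRing.Theory Num.Theory.
Import numFieldNormedType.Exports.
Local Open Scope classical_set_scope.
Local Open Scope ring_scope.

(** * The Hilbert space L^2 *)

(** The obstacle is that the right-hand side is merely continuous: a change of eta(u_t) moves the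
    point at which a history without Lipschitz bound is evaluated, so no Gronwall estimate gives
    continuous dependence on the data. Uniqueness is therefore proved for pairs with a common past,
    and continuity of S_t is deduced from uniqueness by compactness, which confines it to BB. For
    this reason the attractor is built from the single map S_{T0} on the compact set BB, which it
    leaves invariant, and invariance under the other S_t is recovered afterwards from the semigroup
    law.

    Mild solutions need not be differentiable, and the integrals are given only as limits of Riemann
    sums. So decay comes from a Dini-derivative argument over short steps, and energy bounds are
    proved for Riemann sums and passed to the limit. The latter works because all energy bounds are
    stated for finite partial sums, which are continuous on L^2, unlike the energy itself. *)

Lemma cvg_at_epsdelta (R : realType) (V W : normedModType R) (f : V -> W) v :
  (f @ v --> f v) <->
  (forall e, 0 < e -> exists2 dlt, 0 < dlt &
    forall w, `|v - w| < dlt -> `|f v - f w| < e).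
Proof.
split=> [/cvgrPdist_lt fv e /fv/nbhs_normP[dlt /= d0 dP]|fv].
  by exists dlt => // w; exact: dP.
apply/cvgrPdist_lt => e /fv [dlt d0 dP]; apply/nbhs_normP.
by exists dlt => // w; exact: dP.
Qed.

Lemma cvg_seq_continuous (R : realType) (V W : normedModType R) (f : V -> W)
    (x : nat -> V) v :
  continuous f -> x n @[n --> \oo] --> v -> f (x n) @[n --> \oo] --> f v.
Proof. by move=> cf xv; apply: continuous_cvg => //; exact: cf. Qed.

Section hilbert.
Context d (T : measurableType d) (R : realType).
Variable mu : {measure set T -> \bar R}.
Local Notation H := (L2 mu).
Implicit Types u v w : H.

Lemma L2fun_mulI u v :
  mu.-integrable setT (EFin \o (fun x => L2fun u x * L2fun v x)).
Proof.
apply/Lfun1_integrable; apply: Lfun2_mul_Lfun1; exact: L2fun_Lfun.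
Qed.

Lemma L2dotC u v : L2dot u v = L2dot v u.
Proof. by apply: eq_Rintegral => x _; rewrite mulrC. Qed.

Lemma L2fun_meas u : measurable_fun setT (L2fun u).
Proof. exact: Lfun_measurable (L2fun_Lfun u). Qed.

Lemma L2dotP a u v w : L2dot (a *: u + v) w = a * L2dot u w + L2dot v w.
Proof.
rewrite /L2dot -RintegralZl//; last exact: L2fun_mulI.
rewrite -RintegralD//; first last.
- exact: L2fun_mulI.
- have := integrableZl measurableT a (L2fun_mulI u w).
  by apply: eq_integrable => // x _; rewrite /= EFinM.
congr fine; apply: ae_eq_integral => //.
- by apply/measurable_EFinP; apply: measurable_funM => //; exact: L2fun_meas.
- apply/measurable_EFinP; apply: measurable_funD.
    by apply: measurable_funM => //; apply: measurable_funM; exact: L2fun_meas.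
  by apply: measurable_funM; exact: L2fun_meas.
near=> x => _; congr EFin.
rewrite (near (L2addE (L2scale a u) v) x)// (near (L2scaleE a u) x)//.
by rewrite mulrDl mulrA.
Unshelve. all: by end_near. Qed.

Lemma L2norm_sqE u : ((`|u| ^+ 2)%:E = \int[mu]_x ((L2fun u x) ^+ 2)%:E)%E.
Proof.
have := @powR_Lnorm _ _ _ mu (EFin \o L2fun u) 2.
rewrite -L2normE => /(_ _); rewrite pnatr_eq0 => /(_ isT).
have u0 : 0 <= L2norm u by exact: (normr_ge0 u).
rewrite poweR_EFin powR_mulrn// => ->.
apply: eq_integral => x _; rewrite /= powR_mulrn//.
by rewrite real_normK// num_real.
Qed.

Lemma L2dotE u : L2dot u u = `|u| ^+ 2.
Proof.
by rewrite -[RHS]/(fine (`|u| ^+ 2)%:E) L2norm_sqE.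
Qed.

Lemma L2dot0l u : L2dot 0 u = 0.
Proof. by have := L2dotP 1 0 0 u; rewrite scale1r addr0 mul1r; lra. Qed.
Lemma L2dot0r u : L2dot u 0 = 0.
Proof. by rewrite L2dotC L2dot0l. Qed.
Lemma L2dotZl a u v : L2dot (a *: u) v = a * L2dot u v.
Proof. by rewrite -[a *: u]addr0 L2dotP L2dot0l addr0. Qed.
Lemma L2dotZr a u v : L2dot u (a *: v) = a * L2dot u v.
Proof. by rewrite L2dotC L2dotZl L2dotC. Qed.
Lemma L2dotDl u v w : L2dot (u + v) w = L2dot u w + L2dot v w.
Proof. by rewrite -[u]scale1r L2dotP mul1r scale1r. Qed.
Lemma L2dotDr u v w : L2dot u (v + w) = L2dot u v + L2dot u w.
Proof. by rewrite !(L2dotC u) L2dotDl. Qed.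
Lemma L2dotNl u v : L2dot (- u) v = - L2dot u v.
Proof. by rewrite -scaleN1r L2dotZl mulN1r. Qed.
Lemma L2dotNr u v : L2dot u (- v) = - L2dot u v.
Proof. by rewrite L2dotC L2dotNl L2dotC. Qed.
Lemma L2dotBl u v w : L2dot (u - v) w = L2dot u w - L2dot v w.
Proof. by rewrite L2dotDl L2dotNl. Qed.
Lemma L2dotBr u v w : L2dot u (v - w) = L2dot u v - L2dot u w.
Proof. by rewrite L2dotDr L2dotNr. Qed.
Lemma L2dot_suml I (s : seq I) (P : pred I) (F : I -> H) v :
  L2dot (\sum_(i <- s | P i) F i) v = \sum_(i <- s | P i) L2dot (F i) v.
Proof.
by apply: (big_morph (fun u => L2dot u v)) => [x y|]; rewrite ?L2dotDl ?L2dot0l.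
Qed.
Lemma L2dot_sumr I (s : seq I) (P : pred I) (F : I -> H) v :
  L2dot v (\sum_(i <- s | P i) F i) = \sum_(i <- s | P i) L2dot v (F i).
Proof. by rewrite L2dotC L2dot_suml; apply: eq_bigr => i _; rewrite L2dotC. Qed.

Lemma L2norm_sqD u v : `|u + v| ^+ 2 = `|u| ^+ 2 + 2 * L2dot u v + `|v| ^+ 2.
Proof. by rewrite -!L2dotE L2dotDl !L2dotDr (L2dotC v u); ring. Qed.
Lemma L2norm_sqB u v : `|u - v| ^+ 2 = `|u| ^+ 2 - 2 * L2dot u v + `|v| ^+ 2.
Proof. by rewrite L2norm_sqD normrN L2dotNr; ring. Qed.

Lemma L2dot_le u v : `|L2dot u v| <= `|u| * `|v|.
Proof.
have [->|v0] := eqVneq v 0; first by rewrite L2dot0r normr0 normr0 mulr0.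
have nv : 0 < `|v| by rewrite normr_gt0.
rewrite -ler_sqr ?nnegrE ?mulr_ge0// exprMn real_normK ?num_real//.
have := sqr_ge0 `| `|v| ^+ 2 *: u - L2dot u v *: v |.
rewrite L2norm_sqB !normrZ !exprMn L2dotZl L2dotZr !real_normK ?num_real//.
set p := `|u| ^+ 2; set q := `|v| ^+ 2; set x := L2dot u v => h.
have q0 : 0 < q by rewrite exprn_gt0.
have : 0 <= q * (q * p - x ^+ 2) by rewrite /q in h *; nra.
by rewrite pmulr_rge0// subr_ge0 mulrC.
Qed.

Lemma L2dotl_continuous u : continuous (L2dot u).
Proof.
move=> v; apply/(@cvg_at_epsdelta R H R (L2dot u) v) => e e0.
exists (e / (`|u| + 1)); first by rewrite divr_gt0// ltr_wpDl.
move=> w; rewrite -L2dotBr ltr_pdivlMr ?ltr_wpDl// mulrC.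
move=> h; rewrite (le_lt_trans (L2dot_le _ _))// (le_lt_trans _ h)//.
by rewrite ler_wpM2r// lerDl.
Qed.

Lemma L2dot_cvgr (F : nat -> H) u v : F n @[n --> \oo] --> v ->
  L2dot u (F n) @[n --> \oo] --> L2dot u v.
Proof. exact: (@cvg_seq_continuous R H R _ _ _ (@L2dotl_continuous u)). Qed.

Lemma L2dot_cvgl (F : nat -> H) u v : F n @[n --> \oo] --> v ->
  L2dot (F n) u @[n --> \oo] --> L2dot v u.
Proof.
move=> Fv; rewrite (L2dotC v u).
by under eq_fun do rewrite L2dotC; exact: L2dot_cvgr.
Qed.

End hilbert.

(** * Completeness of L^2 *)

Lemma geometric_telescope (R : realType) (V : normedModType R) (f : nat -> V) (c q : R) :
  0 <= c -> 0 < q < 1 ->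
  (forall n, `|f n.+1 - f n| <= c * q ^+ n) ->
  forall n m, `|f (n + m)%N - f n| <= c * q ^+ n / (1 - q).
Proof.
move=> c0 /andP[q0 q1] fc n m; have q1' : 0 < 1 - q by lra.
suff : `|f (n + m)%N - f n| <= c * q ^+ n * (1 - q ^+ m) / (1 - q).
  move=> /le_trans; apply; rewrite ler_pM2r ?invr_gt0// ler_piMr//.
    by rewrite mulr_ge0// exprn_ge0// ltW.
  by rewrite gerBl exprn_ge0// ltW.
elim: m => [|m IH]; first by rewrite addn0 subrr normr0 expr0 subrr mulr0 mul0r.
rewrite addnS -[_ - _](subrKA (f (n + m)%N)) (le_trans (ler_normD _ _))//.
rewrite (le_trans (lerD (fc _) IH))// exprD exprS le_eqVlt; apply/orP; left.
by apply/eqP; field; rewrite gt_eqF.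
Qed.

Lemma limn_einf_le (R : realType) (v : nat -> \bar R) (N : nat) c :
  (forall n, (N <= n)%N -> (v n <= c)%E) -> (limn_einf v <= c)%E.
Proof.
move=> vc; rewrite limn_einf_lim; apply: lime_le; first exact: is_cvg_einfs.
apply: nearW => m; apply: le_trans (vc (maxn m N) (leq_maxr _ _)).
by apply: ereal_inf_lbound; exists (maxn m N) => //=; exact: leq_maxl.
Qed.

Section L2_complete.
Context d (T : measurableType d) (R : realType).
Variable mu : {measure set T -> \bar R}.
Local Notation H := (L2 mu).

(* With increments of norm at most c 4^-n, the function sum_n 4^n |f_{n+1} - f_n|^2
   is integrable, hence finite almost everywhere, and f_n(x) converges there. *)
Section fast.
Variables (u : nat -> H) (c : R).
Hypothesis c0 : 0 <= c.
Hypothesis uc : forall n, `|u n.+1 - u n| <= c * 4^-1 ^+ n.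

Let f n x := L2fun (u n) x.
Let mf n : measurable_fun setT (f n). Proof. exact: L2fun_meas. Qed.
Let dn n x : R := 4 ^+ n * (f n.+1 x - f n x) ^+ 2.
Let G x : \bar R := (\sum_(n <oo) (dn n x)%:E)%E.

Let mdn n : measurable_fun setT (EFin \o dn n).
Proof.
apply/measurable_EFinP; apply: measurable_funM => //.
by apply: measurable_funX; exact: measurable_funB.
Qed.

Let dn0 n x : (0 <= (dn n x)%:E)%E.
Proof. by rewrite lee_fin mulr_ge0 ?sqr_ge0 ?exprn_ge0. Qed.

Let fsqE n m : (\int[mu]_x ((f n x - f m x) ^+ 2)%:E = (`|u n - u m| ^+ 2)%:E)%E.
Proof.
rewrite L2norm_sqE; apply: ae_eq_integral => //.
- by apply/measurable_EFinP; apply: measurable_funX; exact: measurable_funB.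
- by apply/measurable_EFinP; apply: measurable_funX; exact: L2fun_meas.
near=> x => _; congr (EFin (_ ^+ 2)).
rewrite (near (L2addE (u n) (L2opp (u m))) x)// (near (L2scaleE (-1) (u m)) x)//.
by rewrite mulN1r.
Unshelve. all: by end_near. Qed.

Let Gint : (\int[mu]_x G x < +oo)%E.
Proof.
rewrite integral_nneseries//.
apply: (@le_lt_trans _ _ (\sum_(n <oo) (c ^+ 2 * (4^-1) ^+ n)%:E)%E).
  apply: lee_nneseries => n; first by move=> *; apply: integral_ge0 => x _; exact: dn0.
  move=> *; rewrite /dn.
  under eq_integral do rewrite EFinM.
  rewrite ge0_integralZl_EFin//; first last.
  - by apply/measurable_EFinP; apply: measurable_funX; exact: measurable_funB.
  - by move=> x _; rewrite lee_fin sqr_ge0.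
  rewrite fsqE -EFinM lee_fin.
  have -> : c ^+ 2 * 4^-1 ^+ n = 4 ^+ n * (c * 4^-1 ^+ n) ^+ 2.
    rewrite exprMn mulrCA; congr (_ * _).
    by rewrite expr2 mulrA -exprMn mulfV ?pnatr_eq0// expr1n mul1r.
  rewrite ler_pM2l ?exprn_gt0// lerXn2r ?nnegrE// mulr_ge0// exprn_ge0//.
have cg : series (geometric (c ^+ 2) (4^-1 : R)) @ \oo --> c ^+ 2 / (1 - 4^-1).
  by apply: cvg_geometric_series; rewrite ger0_norm// invf_lt1// ltr1n.
have -> : (\sum_(n <oo) (c ^+ 2 * 4^-1 ^+ n)%:E)%E =
   (c ^+ 2 / (1 - 4^-1))%:E.
  apply/cvg_lim => //.
  under eq_fun do rewrite sumEFin.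
  by apply: cvg_EFin; [exact: nearW|exact: cg].
by rewrite ltry.
Qed.

Let G0 x : (0 <= G x)%E. Proof. exact: nneseries_ge0. Qed.

Let mG : measurable_fun setT G.
Proof.
have h := @ge0_emeasurable_sum _ _ _ setT (fun n x => (dn n x)%:E) xpredT.
by apply: h => [n x _ _|n _]; [exact: dn0|exact: mdn].
Qed.

Let D := [set x | (G x < +oo)%E].

Let mD : measurable D.
Proof.
have -> : D = setT `&` G @^-1` [set` `]-oo, (+oo%E : \bar R)[ ].
  by apply/seteqP; split=> x; rewrite /D /= in_itv/=; [split|case].
by apply: mG => //; exact: emeasurable_itv.
Qed.

Let Dae : mu.-negligible (~` D).
Proof.
have /(integrable_ae measurableT) : mu.-integrable setT G.
  apply/integrableP; split=> //; under eq_integral do rewrite gee0_abs//.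
  exact: Gint.
apply: negligibleS => x /= nD; apply: contra_not nD => /(_ Logic.I).
by rewrite /D/= => Gf; rewrite ltey_eq Gf.
Qed.

Let fcvg x : D x -> cvgn (f ^~ x).
Proof.
move=> Dx; have Gf : G x \is a fin_num by rewrite ge0_fin_numE.
pose M := Num.sqrt (fine (G x)).
(* Each term of the series is at most [G x], so 4^n |f_{n+1} - f_n|^2 <= [G x] and the increments at
   x are geometric with ratio 1/2. *)
have fM n : `|f n.+1 x - f n x| <= M * 2^-1 ^+ n.
  have : dn n x <= fine (G x).
    rewrite -lee_fin fineK//; apply: le_trans (nneseries_lim_ge n.+1 _) => //.
    by rewrite big_nat_recr//= leeDr// sume_ge0.
  rewrite /dn => h.
  rewrite -ler_sqr ?nnegrE ?mulr_ge0 ?sqrtr_ge0 ?exprn_ge0//.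
  rewrite real_normK ?num_real// exprMn sqr_sqrtr ?fine_ge0//.
  have -> : (2^-1 ^+ n) ^+ 2 = (4 ^+ n)^-1 :> R.
    by rewrite exprAC exprVn (_ : 2 ^+ 2 = 4 :> R) ?exprVn//; ring.
  by rewrite ler_pdivlMr ?exprn_gt0// mulrC.
apply: cauchy_cvg; apply/cauchy_ballP => e e0.
have := @geometric_telescope R R (f ^~ x) M 2^-1 (sqrtr_ge0 _) _ fM.
have -> : 1 - 2^-1 = 2^-1 :> R by field.
move=> /(_ ltac:(lra)) tel.
have : (M * 2^-1 ^+ n / 2^-1 : R) @[n --> \oo] --> 0.
  have -> : (fun n => M * 2^-1 ^+ n / 2^-1) = geometric (M * 2) (2^-1 : R).
    by apply/funext => n; rewrite /= invrK mulrAC.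
  by apply: cvg_geometric; rewrite ger0_norm// invf_lt1// ltr1n.
move=> /cvgrPdist_lt/(_ (e / 2)); rewrite divr_gt0// => /(_ isT) [N _ NP].
have NN := NP N (leqnn _); rewrite /= sub0r normrN in NN.
have NE n : (N <= n)%N -> `|f n x - f N x| < e / 2.
  move=> Nn; have := tel N (n - N)%N; rewrite subnKC// => /le_lt_trans; apply.
  by apply: le_lt_trans NN; exact: ler_norm.
exists ([set f n x | n in [set n | (N <= n)%N]], [set f n x | n in [set n | (N <= n)%N]]).
  by split; exists N => // n; exists n.
move=> [_ _] /= [[n Nn <-] [m Nm <-]]; rewrite /ball/=.
rewrite -(subrKA (f N x)) (le_lt_trans (ler_normD _ _))// (splitr e) ltrD ?NE//.
by rewrite distrC NE.
Qed.

(** The limit is the pointwise one of [f n] set to zero outside the conull set [D], so it is defined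
    everywhere and measurable. Fatou's lemma in m, applied to the squares of [h m - f n], turns the
    telescoped bound on [u m - u n] into the bound on the limit. *)
Lemma L2_fast_cvg : exists l, forall n, `|l - u n| <= c * 4^-1 ^+ n / (1 - 4^-1).
Proof.
pose h n x := f n x * \1_D x.
pose l x := limn (h ^~ x).
have hl x : h ^~ x @ \oo --> l x.
  rewrite /l /h; have [/set_mem Dx|nD] := boolP (x \in D).
    by rewrite indicE mem_set//=; apply: is_cvgM; [exact: fcvg|exact: is_cvg_cst].
  rewrite indicE (negbTE nD)/=.
  by under eq_fun do rewrite mulr0; exact: is_cvg_cst.
have mh n : measurable_fun setT (h n).
  by apply: measurable_funM => //; exact: measurable_indic.
have ml : measurable_fun setT l by exact: (measurable_fun_cvg mh).
have q01 : 0 < (4^-1 : R) < 1 by lra.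
have tel := geometric_telescope c0 q01 uc.
have bnd n : (\int[mu]_x ((l x - f n x) ^+ 2)%:E <=
    ((c * 4^-1 ^+ n / (1 - 4^-1)) ^+ 2)%:E)%E.
  have -> : (\int[mu]_x ((l x - f n x) ^+ 2)%:E =
     \int[mu]_x (limn_einf (fun m => ((h m x - f n x) ^+ 2)%:E)))%E.
    apply: eq_integral => x _.
    have cv : (fun m => ((h m x - f n x) ^+ 2)%:E) @ \oo --> ((l x - f n x) ^+ 2)%:E.
      apply: cvg_EFin; first exact: nearW.
      by apply: cvgM; apply: cvgB; (exact: hl || exact: cvg_cst).
    rewrite (_ : limn_einf _ = limn (fun m => ((h m x - f n x) ^+ 2)%:E)).
      by apply/esym/cvg_lim.
    by apply: is_cvg_limn_einfE; apply/cvg_ex; eexists; exact: cv.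
  apply: (le_trans (fatou _ measurableT _ _)).
  - move=> m; apply/measurable_EFinP; apply: measurable_funX.
    exact: measurable_funB.
  - by move=> m x _; rewrite lee_fin sqr_ge0.
  have hfE m : (\int[mu]_x ((h m x - f n x) ^+ 2)%:E = (`|u m - u n| ^+ 2)%:E)%E.
    rewrite -fsqE; apply: ae_eq_integral => //.
    - apply/measurable_EFinP; apply: measurable_funX.
      exact: measurable_funB.
    - by apply/measurable_EFinP; apply: measurable_funX; exact: measurable_funB.
    apply: negligibleS Dae => x /= + Dx; apply => _.
    by rewrite /h indicE mem_set//= mulr1.
  under [X in (limn_einf X <= _)%E]eq_fun do rewrite hfE.
  apply: (@limn_einf_le _ _ n) => m nm; rewrite lee_fin lerXn2r ?nnegrE//.
    by rewrite !mulr_ge0 ?exprn_ge0// invr_ge0; lra.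
  by have := tel n (m - n)%N; rewrite subnKC.
have lfL n : (fun x => l x - f n x) \in Lfun mu 2%:E.
  apply/andP; rewrite !inE/=; split; first exact: measurable_funB.
  rewrite /finite_norm unlock poweR_lty//.
  apply: le_lt_trans (ltry ((c * 4^-1 ^+ n / (1 - 4^-1)) ^+ 2)).
  apply: le_trans (bnd n); rewrite le_eqVlt; apply/orP; left; apply/eqP.
  apply: eq_integral => x _; rewrite /= powR_mulrn//.
  by rewrite real_normK// num_real.
have lL : l \in Lfun mu 2%:E.
  have := Lfun2D (lfL 0%N) (L2fun_Lfun (u 0%N)).
  by under eq_fun do rewrite subrK.
exists (toL2 lL) => n.
rewrite -ler_sqr ?nnegrE//; last first.
  by rewrite !mulr_ge0 ?exprn_ge0// invr_ge0; lra.
rewrite -lee_fin; apply: le_trans (bnd n).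
rewrite L2norm_sqE le_eqVlt; apply/orP; left; apply/eqP.
apply: ae_eq_integral => //.
- by apply/measurable_EFinP; apply: measurable_funX; exact: L2fun_meas.
- by apply/measurable_EFinP; apply: measurable_funX; exact: measurable_funB.
have lLE : (\forall x \ae mu, L2fun (toL2 lL) x = l x).
  by have := toL2K lL; apply: filterS => y /(_ Logic.I).
near=> x => _; congr (EFin (_ ^+ 2)).
rewrite (near (L2addE (toL2 lL) (L2opp (u n))) x)//.
rewrite (near (L2scaleE (-1) (u n)) x)// mulN1r; congr (_ - _).
by rewrite (near lLE x).
Unshelve. all: by end_near. Qed.

End fast.
End L2_complete.

(** Centres [u n] of balls of radius 4^-n belonging to F form a fast sequence, because any two
    members of F meet; the limit of this sequence is the limit of F. *)
Lemma cauchy_fast_cvg (R : realType) (V : normedModType R) (F : set_system V) :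
  (forall (u : nat -> V) c, 0 <= c ->
     (forall n, `|u n.+1 - u n| <= c * 4^-1 ^+ n) ->
     exists l, forall n, `|l - u n| <= c * 4^-1 ^+ n / (1 - 4^-1)) ->
  ProperFilter F -> cauchy F -> cvg F.
Proof.
move=> fast FF /cauchyP Fc.
have p0 n : 0 < 4^-1 ^+ n :> R by rewrite exprn_gt0// invr_gt0.
have /choice[u uP] : forall n : nat, exists v, F (ball v (4^-1 ^+ n : R)).
  by move=> n; have [v] := Fc _ (p0 n); exists v.
have [l lP] : exists l, forall n, `|l - u n| <= 2 * 4^-1 ^+ n / (1 - 4^-1).
  apply: fast => // n.
  have [w [/= w1 w2]] := filter_ex (filterI (uP n) (uP n.+1)).
  rewrite -ball_normE/= in w1; rewrite -ball_normE/= in w2.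
  rewrite -(subrKA w) (le_trans (ler_normD _ _))// mulr_natl mulr2n lerD//.
    by rewrite (le_trans (ltW w2))// exprS ler_piMl ?ltW//; lra.
  by rewrite distrC ltW.
apply/cvg_ex; exists l; apply/cvgrPdist_lt => e e0.
(* A point of the n-th ball is at distance less than (8/3 + 1) 4^-n from [l], which 4 times 4^-n
   dominates. *)
have : (4 * 4^-1 ^+ n : R) @[n --> \oo] --> 0.
  by apply: (@cvg_geometric _ 4 4^-1); rewrite ger0_norm// invf_lt1// ltr1n.
move=> /cvgrPdist_lt/(_ _ e0)[N _ /(_ N (leqnn _))] /=.
rewrite sub0r normrN => /(le_lt_trans (ler_norm _)) NP.
apply: filterS (uP N) => w; rewrite -ball_normE/= => wN.
rewrite -(subrKA (u N)) (le_lt_trans (ler_normD _ _))//.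
have q : (1 - 4^-1)^-1 = 4 / 3 :> R by field.
by have := lP N; have := p0 N; rewrite q; lra.
Qed.

Section L2_cauchy.
Context d (T : measurableType d) (R : realType).
Variable mu : {measure set T -> \bar R}.

Lemma L2_cauchy_cvg (F : set_system (L2 mu)) : ProperFilter F -> cauchy F -> cvg F.
Proof. apply: cauchy_fast_cvg => u c c0; exact: L2_fast_cvg. Qed.

End L2_cauchy.

(** * Spectral theorem *)

Lemma linear_bounded_norm (R : realType) (V W : normedModType R) (f : V -> W) :
  linear f -> continuous f -> exists2 M, 0 < M & forall x, `|f x| <= M * `|x|.
Proof.
move=> lf cf.
have f0 : f 0 = 0 by have := lf (-1) 0 0; rewrite scaler0 addr0 scaleN1r addNr.
have fZ a x : f (a *: x) = a *: f x by rewrite -[a *: x]addr0 lf f0 addr0.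
have [dlt d0 dP] := (cvg_at_epsdelta f 0).1 (cf 0) 1 ltr01.
exists (2 / dlt); first by rewrite divr_gt0.
move=> x; have [->|x0] := eqVneq x 0; first by rewrite f0 !normr0 mulr0.
have nx : 0 < `|x| by rewrite normr_gt0.
have := dP ((dlt / 2 / `|x|) *: x).
rewrite f0 !sub0r !normrN fZ (normrZ _ x) (normrZ _ (f x)).
have -> : `|dlt / 2 / `|x| | = dlt / 2 / `|x|.
  by rewrite ger0_norm// !divr_ge0// ltW.
rewrite divfK ?gt_eqF// => /(_ ltac:(lra)) h.
rewrite -ler_pdivrMr//.
have -> : 2 / dlt = (dlt / 2)^-1 by rewrite invf_div.
rewrite -[leRHS]mul1r ler_pdivlMr ?divr_gt0//.
apply: ltW; apply: le_lt_trans h; rewrite le_eqVlt; apply/orP; left.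
by apply/eqP; field; rewrite gt_eqF.
Qed.

Lemma cluster_epsP (R : realType) (V : normedModType R) (A : set V) (x : nat -> V) :
  precompact A -> (forall n, A (x n)) ->
  exists y, forall e N, 0 < e -> exists2 n, (N <= n)%N & `|y - x n| < e.
Proof.
rewrite precompactE => cB Ax; have AB := @subset_closure _ A.
have [|y [_ yc]] := cB (x n @[n --> \oo]) _.
- by exists 0%N => // n _; exact/AB.
exists y => e N e0.
have tailN : (x n @[n --> \oo]) [set x n | n in [set n | (N <= n)%N]].
  by exists N => // n /= Nn; exists n.
have [_ [/= [n Nn <-] yn]] := yc _ _ tailN (nbhsx_ballx y e e0).
by exists n => //; move: yn; rewrite -ball_normE.
Qed.

Lemma dense_eps (R : realType) (V : normedModType R) (D : set V) (v : V) (e : R) :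
  dense D -> 0 < e -> exists2 w, D w & `|v - w| < e.
Proof.
move=> dD e0; have vb : (ball v e)^° !=set0 by exists v; exact: nbhsx_ballx.
have [w [/= wv Dw]] := dD _ vb (@open_interior _ _).
by exists w => //; move: (interior_subset wv); rewrite -ball_normE.
Qed.

Lemma normr_le_eps (R : realType) (V : normedModType R) (v : V) :
  (forall e : R, 0 < e -> `|v| <= e) -> v = 0.
Proof.
move=> h; apply/eqP; rewrite -normr_le0; apply/ler_addgt0Pr => e e0.
by rewrite add0r; exact: h.
Qed.

Section banach_steinhaus.
Context d (T : measurableType d) (R : realType).
Variable mu : {measure set T -> \bar R}.
Local Notation H := (L2 mu).

Lemma L2_banach_steinhaus (F : set (H -> H)) :
  (forall f, F f -> linear f /\ continuous f) ->
  (forall x, exists M, forall f, F f -> `|f x| <= M) ->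
  exists M, forall f, F f -> forall x, `|f x| <= M * `|x|.
Proof.
move=> Flc Fb.
(* The completeness just proved is packed into a local structure on [H], as the Banach-Steinhaus
   theorem requires. *)
pose c := @Uniform_isComplete.Build H (@L2_cauchy_cvg _ T R mu).
pose V : completeNormedModType R := HB.pack H c.
have [||M MP] := @Banach_Steinhauss R V (H : normedModType R) F _ _ 1.
- move=> f Ff; have [lf cf] := Flc _ Ff; split; last exact: lf.
  have [M M0 MP] := linear_bounded_norm lf cf => r; exists (M * r) => x xr.
  by apply: le_trans (MP x) _; rewrite ler_pM2l.
- exact: Fb.
exists M => f Ff x; have [lf _] := Flc _ Ff.
have f0 : f 0 = 0 by have := lf (-1) 0 0; rewrite scaler0 addr0 scaleN1r addNr.
have fZ a y : f (a *: y) = a *: f y by rewrite -[a *: y]addr0 lf f0 addr0.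
have [->|x0] := eqVneq x 0; first by rewrite f0 !normr0 mulr0.
have nx : 0 < `|x| by rewrite normr_gt0.
have := MP f Ff (`|x|^-1 *: x).
rewrite normrZ normfV normr_id mulVf ?gt_eqF// => /(_ (lexx _)).
by rewrite fZ normrZ normfV normr_id mulrC ler_pdivrMr.
Qed.

End banach_steinhaus.

(** * Eigenvectors of an injective compact symmetric operator *)

Section compact_symmetric.
Context d (T : measurableType d) (R : realType).
Variable mu : {measure set T -> \bar R}.
Local Notation H := (L2 mu).
Implicit Types u v w x y : H.

Variable K : H -> H.
Hypothesis Klin : linear K.
Hypothesis Kcont : continuous K.
Hypothesis Ksym : forall u v, L2dot (K u) v = L2dot u (K v).
Hypothesis Kinj : forall u, K u = 0 -> u = 0.
Hypothesis Kcomp : forall X : set H, bounded_set X -> precompact (K @` X).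
Hypothesis Hinf : forall s : seq H,
  exists2 v, v != 0 & forall w, w \in s -> L2dot v w = 0.

Let K0 : K 0 = 0.
Proof. by have := Klin (-1) 0 0; rewrite scaler0 addr0 scaleN1r addNr. Qed.
Let KZ a u : K (a *: u) = a *: K u.
Proof. by rewrite -[a *: u]addr0 Klin K0 addr0. Qed.
Let KD u v : K (u + v) = K u + K v.
Proof. by rewrite -[u]scale1r Klin !scale1r. Qed.
Let KB u v : K (u - v) = K u - K v.
Proof. by rewrite KD -scaleN1r KZ scaleN1r. Qed.

Let orth (s : seq H) v := forall w, w \in s -> L2dot v w = 0.
Let eigs (s : seq H) := forall w, w \in s -> exists c : R, K w = c *: w.

Lemma cluster_image (x : nat -> H) : (forall n, `|x n| <= 1) ->
  exists y, forall e N, 0 < e -> exists2 n, (N <= n)%N & `|y - K (x n)| < e.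
Proof.
move=> x1.
have /Kcomp Kx : bounded_set (range x).
  exists 1; split; first exact: num_real.
  by move=> M M1 _ [n _ <-]; apply: le_trans (x1 n) (ltW M1).
by apply: (cluster_epsP Kx) => n; exists (x n) => //; exists n.
Qed.

(* A limit y of K(x_n) along a sequence of unit vectors maximizing |K x| satisfies
   K^2 y = sp^2 y; so either y belongs to the eigenvalue -sp, or K y + sp y is an
   eigenvector for sp. *)
Lemma next_eigenvector (s : seq H) : eigs s -> exists ev : H * R,
  [/\ `|ev.1| = 1, orth s ev.1, K ev.1 = ev.2 *: ev.1 &
      forall x, orth s x -> `|K x| <= `|ev.2| * `|x|].
Proof.
move=> es.
have Korth x : orth s x -> orth s (K x).
  move=> ox w ws; have [c Kw] := es _ ws.
  by rewrite Ksym Kw L2dotZr ox// mulr0.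
have oZ a x : orth s x -> orth s (a *: x).
  by move=> ox w ws; rewrite L2dotZl ox// mulr0.
have oD x y : orth s x -> orth s y -> orth s (x + y).
  by move=> ox oy w ws; rewrite L2dotDl ox// oy// addr0.
have [M M0 KM] := linear_bounded_norm Klin Kcont.
pose X := [set `|K x| | x in [set x | orth s x /\ `|x| <= 1]].
have hsX : has_sup X.
  split.
    exists `|K 0|, 0 => //; split; last by rewrite normr0.
    by move=> w _; rewrite L2dot0l.
  exists M => _ [x [_ x1] <-]; apply: le_trans (KM x) _.
  by rewrite ler_piMr// ltW.
set sp := sup X.
have spP x : orth s x -> `|K x| <= sp * `|x|.
  move=> ox; have [->|x0] := eqVneq x 0; first by rewrite K0 !normr0 mulr0.
  have nx : 0 < `|x| by rewrite normr_gt0.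
  have : `|K (`|x|^-1 *: x)| <= sp.
    apply: sup_upper_bound => //; exists (`|x|^-1 *: x) => //; split; first exact: oZ.
    by rewrite normrZ normfV normr_id mulVf ?gt_eqF.
  by rewrite KZ normrZ normfV normr_id mulrC ler_pdivrMr.
(* Infinite dimension provides a nonzero vector orthogonal to the eigenvectors already found, and
   injectivity keeps its image nonzero. *)
have sp0 : 0 < sp.
  have [v v0 ov] := Hinf s; have := spP v ov.
  have nv : 0 < `|v| by rewrite normr_gt0.
  move=> h; rewrite -(pmulr_lgt0 _ nv); apply: lt_le_trans h.
  by rewrite normr_gt0; apply/eqP => /Kinj /eqP; rewrite (negbTE v0).
have /choice[x xP] : forall n : nat, exists x,
    [/\ orth s x, `|x| <= 1 & sp - n.+1%:R^-1 < `|K x| ].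
  move=> n; have n0 : 0 < n.+1%:R^-1 :> R by rewrite invr_gt0.
  by have [_ [x [ox x1] <-] h] := sup_adherent n0 hsX; exists x.
have [y yP] : exists y, forall e N, 0 < e -> exists2 n, (N <= n)%N & `|y - K (x n)| < e.
  by apply: cluster_image => n; have [] := xP n.
have oy : orth s y.
  move=> w ws; apply: (@normr_le_eps R R) => e e0.
  have w0 : 0 < `|w| + 1 by rewrite ltr_wpDl.
  have [n _ yn] := yP (e / (`|w| + 1)) 0%N (divr_gt0 e0 w0).
  have [ox _ _] := xP n.
  have -> : L2dot y w = L2dot (y - K (x n)) w by rewrite L2dotBl (Korth _ ox)// subr0.
  rewrite (le_trans (L2dot_le _ _))// (le_trans (ler_wpM2r _ (ltW yn)))//.
  by rewrite mulrAC ler_pdivrMr// ler_pM2l// lerDl.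
have invN e : 0 < e -> exists N : nat, forall n, (N <= n)%N -> n.+1%:R^-1 < e :> R.
  move=> e0; have := near_infty_natSinv_lt (PosNum e0).
  by move=> [N _ NP]; exists N => n Nn; exact: NP.
have y0 : y != 0.
  have s3 : 0 < sp / 3 by rewrite divr_gt0.
  have [N NP] := invN _ s3.
  have [n /NP n3 yn] := yP _ N s3.
  have [_ _ Kx] := xP n.
  rewrite -normr_gt0; have := ler_normB y (y - K (x n)).
  rewrite opprB addrCA subrr addr0; move: n3 yn Kx; set q := n.+1%:R^-1.
  lra.
(* By symmetry |K K x_n - sp^2 x_n|^2 <= sp^2 (sp^2 - |K x_n|^2), which tends to 0. Since y is near
   K x_n and not near x_n, one more K is applied to this difference. The constant [c] collects the
   factors of the three errors and 1 to spare. *)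
have KKy : K (K y) = sp ^+ 2 *: y.
  apply/eqP; rewrite -subr_eq0; apply/eqP; apply: normr_le_eps => e e0.
  pose c := M * M + M + sp ^+ 2 + 1.
  have M20 : 0 <= M * M by rewrite mulr_ge0// ltW.
  have sp20 : 0 < sp ^+ 2 by rewrite exprn_gt0.
  have c0 : 0 < c by rewrite /c; lra.
  have ec : 0 < e / c by rewrite divr_gt0.
  have q0 : 0 < (e / c) ^+ 2 / (2 * sp ^+ 3).
    by rewrite divr_gt0 ?exprn_gt0// mulr_gt0// exprn_gt0.
  have [N NP] := invN _ q0.
  have [n /NP nN yn] := yP _ N ec.
  have [ox x1 Kx] := xP n.
  have dfct : `|K (K (x n)) - sp ^+ 2 *: x n| <= e / c.
    rewrite -ler_sqr ?nnegrE ?(ltW ec)//.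
    rewrite L2norm_sqB L2dotZr Ksym L2dotE normrZ exprMn (ger0_norm (ltW sp20)).
    have := spP _ (Korth _ ox) => h1; have h2 := spP _ ox.
    have k0 : 0 <= `|K (x n)| by [].
    have kk0 : 0 <= `|K (K (x n))| by [].
    have x0 : 0 <= `|x n| by [].
    move: nN; rewrite ltr_pdivlMr ?mulr_gt0 ?exprn_gt0//; move: Kx.
    set q := n.+1%:R^-1; move: x1 h1 h2 k0 kk0 x0.
    set a := `|x n|; set b := `|K (x n)|; set g := `|K (K (x n))|.
    move=> a1 gb ba b0 g0 a0 bq qe.
    have bs : b <= sp by apply: le_trans ba _; rewrite ler_piMr// ltW.
    have g2 : g ^+ 2 <= sp ^+ 2 * b ^+ 2.
      by rewrite -exprMn lerXn2r// nnegrE// mulr_ge0// ltW.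
    have a2 : a ^+ 2 <= 1 by rewrite expr_le1.
    have s4 : (sp ^+ 2) ^+ 2 * a ^+ 2 <= (sp ^+ 2) ^+ 2.
      by rewrite ler_piMr// exprn_ge0// ltW.
    have : sp ^+ 2 * (sp ^+ 2 - b ^+ 2) <= 2 * sp ^+ 3 * q.
      have -> : 2 * sp ^+ 3 * q = sp ^+ 2 * (2 * sp * q) by ring.
      rewrite ler_pM2l//; nra.
    lra.
  have -> : K (K y) - sp ^+ 2 *: y =
      K (K (y - K (x n))) + (K (K (K (x n)) - sp ^+ 2 *: x n) -
      sp ^+ 2 *: (y - K (x n))).
    rewrite !KB KZ scalerBr opprB !addrA; congr (_ - _).
    by rewrite subrK subrK.
  have sE : `|sp ^+ 2 *: (y - K (x n))| <= sp ^+ 2 * (e / c).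
    by rewrite normrZ (ger0_norm (ltW sp20)) ler_pM2l// ltW.
  have KE : `|K (K (K (x n)) - sp ^+ 2 *: x n)| <= M * (e / c).
    by apply: le_trans (KM _) _; rewrite ler_pM2l.
  have KKE : `|K (K (y - K (x n)))| <= M * M * (e / c).
    apply: le_trans (KM _) _; rewrite -mulrA ler_pM2l//.
    by apply: le_trans (KM _) _; rewrite ler_pM2l// ltW.
  apply: le_trans (ler_normD _ _) _.
  apply: le_trans (lerD KKE (le_trans (ler_normB _ _) (lerD KE sE))) _.
  have -> : M * M * (e / c) + (M * (e / c) + sp ^+ 2 * (e / c)) = (c - 1) * (e / c).
    by rewrite /c; ring.
  by rewrite mulrBl mulrC divfK ?gt_eqF// mul1r lerBlDr lerDl ltW.
have nrm z c : z != 0 -> orth s z -> K z = c *: z -> `|c| = sp ->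
    exists ev : H * R, [/\ `|ev.1| = 1, orth s ev.1, K ev.1 = ev.2 *: ev.1 &
      forall x, orth s x -> `|K x| <= `|ev.2| * `|x|].
  move=> z0 oz Kz cE; have nz : `|z| != 0 by rewrite normr_eq0.
  exists (`|z|^-1 *: z, c); split => /=.
  - by rewrite normrZ normfV normr_id mulVf.
  - exact: oZ.
  - by rewrite KZ Kz scalerA mulrC -scalerA.
  - by rewrite cE.
have [z0|z0] := eqVneq (K y + sp *: y) 0.
  apply: (nrm y (- sp)) => //; last by rewrite normrN gtr0_norm.
  by rewrite scaleNr; apply/eqP; rewrite -addr_eq0 z0.
apply: (nrm (K y + sp *: y) sp) => //; last by rewrite gtr0_norm.
  by apply: oD; [exact: Korth|exact: oZ].
by rewrite KD KKy KZ scalerDr scalerA addrC expr2.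
Qed.

(** [next_eigenvector] is iterated on the list [l n] of the first n eigenvectors. The last clause
    records the maximality of each choice: it makes |m n| nonincreasing and later yields
    completeness of the system. *)
Lemma eigensystem : exists (e : nat -> H) (m : nat -> R),
  [/\ forall n, K (e n) = m n *: e n,
      forall j k, L2dot (e j) (e k) = (j == k)%:R &
      forall n x, (forall k, (k < n)%N -> L2dot x (e k) = 0) ->
        `|K x| <= `|m n| * `|x|].
Proof.
have /choice[nxt nxtP] : forall s, exists ev : H * R, eigs s ->
    [/\ `|ev.1| = 1, orth s ev.1, K ev.1 = ev.2 *: ev.1 &
      forall x, orth s x -> `|K x| <= `|ev.2| * `|x|].
  move=> s; have [/next_eigenvector[ev evP]|ns] := pselect (eigs s).
    by exists ev.
  by exists (0, 0).
pose l := fix l n := if n is k.+1 then rcons (l k) (nxt (l k)).1 else [::].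
have el n : eigs (l n).
  elim: n => [//|n IH] w; rewrite mem_rcons inE => /predU1P[->|]; last exact: IH.
  by exists (nxt (l n)).2; have [] := nxtP _ IH.
have lS n : l n.+1 = rcons (l n) (nxt (l n)).1 by [].
have lE n w : w \in l n <-> exists2 k, (k < n)%N & w = (nxt (l k)).1.
  elim: n => [|n IH]; first by split => // -[].
  rewrite lS mem_rcons inE; split=> [/predU1P[->|/IH[k kn ->]]|[k + wE]].
  - by exists n.
  - by exists k => //; rewrite ltnW.
  - rewrite ltnS leq_eqVlt => /predU1P[kn|kn]; first by rewrite wE kn eqxx.
    by rewrite (IH.2 _) ?orbT//; exists k.
exists (fun n => (nxt (l n)).1), (fun n => (nxt (l n)).2); split.
- by move=> n; have [] := nxtP _ (el n).
- have lt j k : (k < j)%N -> L2dot (nxt (l j)).1 (nxt (l k)).1 = 0.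
    by move=> kj; have [_ o _ _] := nxtP _ (el j); apply: o; apply/lE; exists k.
  move=> j k; have [jk|kj|->] := ltngtP j k.
  - by rewrite L2dotC lt.
  - by rewrite lt.
  - by rewrite L2dotE; have [-> _ _ _] := nxtP _ (el k); rewrite expr1n.
- move=> n x ox; have [_ _ _ h] := nxtP _ (el n); apply: h.
  by move=> w /lE[k kn ->]; exact: ox.
Qed.

End compact_symmetric.

Section orthonormal.
Context d (T : measurableType d) (R : realType).
Variable mu : {measure set T -> \bar R}.
Local Notation H := (L2 mu).
Implicit Types u v w x y : H.
Variable e : nat -> H.
Hypothesis eo : forall j k, L2dot (e j) (e k) = (j == k)%:R.

Definition oproj n v : H := \sum_(0 <= k < n) L2dot v (e k) *: e k.

Lemma sum_delta (c : nat -> R) n k :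
  \sum_(0 <= j < n) c j * (j == k)%:R = if (k < n)%N then c k else 0.
Proof.
elim: n => [|n IH]; first by rewrite big_geq.
rewrite big_nat_recr//= IH [in RHS]ltnS [in RHS]leq_eqVlt (eq_sym n k).
have [->|nk] := eqVneq k n; first by rewrite ltnn mulr1 add0r.
by rewrite mulr0 addr0.
Qed.

Lemma dot_osum (c : nat -> R) n k :
  L2dot (\sum_(0 <= j < n) c j *: e j) (e k) = if (k < n)%N then c k else 0.
Proof.
by rewrite L2dot_suml; under eq_bigr do rewrite L2dotZl eo; exact: sum_delta.
Qed.

Lemma norm_osum (c : nat -> R) n :
  `|\sum_(0 <= j < n) c j *: e j| ^+ 2 = \sum_(0 <= j < n) c j ^+ 2.
Proof.
rewrite -L2dotE L2dot_sumr; apply: eq_big_nat => j /andP[_ jn].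
by rewrite L2dotZr dot_osum jn expr2.
Qed.

Lemma dot_oproj n v k : L2dot (oproj n v) (e k) = if (k < n)%N then L2dot v (e k) else 0.
Proof. exact: dot_osum. Qed.

Lemma oproj_pythagoras n v : `|v| ^+ 2 = `|v - oproj n v| ^+ 2 + `|oproj n v| ^+ 2.
Proof.
have vP : L2dot v (oproj n v) = `|oproj n v| ^+ 2.
  rewrite norm_osum L2dot_sumr; apply: eq_bigr => j _.
  by rewrite L2dotZr expr2.
by rewrite L2norm_sqB vP; ring.
Qed.

Lemma bessel n v : \sum_(0 <= k < n) L2dot v (e k) ^+ 2 <= `|v| ^+ 2.
Proof. by rewrite -norm_osum (oproj_pythagoras n v) lerDr sqr_ge0. Qed.

Lemma oproj_res_le n v : `|v - oproj n v| <= `|v|.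
Proof.
by rewrite -ler_sqr ?nnegrE// [leRHS](oproj_pythagoras n) lerDl sqr_ge0.
Qed.

Lemma oprojB n u v : oproj n (u - v) = oproj n u - oproj n v.
Proof. by rewrite -sumrB; apply: eq_bigr => k _; rewrite L2dotBl scalerBl. Qed.

(** The residual map v - [oproj e n v] is linear and does not increase norms, uniformly in n, so
    convergence spreads from a dense set. *)
Lemma oproj_cvg_dense (D : set H) : dense D ->
  (forall v, D v -> oproj n v @[n --> \oo] --> v) ->
  forall v, oproj n v @[n --> \oo] --> v.
Proof.
move=> dD Dv v; apply/cvgrPdist_lt => eps eps0.
have [w Dw wv] := dense_eps v dD (divr_gt0 eps0 (ltr0n _ 2)).
have /cvgrPdist_lt/(_ (eps / 2)) := Dv w Dw.
rewrite divr_gt0// => /(_ isT) [N _ NP]; exists N => // n /NP /= wn.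
rewrite -[v - _](subrKA w).
have -> : v - w + (w - oproj n v) = (v - w - oproj n (v - w)) + (w - oproj n w).
  by rewrite oprojB opprB -[RHS]addrA; congr (_ + _); rewrite [RHS]addrC subrKA.
rewrite (le_lt_trans (ler_normD _ _))// (splitr eps) ltrD//.
by rewrite (le_lt_trans (oproj_res_le _ _)).
Qed.

End orthonormal.

Section eigenbasis.
Context d (T : measurableType d) (R : realType).
Variable mu : {measure set T -> \bar R}.
Local Notation H := (L2 mu).
Implicit Types u v w x y : H.
Variable A : unbounded_op mu.
Hypotheses (Alin : linear_op A) (Aden : densely_defined A)
  (Asa : self_adjoint A) (Apos : positive_op A) (Acr : compact_resolvent A).
Hypothesis Hinf : forall s : seq H,
  exists2 v, v != 0 & forall w, w \in s -> L2dot v w = 0.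

Lemma self_adjoint_sym u v : uop_dom A u -> uop_dom A v -> L2dot (A u) v = L2dot u (A v).
Proof. by move=> Du Dv; have /(_ _ Du) := (Asa v (A v)).2 (conj Dv erefl). Qed.

(** An eigenvector of the resolvent [K] for m is one of A for l + 1/m. Compactness gives m_k -> 0:
    otherwise the orthogonal vectors m_k e_k would keep a fixed distance from each other and have no
    cluster point. Completeness need only be checked on the domain, where v = K w and |K (w - P_n
    w)| <= |m_n| |w|. *)
Lemma exists_eigenbasis : exists (e : nat -> H) (lam : nat -> R),
  [/\ eigenbasis A e lam, forall k, 0 < lam k &
      forall M, exists N, forall n, (N <= n)%N -> M <= lam n].
Proof.
have [l [K [[Kcont KR KL] Kcomp]]] := Acr.
have domB u v a : uop_dom A u -> uop_dom A v ->
    uop_dom A (a *: u + v) /\ A (a *: u + v) = a *: A u + A v.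
  by move=> Du Dv; exact: Alin.2.
have Klin : linear K.
  move=> a u v; have [Du Au] := KR u; have [Dv Av] := KR v.
  have [Dw Aw] := domB _ _ a Du Dv.
  rewrite -[RHS](KL _ Dw) Aw; congr K.
  rewrite -{1}Au -{1}Av scalerBr scalerDr opprD !scalerA.
  by rewrite [l * a]mulrC addrACA.
have Ksym u v : L2dot (K u) v = L2dot u (K v).
  have [Du Au] := KR u; have [Dv Av] := KR v.
  rewrite -{1}Av -{2}Au L2dotBr L2dotBl L2dotZl L2dotZr self_adjoint_sym//.
have Kinj u : K u = 0 -> u = 0.
  have [_ Au] := KR u => Ku0; rewrite -Au Ku0 scaler0 subr0.
  have [D0 _] := KR u; rewrite Ku0 in D0.
  by have [_] := domB _ _ (-1) D0 D0; rewrite scaler0 addr0 scaleN1r addNr.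
have [e [m [Ke eo Ko]]] := eigensystem Klin Kcont Ksym Kinj Kcomp Hinf.
have K0 : K 0 = 0.
  by have := Klin (-1) 0 0; rewrite scaler0 addr0 scaleN1r addNr.
have KZ a u : K (a *: u) = a *: K u by rewrite -[a *: u]addr0 Klin K0 addr0.
have KD u v : K (u + v) = K u + K v by rewrite -[u]scale1r Klin !scale1r.
have ne n : `|e n| = 1.
  by apply/eqP; rewrite -(@eqrXn2 _ 2)//; rewrite -L2dotE eo eqxx expr1n.
have e0 n : e n != 0 by rewrite -normr_eq0 ne oner_eq0.
have m0 n : m n != 0.
  apply/eqP => mn; have := Ke n; rewrite mn scale0r => /Kinj/eqP.
  by rewrite (negbTE (e0 n)).
have mdec j k : (j <= k)%N -> `|m k| <= `|m j|.
  move=> jk; have := Ko j (e k); rewrite Ke normrZ !ne !mulr1; apply => i ij.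
  by rewrite eo gtn_eqF// (leq_trans ij).
have mlim eps : 0 < eps -> exists N, forall n, (N <= n)%N -> `|m n| < eps.
  move=> eps0; apply: contrapT => /forallNP h.
  have big n : eps <= `|m n|.
    rewrite leNgt; apply/negP => mn; apply: (h n) => k nk.
    exact: le_lt_trans (mdec _ _ nk) mn.
  have [y yP] : exists y, forall e' N, 0 < e' ->
      exists2 n, (N <= n)%N & `|y - K (e n)| < e'.
    by apply: cluster_image => // n; rewrite ne.
  have eps2 : 0 < eps / 2 by rewrite divr_gt0.
  have [i _ yi] := yP _ 0%N eps2; have [j ij yj] := yP _ i.+1 eps2.
  have : `|K (e i) - K (e j)| < eps.
    rewrite -(subrKA y) (le_lt_trans (ler_normD _ _))// (splitr eps) ltrD//.
    by rewrite distrC.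
  rewrite -ltr_sqr ?nnegrE ?(ltW eps0)// L2norm_sqB Ke Ke L2dotZl L2dotZr eo.
  rewrite (ltn_eqF ij) !mulr0 subr0 !normrZ !ne !mulr1.
  have := big i; rewrite -ler_sqr ?nnegrE ?(ltW eps0)//.
  have : 0 <= `|m j| ^+ 2 by rewrite sqr_ge0.
  lra.
pose lam k := l + (m k)^-1.
have De k : uop_dom A (e k).
  have [Dk _] := KR (e k); rewrite Ke in Dk.
  have [+ _] := domB _ _ (m k)^-1 Dk Alin.1.
  by rewrite addr0 scalerA mulVf// scale1r.
have Ae k : A (e k) = lam k *: e k.
  have [_] := KR (e k); rewrite Ke.
  have [_] := domB _ _ (m k) (De k) Alin.1.
  have A0 : A 0 = 0.
    have [_] := domB _ _ (-1) Alin.1 Alin.1.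
    by rewrite scaler0 addr0 scaleN1r addNr.
  rewrite A0 !addr0 => -> h; apply: (scalerI (m0 k)).
  move/eqP: h; rewrite subr_eq => /eqP ->.
  rewrite !scalerA -[X in X + _]scale1r -scalerDl /lam mulrDr mulfV//.
  by rewrite [1 + _]addrC [l * _]mulrC.
have eb : eigenbasis A e lam.
  split; [by move=> k; split|exact: eo|].
  apply: (oproj_cvg_dense eo Aden) => v Dv.
  pose w := A v - l *: v; have Kw : K w = v by exact: KL.
  have KP n : K (oproj e n w) = oproj e n (K w).
    rewrite /oproj (big_morph K KD K0); apply: eq_bigr => k _.
    by rewrite KZ Ke scalerA Ksym Ke L2dotZr mulrC.
  apply/cvgrPdist_lt => eps eps0.
  have [N NP] := mlim (eps / (`|w| + 1)) (divr_gt0 eps0 (ltr_wpDl (normr_ge0 _) ltr01)).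
  exists N => // n /= Nn; rewrite -Kw -KP -scaleN1r addrC -Klin scaleN1r addrC.
  rewrite (le_lt_trans (Ko n _ _))//.
    by move=> k kn; rewrite L2dotBl dot_oproj// kn subrr.
  rewrite (le_lt_trans (ler_wpM2l (normr_ge0 _) (oproj_res_le eo _ _)))//.
  have := NP n Nn; rewrite ltr_pdivlMr ?ltr_wpDl//; apply: le_lt_trans.
  by rewrite ler_wpM2l// lerDl.
have lam0 k : 0 < lam k.
  by have := Apos (De k) (e0 k); rewrite Ae L2dotZl eo eqxx mulr1.
exists e, lam; split => // M.
have c0 : 0 < (`|M| + `|l| + 1)^-1 by rewrite invr_gt0 ltr_wpDl// addr_ge0.
have [N NP] := mlim _ c0; exists N => n /NP mn.
(* The number 1/m_n is large in absolute value, and positivity of [lam n] = l + 1/m_n excludes the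
   negative sign. *)
have : `|M| + `|l| + 1 < `|(m n)^-1|.
  by rewrite normfV -[ltLHS]invrK ltf_pV2 ?posrE ?normr_gt0.
have := ler_norm M; have := lam0 n; rewrite /lam.
have := ler_norm l; have := ler_norm (- l); rewrite normrN.
have := real_ltgt0P (num_real (m n)^-1).
case=> [p|p|p]; lra.
Qed.

End eigenbasis.

(** * Infinite dimension of L^2(Omega) *)

Section infinite_dimension.
Context d (T : measurableType d) (R : realType).
Variable mu : {measure set T -> \bar R}.
Local Notation H := (L2 mu).

Lemma indic_Lfun2 (F : set T) : measurable F -> (mu F < +oo)%E ->
  \1_F \in Lfun mu 2%:E.
Proof.
move=> mF Foo; apply/andP; rewrite !inE/=; split; first exact: measurable_indic.
rewrite /finite_norm unlock poweR_lty//.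
rewrite (eq_integral (fun x => (\1_F x)%:E)) ?integral_indic ?setIT// => x _ /=.
rewrite powR_mulrn// indicE; by case: (x \in F); rewrite ?normr1 ?normr0 ?expr1n ?expr0n.
Qed.

(** Orthogonality to n given vectors imposes n linear conditions on the combinations of n+1
    indicators, so a nontrivial combination satisfies them. It is a nonzero function because the
    indicators are orthogonal with positive norms. *)
Lemma disjoint_infinite_dimension (F : nat -> set T) :
  (forall k, measurable (F k)) -> (forall k, (0 < mu (F k) < +oo)%E) ->
  (forall j k, j != k -> F j `&` F k = set0) ->
  forall s : seq H, exists2 v : H, v != 0 & forall w, w \in s -> L2dot v w = 0.
Proof.
move=> mF Fpos Fdis s.
have FL k : \1_(F k) \in Lfun mu 2%:E.
  by apply: indic_Lfun2 => //; have /andP[] := Fpos k.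
pose f k : H := toL2 (FL k).
have fE k : \forall x \ae mu, L2fun (f k) x = \1_(F k) x.
  by have := toL2K (FL k); apply: filterS => y /(_ Logic.I).
have dotf j k : L2dot (f j) (f k) = (j == k)%:R * fine (mu (F k)).
  have -> : L2dot (f j) (f k) = fine (\int[mu]_x (\1_(F j `&` F k) x)%:E)%E.
    congr fine; apply: ae_eq_integral => //.
    - by apply/measurable_EFinP; apply: measurable_funM; exact: L2fun_meas.
    - by apply/measurable_EFinP; apply: measurable_indic; exact: measurableI.
    near=> x => _; congr EFin.
    by rewrite (near (fE j) x)// (near (fE k) x)// indicI.
  rewrite integral_indic ?setIT//; last exact: measurableI.
  have [->|jk] := eqVneq j k; first by rewrite setIid mul1r.
  by rewrite Fdis// measure0 mul0r.
pose n := size s.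
pose M : 'M[R]_(n.+1, n) := \matrix_(i, j) L2dot (f i) s`_j.
have : kermx M != 0.
  rewrite kermx_eq0 /row_free neq_ltn; apply/orP; left.
  by rewrite ltnS rank_leq_col.
case/rowV0Pn => c /sub_kermxP cM c0.
exists (\sum_(i < n.+1) c 0 i *: f i).
  apply: contraNneq c0 => v0; apply/eqP/rowP => i; rewrite mxE.
  have : L2dot (\sum_(i < n.+1) c 0 i *: f i) (f i) = 0 by rewrite v0 L2dot0l.
  rewrite L2dot_suml (bigD1 i)//= big1 ?addr0; last first.
    move=> j ji; rewrite L2dotZl dotf.
    by rewrite (negbTE (_ : j != i :> nat)) ?mul0r ?mulr0.
  rewrite L2dotZl dotf eqxx mul1r => /eqP; rewrite mulf_eq0 => /orP[/eqP//|].
  by rewrite gt_eqF// fine_gt0.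
move=> w /(nthP 0)[j jn <-].
rewrite L2dot_suml; have /rowP/(_ (Ordinal jn)) h := cM.
transitivity ((c *m M) 0 (Ordinal jn)); last by rewrite h mxE.
by rewrite mxE; apply: eq_bigr => i _; rewrite L2dotZl !mxE.
Unshelve. all: by end_near. Qed.

End infinite_dimension.

Section boxes.
Context {R : realType}.
Local Notation RT := (measurableTypeR R).

Definition tbox n (a b : nat -> R) : set (n.-tuple RT) :=
  [set t | forall i : 'I_n, a i < tnth t i < b i].

Lemma measurable_tbox n a b : measurable (@tbox n a b).
Proof.
rewrite (_ : tbox _ _ = \bigcap_(i in [set: 'I_n])
    ((@tnth n RT)^~ i @^-1` `]a i, b i[%classic)); last first.
  by apply/seteqP; split=> t h i; have := h i; rewrite /= in_itv/=; [|apply].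
apply: fin_bigcap_measurable => // i _.
by rewrite -[X in measurable X]setTI; apply: measurable_tnth.
Qed.

Lemma lebt_tbox n a b : (forall i, a i < b i) -> (0 < lebt n (tbox a b) < +oo)%E.
Proof.
elim: n a b => [|n IH] a b ab.
  rewrite /= /leb0 diracE mem_set ?lte01 ?ltry//.
  by move=> [].
rewrite /= /lebS /image_measure /pushforward.
have -> : @tcons R n @^-1` tbox a b =
    `]a 0%N, b 0%N[%classic `*` tbox (fun i => a i.+1) (fun i => b i.+1).
  apply/seteqP; split=> [[x t] h|[x t] [/= h1 h2] i].
    split => /=; first by have := h ord0; rewrite in_itv.
    by move=> i; have := h (lift ord0 i); rewrite /= !(tnth_nth 0)/=.
  case: (unliftP ord0 i) => [j ->|->]; first by have := h2 j; rewrite !(tnth_nth 0).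
  by rewrite in_itv in h1.
have /andP[h1 h2] := IH _ _ (fun i => ab i.+1).
set X := (X in (_ < X < _)%E).
have -> : X = (lebesgue_measure (`]a 0%N, b 0%N[%classic : set R) *
    lebt n (tbox (fun i => a i.+1) (fun i => b i.+1)))%E.
  by apply: product_measure1E => //; exact: measurable_tbox.
rewrite lebesgue_measure_itv/= lte_fin ab -EFinD.
by rewrite mule_gt0 ?lte_fin ?subr_gt0//= lte_mul_pinfty// ?lee_fin ?subr_ge0 ?ltW.
Qed.

(** A ball inside the domain contains infinitely many disjoint boxes: the first coordinate of the
    k-th one ranges between x_0 + e/(k+2) and x_0 + e/(k+1). In dimension 0 there is no coordinate
    to slice. *)
Lemma dom_infinite_dimension n (O : smooth_bounded_domain R n) : (0 < n)%N ->
  forall s : seq (L2dom O), exists2 v, v != 0 & forall w, w \in s -> L2dot v w = 0.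
Proof.
case: n O => // n O _.
have [x Ox] := dom_nonempty O.
have /nbhs_ballP[e /= e0 eO] : nbhs x (dom_set O).
  by apply: open_nbhs_nbhs; split => //; exact: dom_open.
pose a k i := x ord0 (inord i) + (if i == 0%N then e / k.+2%:R else 0).
pose b k i := x ord0 (inord i) + (if i == 0%N then e / k.+1%:R else e).
have ab k i : a k i < b k i.
  rewrite /a /b ltrD2l; case: ifP => // _.
  by rewrite ltr_pM2l// ltf_pV2 ?posrE// ltr_nat.
pose F k : set (@Rn R n.+1) := [set y | forall i : 'I_n.+1, a k i < y ord0 i < b k i].
have FO k : F k `<=` dom_set O.
  move=> y Fy; apply: eO; split=> // i j; have -> : i = ord0 := ord1 i; rewrite /ball/= distrC.
  have := Fy j; rewrite /a /b inord_val ltr_distlC.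
  have k1 : e / k.+1%:R <= e by rewrite ler_pdivrMr// ler_peMr ?ler1n// ltW.
  have k2 : 0 < e / k.+2%:R by rewrite divr_gt0.
  move: k1 k2; set p := e / k.+1%:R; set q := e / k.+2%:R => k1 k2.
  move: (x ord0 j) (y ord0 j) => xj yj.
  by case: ifP => _ /andP[h1 h2]; apply/andP; split; lra.
have mF k : measurable (F k).
  suff : open (F k : set 'rV[R]_n.+1) by exact: sub_sigma_algebra.
  rewrite openE => y Fy; rewrite /interior.
  have : \forall z \near (y : 'rV[R]_n.+1), forall i : 'I_n.+1,
      a k i < (z : 'rV[R]_n.+1) ord0 i < b k i.
    apply: (@filter_forall _ 'I_n.+1
      (fun i (z : 'rV[R]_n.+1) => a k i < z ord0 i < b k i) (nbhs y)) => i.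
    have : (`]a k i, b k i[%classic : set R) (y ord0 i) by rewrite /= in_itv/= Fy.
    move=> yi; have oi : nbhs (y ord0 i) (`]a k i, b k i[%classic : set R).
      by apply: open_nbhs_nbhs; split => //; exact: interval_open.
    have := @coord_continuous R 1 n.+1 ord0 i y _ oi.
    move=> h; apply: (@filterS _ (nbhs y) _ _ _ _ h) => z /=.
    by rewrite in_itv.
  exact.
apply: (@disjoint_infinite_dimension _ _ R (lebesgue_dom O) F mF).
  move=> k; rewrite /lebesgue_dom /= /mrestr (setIidl (FO k)).
  rewrite /lebesgue_Rn /image_measure /pushforward.
  have -> : @row_of_tuple R n.+1 @^-1` F k = tbox (a k) (b k).
    by apply/seteqP; split=> t h i; have := h i; rewrite mxE.
  exact: lebt_tbox.
suff lt j k : (j < k)%N -> F j `&` F k = set0.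
  by move=> j k; rewrite neq_ltn => /orP[/lt//|/lt]; rewrite setIC.
move=> jk; apply/seteqP; split => // y [/(_ ord0)/andP[h _] /(_ ord0)/andP[_]].
move: h; rewrite /a /b /= => h1 h2; have := lt_trans h1 h2.
by rewrite ltrD2l ltr_pM2l// ltf_pV2 ?posrE// ltr_nat ltnS ltnNge jk.
Qed.

End boxes.

(** * The semigroup on the eigenbasis *)

Lemma near_right0P (R : realType) (P : R -> Prop) :
  (\forall t \near (0 : R)^'+, P t) <->
  exists2 dlt : R, 0 < dlt & forall t, 0 < t < dlt -> P t.
Proof.
split=> [/nbhs_ballP[dlt /= d0 dP]|[dlt d0 dP]].
  exists dlt => // t /andP[t0 td]; apply: dP => //.
  by rewrite /ball/= sub0r normrN gtr0_norm.
apply/nbhs_ballP; exists dlt => //= t /=.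
rewrite /ball/= sub0r normrN => td t0; apply: dP.
by rewrite t0/= (le_lt_trans (ler_norm _)).
Qed.

Lemma cvg_right0P (R : realType) (V : normedModType R) (f : R -> V) (l : V) :
  (f t @[t --> (0 : R)^'+] --> l) <->
  forall eps, 0 < eps -> exists2 dlt : R, 0 < dlt &
    forall t, 0 < t < dlt -> `|l - f t| < eps.
Proof.
split=> [/cvgrPdist_lt fl eps /fl/near_right0P//|fl].
by apply/cvgrPdist_lt => eps /fl; exact: (near_right0P _).2.
Qed.

Lemma expRN_bounds (R : realType) (x : R) : 0 <= x ->
  0 <= expR (- x) - 1 + x <= x ^+ 2.
Proof.
move=> x0; have := expR_ge1Dx (- x); have := expR_ge1Dx x => h1 h2.
apply/andP; split; first lra.
have p0 : 0 < expR (- x) by exact: expR_gt0.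
have : expR (- x) * expR x = 1 by rewrite -expRD addNr expR0.
have : expR (- x) * (1 + x) <= expR (- x) * expR x by rewrite ler_pM2l.
move=> /[swap] -> h3; nra.
Qed.

Section semigroup.
Context d (T : measurableType d) (R : realType).
Variable mu : {measure set T -> \bar R}.
Local Notation H := (L2 mu).
Implicit Types u v w x y : H.
Variables (A : unbounded_op mu) (E : R -> H -> H).
Hypothesis genE : generated_by_opp A E.

Lemma E_linear t : 0 <= t -> linear (E t).
Proof. by move=> t0; case: genE => -[/(_ t t0)[_ h] _ _ _] _ a u v; exact: h. Qed.

Lemma E_continuous t : 0 <= t -> continuous (E t).
Proof. by move=> t0; case: genE => -[/(_ t t0)[h _]]. Qed.

Lemma E0 u : E 0 u = u. Proof. by case: genE => -[]. Qed.

Lemma E_add s t u : 0 <= s -> 0 <= t -> E (s + t) u = E s (E t u).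
Proof. by case: genE => -[_ _ h _] _; exact: h. Qed.

Lemma E_zero t : 0 <= t -> E t 0 = 0.
Proof.
by move=> t0; have := E_linear t0 (-1) 0 0; rewrite scaler0 addr0 scaleN1r addNr.
Qed.

Lemma EZ t a u : 0 <= t -> E t (a *: u) = a *: E t u.
Proof. by move=> t0; rewrite -[a *: u]addr0 E_linear// E_zero// addr0. Qed.

Lemma ED t u v : 0 <= t -> E t (u + v) = E t u + E t v.
Proof. by move=> t0; rewrite -[u]scale1r E_linear// !scale1r. Qed.

Lemma EB t u v : 0 <= t -> E t (u - v) = E t u - E t v.
Proof. by move=> t0; rewrite ED// -!(scaleN1r v) EZ// scaleN1r. Qed.

Lemma E_right0 u eps : 0 < eps -> exists2 dlt : R, 0 < dlt &
  forall t, 0 <= t < dlt -> `|u - E t u| < eps.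
Proof.
move=> eps0; case: genE => -[_ _ _ /(_ u) /cvg_right0P/(_ _ eps0)[dlt d0 dP]] _.
exists dlt => // t /andP[]; rewrite le_eqVlt => /predU1P[<- _|t0 td].
  by rewrite E0 subrr normr0.
by apply: dP; rewrite t0.
Qed.

(* Banach-Steinhaus applied to a sequence t_n -> 0+. *)
Lemma E_locally_bounded : exists h0 M : R, [/\ 0 < h0, 1 <= M &
  forall t x, 0 <= t <= h0 -> `|E t x| <= M * `|x|].
Proof.
apply: contrapT => h.
have /choice[t tP] : forall n : nat, exists t : R, 0 <= t <= n.+1%:R^-1 /\
    exists x, n.+1%:R * `|x| < `|E t x|.
  move=> n; apply: contrapT => /forallNP h'; apply: h.
  exists n.+1%:R^-1, n.+1%:R; split; first by rewrite invr_gt0.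
    by rewrite ler1n.
  move=> t x t0; rewrite leNgt; apply/negP => ht.
  by apply: (h' t); split => //; exists x.
have t0 n : 0 <= t n by have [/andP[]] := tP n.
have [||M MP] := @L2_banach_steinhaus _ _ _ mu (range (fun n => E (t n))).
- by move=> _ [n _ <-]; split; [exact: E_linear|exact: E_continuous].
- move=> x; have [dlt d0 dP] := E_right0 x ltr01.
  have := near_infty_natSinv_lt (PosNum d0); move=> [N _ NP].
  exists (\sum_(n < N) `|E (t n) x| + (`|x| + 1)) => _ [n _ <-].
  have S0 : 0 <= \sum_(n < N) `|E (t n) x| by exact: sumr_ge0.
  have [nN|Nn] := ltnP n N.
    by rewrite (bigD1 (Ordinal nN))//= -addrA lerDl addr_ge0// sumr_ge0.
  apply: (@le_trans _ _ (`|x| + 1)); last by rewrite lerDr.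
  have : `|x - E (t n) x| < 1.
    apply: dP; rewrite t0/=; have [/andP[_ +] _] := tP n.
    by move=> /le_lt_trans; apply; exact: NP.
  rewrite distrC => /ltW; have := lerB_dist (E (t n) x) x; lra.
have [n nM] : exists n : nat, M < n.+1%:R.
  exists (Num.truncn `|M|); apply: le_lt_trans (ler_norm M) _.
  by have /andP[] := truncn_itv (normr_ge0 M).
have [_ [x]] := tP n; rewrite ltNge; apply/negP/negPn.
apply: le_trans (MP (E (t n)) _ x) _; first by exists n.
by rewrite ler_wpM2r// ltW.
Qed.

Section eigen.
Variables (x : H) (l : R).
Hypotheses (l0 : 0 < l) (Dx : uop_dom A x) (Ax : A x = l *: x).

(** With q = e^{-lh}, one step splits E^{n+1} x - q^{n+1} x into E^n (E x - q x) and q (E^n x - q^n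
    x). The first is bounded by M, the second does not grow since q <= 1. *)
Lemma E_telescope h0 M h n : 0 <= M ->
  (forall t v, 0 <= t <= h0 -> `|E t v| <= M * `|v|) ->
  0 <= h -> n%:R * h <= h0 ->
  `|E (n%:R * h) x - expR (- l * h) ^+ n *: x| <=
    n%:R * (M * `|E h x - expR (- l * h) *: x|).
Proof.
move=> M0 MP h_ge0; elim: n => [|n IH] nh.
  by rewrite !mul0r E0 expr0 scale1r subrr normr0.
have nh' : 0 <= n%:R * h <= h0.
  rewrite mulr_ge0//= (le_trans _ nh)// ler_wpM2r// ler_nat//.
have q1 : expR (- l * h) <= 1 by rewrite expR_le1 mulNr oppr_le0 mulr_ge0// ltW.
have -> : n.+1%:R * h = n%:R * h + h by rewrite -natr1 mulrDl mul1r.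
rewrite E_add//; last by have /andP[] := nh'.
rewrite -(subrKA (E (n%:R * h) (expR (- l * h) *: x))) -EB; last by have /andP[] := nh'.
rewrite EZ; last by have /andP[] := nh'.
rewrite exprS -scalerA -scalerBr -[n.+1%:R]natr1 addrC mulrDl mul1r addrC.
rewrite [leRHS]addrC (le_trans (ler_normD _ _))// lerD//; first exact: MP.
rewrite normrZ ger0_norm ?expR_ge0//.
apply: le_trans (ler_wpM2r (normr_ge0 _) q1) _.
by rewrite mul1r; apply: IH; have /andP[] := nh'.
Qed.

(* The generator gives |E h x - e^{-lh} x| = o(h), and E is bounded near 0, so the
   error at time n h is o(1). *)
Lemma E_eigenvector t : 0 <= t -> E t x = expR (- l * t) *: x.
Proof.
have [h0 [M [h0_gt0 M1 MP]]] := E_locally_bounded.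
have M0 : 0 <= M by lra.
have small s : 0 <= s <= h0 -> E s x = expR (- l * s) *: x.
  move=> /andP[]; rewrite le_eqVlt => /predU1P[<- _|s0 sh].
    by rewrite E0 mulr0 expR0 scale1r.
  apply/eqP; rewrite -subr_eq0; apply/eqP; apply: normr_le_eps => eps eps0.
  (* The n one-step errors add up to [s * M * (1 + l ^+ 2 * |x|)] times their relative size, so a
     relative size of [eps / c] suffices. *)
  have c0 : 0 < s * M * (1 + l ^+ 2 * `|x|) + 1.
    by rewrite ltr_wpDl// !mulr_ge0 ?addr_ge0 ?mulr_ge0 ?sqr_ge0// ltW.
  set c := _ + 1 in c0.
  have ec : 0 < eps / c by rewrite divr_gt0.
  have gx := (genE.2 x (- A x)).2 (conj Dx erefl).
  have [dlt d0 dP] := (cvg_right0P _ _).1 gx _ ec.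
  have m0 : 0 < Num.min dlt (eps / c) / s by rewrite divr_gt0// lt_min d0.
  have := near_infty_natSinv_lt (PosNum m0); move=> [N _ /(_ N (leqnn _))] /=.
  set h := s / N.+1%:R => Ns.
  have N0 : 0 < N.+1%:R :> R by [].
  have hpos : 0 < h by rewrite divr_gt0.
  have : h < Num.min dlt (eps / c) by rewrite /h mulrC -ltr_pdivlMr.
  rewrite lt_min => /andP[hd he].
  have sE : s = N.+1%:R * h by rewrite /h mulrC divfK// gt_eqF.
  have qE : expR (- l * s) = expR (- l * h) ^+ N.+1.
    by rewrite -expRM_natl sE mulrCA.
  rewrite qE [in E _]sE.
  have Nh : N.+1%:R * h <= h0 by rewrite -sE.
  apply: le_trans (E_telescope M0 MP (ltW hpos) Nh) _.
  (* The difference quotient is close to - A x = - l x, and e^{-lh} differs from 1 - lh by at most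
     (lh)^2. *)
  have D : `|E h x - expR (- l * h) *: x| <= h * (eps / c * (1 + l ^+ 2 * `|x|)).
    have -> : E h x - expR (- l * h) *: x =
       h *: (h^-1 *: (E h x - x) - (- A x)) - (expR (- l * h) - 1 + l * h) *: x.
      rewrite scalerBr scalerA mulfV ?gt_eqF// scale1r Ax scalerN opprK scalerA.
      by rewrite !scalerDl scaleN1r (mulrC l h) opprD opprB addrACA subrr addr0 subrKA.
    apply: le_trans (ler_normB _ _) _.
    rewrite mulrDr mulr1 mulrDr lerD//.
      rewrite normrZ gtr0_norm// ler_pM2l// distrC ltW//.
      by apply: dP; rewrite hpos.
    rewrite normrZ mulrA.
    have lh : 0 <= l * h by rewrite mulr_ge0// ltW.
    have := expRN_bounds lh; rewrite -mulNr => /andP[p1 p2].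
    rewrite (ger0_norm p1) [leRHS]mulrA; apply: ler_wpM2r => //; apply: le_trans p2 _.
    have -> : (l * h) ^+ 2 = h * (h * l ^+ 2) by ring.
    by rewrite ler_pM2l// ler_wpM2r ?sqr_ge0// ltW.
  have s0' : 0 <= N.+1%:R * M by rewrite mulr_ge0.
  rewrite mulrA; apply: le_trans (ler_wpM2l s0' D) _.
  have -> : N.+1%:R * M * (h * (eps / c * (1 + l ^+ 2 * `|x|))) =
      (N.+1%:R * h * M * (1 + l ^+ 2 * `|x|)) * (eps / c) by ring.
  rewrite -sE; have -> : s * M * (1 + l ^+ 2 * `|x|) = c - 1 by rewrite /c addrK.
  by rewrite mulrBl mulrC divfK ?gt_eqF// mul1r lerBlDr lerDl ltW.
move=> t0.
(* A large time is cut into N+1 equal steps within [0, h0], and the semigroup law multiplies the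
   exponentials. *)
have th : 0 < h0 / (t + 1) by rewrite divr_gt0// ltr_wpDl.
have := near_infty_natSinv_lt (PosNum th); move=> [N _ /(_ N (leqnn _))] /= Nt.
have N0 : 0 < N.+1%:R :> R by [].
pose s := t / N.+1%:R.
have s0 : 0 <= s by rewrite divr_ge0.
have sh : s <= h0.
  move: Nt; rewrite ltr_pdivlMr ?ltr_wpDl// => /ltW; apply: le_trans.
  by rewrite /s mulrC ler_wpM2l ?invr_ge0// lerDl.
have sP n : E (n%:R * s) x = expR (- l * (n%:R * s)) *: x.
  elim: n => [|n IH]; first by rewrite !mul0r E0 mulr0 expR0 scale1r.
  rewrite -natr1 mulrDl mul1r E_add ?mulr_ge0// small ?s0// EZ ?mulr_ge0// IH.
  by rewrite scalerA -expRD mulrDr addrC.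
have <- : N.+1%:R * s = t by rewrite /s mulrC divfK// gt_eqF.
exact: sP.
Qed.

End eigen.
End semigroup.

(** The weights will be the step lengths of a partition, which makes this the Cauchy-Schwarz
    inequality for Riemann sums. *)
Lemma weighted_cauchy_schwarz (R : realType) n (d p q : nat -> R) :
  (forall i, (i < n)%N -> 0 <= d i) ->
  (\sum_(0 <= i < n) d i * (p i * q i)) ^+ 2 <=
  (\sum_(0 <= i < n) d i * p i ^+ 2) * (\sum_(0 <= i < n) d i * q i ^+ 2).
Proof.
elim: n => [_|n IH d0]; first by rewrite !big_geq// expr0n mul0r.
rewrite !big_nat_recr//=.
have := IH (fun i ni => d0 i (ltnW ni)); have := d0 n (ltnSn n).
have : 0 <= \sum_(0 <= i < n) d i * p i ^+ 2.
  rewrite big_nat sumr_ge0// => i /andP[_ ni].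
  by rewrite mulr_ge0 ?sqr_ge0// d0// ltnW.
have : 0 <= \sum_(0 <= i < n) d i * q i ^+ 2.
  rewrite big_nat sumr_ge0// => i /andP[_ ni].
  by rewrite mulr_ge0 ?sqr_ge0// d0// ltnW.
set X := \sum_(0 <= i < n) d i * p i ^+ 2.
set Y := \sum_(0 <= i < n) d i * q i ^+ 2.
set Z := \sum_(0 <= i < n) d i * (p i * q i).
move: (d n) (p n) (q n) => dn pn qn Y0 X0 dn0 ZXY.
have W0 : 0 <= X * qn ^+ 2 + Y * pn ^+ 2.
  by rewrite addr_ge0// mulr_ge0// sqr_ge0.
have h : 2 * Z * (pn * qn) <= X * qn ^+ 2 + Y * pn ^+ 2.
  apply: le_trans (ler_norm _) _.
  rewrite -ler_sqr ?nnegrE// real_normK ?num_real//.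
  have h1 : (2 * Z * (pn * qn)) ^+ 2 <= 4 * (X * Y) * (pn * qn) ^+ 2.
    have -> : (2 * Z * (pn * qn)) ^+ 2 = 4 * Z ^+ 2 * (pn * qn) ^+ 2 by ring.
    by rewrite ler_wpM2r ?sqr_ge0// ler_pM2l.
  apply: le_trans h1 _; rewrite -subr_ge0.
  have -> : (X * qn ^+ 2 + Y * pn ^+ 2) ^+ 2 - 4 * (X * Y) * (pn * qn) ^+ 2 =
    (X * qn ^+ 2 - Y * pn ^+ 2) ^+ 2 by ring.
  exact: sqr_ge0.
have := ler_wpM2l dn0 h; nra.
Qed.

(** * Decay, smoothing and energy on the eigenbasis *)

Section spectral_estimates.
Context d (T : measurableType d) (R : realType).
Variable mu : {measure set T -> \bar R}.
Local Notation H := (L2 mu).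
Implicit Types u v w x y : H.
Variables (A : unbounded_op mu) (E : R -> H -> H).
Hypothesis genE : generated_by_opp A E.
Variables (e : nat -> H) (lam : nat -> R).
Hypothesis eb : eigenbasis A e lam.
Hypothesis lam0 : forall k, 0 < lam k.

Lemma eb_orthonormal j k : L2dot (e j) (e k) = (j == k)%:R.
Proof. by case: eb. Qed.
Local Notation eo := eb_orthonormal.

Lemma oproj_cvg v : oproj e n v @[n --> \oo] --> v.
Proof. by case: eb => _ _; exact. Qed.

Lemma norm_le_coef v c : 0 <= c ->
  (forall n, \sum_(0 <= k < n) L2dot v (e k) ^+ 2 <= c ^+ 2) -> `|v| <= c.
Proof.
move=> c0 h; apply/ler_addgt0Pr => eps eps0.
have /cvgrPdist_lt/(_ eps eps0)[n _ /(_ n (leqnn _)) /= vn] := @oproj_cvg v.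
rewrite -(subrK (oproj e n v) v) addrC (le_trans (ler_normD _ _))// lerD ?(ltW vn)//.
by rewrite -ler_sqr ?nnegrE// (norm_osum eo).
Qed.

Lemma norm_coef_le u v a : 0 <= a ->
  (forall k, L2dot u (e k) ^+ 2 <= a ^+ 2 * L2dot v (e k) ^+ 2) ->
  `|u| <= a * `|v|.
Proof.
move=> a0 h; apply: norm_le_coef => [|n]; first by rewrite mulr_ge0.
apply: le_trans (ler_sum _ (fun k _ => h k)) _.
by rewrite -mulr_sumr exprMn ler_wpM2l ?sqr_ge0// (bessel eo).
Qed.

Lemma E_eigen t k : 0 <= t -> E t (e k) = expR (- lam k * t) *: e k.
Proof.
by move=> t0; have [/(_ k)[De Ae] _ _] := eb; exact: (E_eigenvector genE (lam0 k) De Ae).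
Qed.

(** For the partial sums of v with more than k terms this is the action of [E t] on eigenvectors;
    continuity of [E t] gives the rest. *)
Lemma dot_E t v k : 0 <= t -> L2dot (E t v) (e k) = expR (- lam k * t) * L2dot v (e k).
Proof.
move=> t0.
have Ec : E t (oproj e n v) @[n --> \oo] --> E t v.
  exact: (cvg_seq_continuous (E_continuous genE t0) (@oproj_cvg v)).
have := @L2dot_cvgl _ _ _ _ _ (e k) _ Ec.
move=> /cvg_lim <- //; apply: lim_near_cst => //.
exists k.+1 => // n /= kn.
rewrite /oproj (big_morph (E t) (fun x y => ED genE x y t0) (E_zero genE t0)).
under eq_bigr do rewrite (EZ genE)// E_eigen// scalerA.
by rewrite (dot_osum eo) kn mulrC.
Qed.

Lemma E_decay l0 t v : (forall k, l0 <= lam k) -> 0 <= t ->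
  `|E t v| <= expR (- l0 * t) * `|v|.
Proof.
move=> l0P t0; apply: norm_coef_le => [|k]; first exact: expR_ge0.
rewrite dot_E// exprMn ler_wpM2r ?sqr_ge0// lerXn2r ?nnegrE ?expR_ge0//.
by rewrite ler_expR !mulNr lerN2 ler_wpM2r.
Qed.

Lemma E_contract t v : 0 <= t -> `|E t v| <= `|v|.
Proof.
move=> t0; have := @E_decay 0 t v (fun k => ltW (lam0 k)) t0.
by rewrite oppr0 mul0r expR0 mul1r.
Qed.

(* The partial sums of |A^{1/2} v|^2. *)
Definition energy n v := \sum_(0 <= k < n) lam k * L2dot v (e k) ^+ 2.

Lemma energy_E n t v : 0 <= t -> energy n (E t v) <= energy n v.
Proof.
move=> t0; apply: ler_sum => k _; rewrite dot_E// exprMn ler_pM2l//.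
rewrite ler_piMl ?sqr_ge0// expr_le1 ?expR_ge0// expR_le1 mulNr oppr_le0.
by rewrite mulr_ge0// ltW.
Qed.

(** Mode by mode this is x e^{-2x} <= 1 at x = lam_k t, followed by Bessel's inequality. *)
Lemma energy_smoothing n t v : 0 < t -> energy n (E t v) <= `|v| ^+ 2 / t.
Proof.
move=> t0; rewrite ler_pdivlMr//; apply: le_trans (bessel eo n v).
rewrite mulr_suml; apply: ler_sum => k _; rewrite (dot_E _ _ (ltW t0)) exprMn.
have -> : lam k * (expR (- lam k * t) ^+ 2 * L2dot v (e k) ^+ 2) * t =
  (lam k * t * expR (- lam k * t) ^+ 2) * L2dot v (e k) ^+ 2 by ring.
rewrite ler_piMl ?sqr_ge0//.
have x0 : 0 <= lam k * t by rewrite mulr_ge0// ltW.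
have := expR_ge1Dx (lam k * t).
have : expR (- lam k * t) * expR (lam k * t) = 1.
  by rewrite -expRD mulNr addNr expR0.
have : expR (- lam k * t) <= 1 by rewrite expR_le1 mulNr oppr_le0.
have := expR_gt0 (- lam k * t); move: (expR _) (expR _) => p q.
by move: x0; set x := lam k * t => x0 p0 p1 pq qx; nra.
Qed.

(** Mode by mode this is (1 - e^{-x})^2 <= x at x = lam_k h. It is the source of the Hoelder
    exponent 1/2. *)
Lemma E_holder h v c : (forall n, energy n v <= c) -> 0 <= h ->
  `|E h v - v| <= Num.sqrt (h * c).
Proof.
move=> vc h0.
have c0 : 0 <= c by apply: le_trans (vc 0%N); rewrite /energy big_geq.
apply: norm_le_coef => [|n]; first exact: sqrtr_ge0.
rewrite sqr_sqrtr ?mulr_ge0//; apply: le_trans (ler_wpM2l h0 (vc n)).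
rewrite mulr_sumr; apply: ler_sum => k _.
rewrite L2dotBl dot_E// -{2}[L2dot v (e k)]mul1r -mulrBl exprMn [leRHS]mulrA.
rewrite ler_wpM2r ?sqr_ge0//.
have x0 : 0 <= lam k * h by rewrite mulr_ge0// ltW.
have := expR_ge1Dx (- lam k * h); have := expR_gt0 (- lam k * h).
have : expR (- lam k * h) <= 1 by rewrite expR_le1 mulNr oppr_le0.
rewrite mulNr (mulrC h); move: (expR _) x0; set x := lam k * h => p x0 p1 p0 px.
nra.
Qed.

Lemma energyD n u v : energy n (u + v) <= 2 * (energy n u + energy n v).
Proof.
rewrite -big_split/= mulr_sumr; apply: ler_sum => k _.
rewrite L2dotDl -mulrDr [leRHS]mulrCA ler_pM2l//.
have := sqr_ge0 (L2dot u (e k) - L2dot v (e k)); nra.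
Qed.

Lemma energyB_le n u v : energy n (u - v) <= 2 * (energy n u + energy n v).
Proof.
apply: le_trans (energyD _ _ _) _; rewrite ler_pM2l// lerD2l le_eqVlt.
by apply/orP; left; apply/eqP; apply: eq_bigr => k _; rewrite L2dotNl sqrrN.
Qed.

Lemma energy_cvg n (v : nat -> H) w : v m @[m --> \oo] --> w ->
  energy n (v m) @[m --> \oo] --> energy n w.
Proof.
move=> vw; elim: n => [|n IH].
  rewrite /energy big_geq//.
  by under eq_fun do rewrite big_geq//; exact: cvg_cst.
rewrite /energy big_nat_recr//=.
under eq_fun do rewrite big_nat_recr//=.
apply: cvgD; first exact: IH.
apply: cvgM; first exact: cvg_cst.
by apply: cvgM; exact: L2dot_cvgl.
Qed.

(** A finite partial sum is continuous on L^2, so a bound valid at points arbitrarily near w holds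
    at w. *)
Lemma energy_closed n w c :
  (forall eps, 0 < eps -> exists2 v, `|w - v| < eps & energy n v <= c) ->
  energy n w <= c.
Proof.
move=> h; have p0 m : 0 < m.+1%:R^-1 :> R by rewrite invr_gt0.
have /choice[v vP] : forall m : nat, exists v, `|w - v| < m.+1%:R^-1 /\ energy n v <= c.
  by move=> m; have [v] := h _ (p0 m); exists v.
have vw : v m @[m --> \oo] --> w.
  apply/cvgrPdist_lt => eps eps0.
  have := near_infty_natSinv_lt (PosNum eps0); apply: filterS => m /= me.
  by apply: lt_trans me; have [] := vP m.
have ec := @energy_cvg n _ _ vw; rewrite -(cvg_lim _ ec)//.
apply: limr_le; first by apply/cvg_ex; exists (energy n w).
by apply: nearW => m; have [] := vP m.
Qed.

Lemma spectral_gap : (forall M, exists N, forall n, (N <= n)%N -> M <= lam n) ->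
  exists2 l0, 0 < l0 & forall k, l0 <= lam k.
Proof.
move=> /(_ 1)[N NP].
suff [l0 l00 l0P] : exists2 l0, 0 < l0 & forall k, (k < N)%N -> l0 <= lam k.
  exists (Num.min 1 l0); first by rewrite lt_min ltr01.
  move=> k; rewrite ge_min; have [/l0P->|/NP->//] := ltnP k N.
  by rewrite orbT.
elim: N {NP} => [|N [l0 l00 l0P]]; first by exists 1.
exists (Num.min l0 (lam N)); first by rewrite lt_min l00/=.
move=> k; rewrite ltnS leq_eqVlt ge_min => /predU1P[->|/l0P->//].
by rewrite lexx orbT.
Qed.

End spectral_estimates.

(** * Riemann integrals *)

Lemma fine_partition (R : realType) (a b dlt : R) : a <= b -> 0 < dlt ->
  exists s, itv_partition a b s /\
    forall i, (i < size s)%N -> nth b s i - nth b (a :: s) i < dlt.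
Proof.
move=> + d0; have [N] : exists N : nat, b - a < N%:R * (dlt / 2).
  exists (Num.truncn (`|b - a| / (dlt / 2))).+1.
  rewrite -ltr_pdivrMr ?divr_gt0//.
  have /andP[_] := truncn_itv (divr_ge0 (normr_ge0 (b - a)) (ltW (divr_gt0 d0 (ltr0n _ 2)))).
  by apply: le_lt_trans; rewrite ler_wpM2r ?ler_norm// invr_ge0 divr_ge0// ltW.
elim: N a => [|N IH] a h; first by rewrite mul0r subr_lt0 ltNge in h *; move=> ab; rewrite ab in h.
rewrite le_eqVlt => /predU1P[->|ab].
  by exists [::]; split => //; split => /=.
have [bd|bd] := ltP (b - a) dlt.
  exists [:: b]; split; first exact: itv_partition1.
  by move=> [|]//.
have [||s [[sp sl] sd]] := IH (a + dlt / 2).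
- by move: h; rewrite -natr1 mulrDl mul1r; lra.
- lra.
exists (a + dlt / 2 :: s); split; last by move=> [_ /=|i /=]; [lra|exact: sd].
by split => //=; rewrite sp andbT ltrDl divr_gt0.
Qed.

Section riemann.
Context d (T : measurableType d) (R : realType).
Variable mu : {measure set T -> \bar R}.
Local Notation H := (L2 mu).
Implicit Types (f g : R -> H) (a b c : R) (s : seq R) (xi : nat -> R) (w : H).

Definition rsum f a b s xi : H :=
  \sum_(0 <= i < size s) (nth b s i - nth b (a :: s) i) *: f (xi i).

Definition fine_tags a b s xi (dlt : R) := forall i, (i < size s)%N ->
  nth b s i - nth b (a :: s) i < dlt /\ nth b (a :: s) i <= xi i <= nth b s i.

Lemma tag_in a b s xi dlt i : itv_partition a b s -> fine_tags a b s xi dlt ->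
  (i < size s)%N -> a <= xi i <= b.
Proof.
move=> ps ft si; have [_ /andP[h1 h2]] := ft i si; apply/andP; split.
  by apply: le_trans h1; apply: itv_partition_nth_ge => //; exact: ltnW.
by apply: le_trans h2 _; exact: (@itv_partition_nth_le _ _ a b s i.+1).
Qed.

Lemma step_ge0 a b s i : itv_partition a b s -> (i < size s)%N ->
  0 <= nth b s i - nth b (a :: s) i.
Proof.
move=> [ps _] si; rewrite subr_ge0.
by have /(pathP b)/(_ i si)/ltW := ps.
Qed.

Lemma sum_steps a b s : itv_partition a b s ->
  \sum_(0 <= i < size s) (nth b s i - nth b (a :: s) i) = b - a.
Proof.
move=> ps; rewrite (telescope_sumr_eq (fun i => nth b (a :: s) i))//.
by rewrite (itv_partition_nth_size _ ps).
Qed.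

(** Left endpoints are chosen as tags because the telescoping in [left_sum_exp_le] relies on
    them. *)
Lemma left_tags a b dlt : a <= b -> 0 < dlt -> exists s xi,
  [/\ itv_partition a b s, fine_tags a b s xi dlt &
      forall i, xi i = nth b (a :: s) i].
Proof.
move=> ab d0; have [s [ps sd]] := fine_partition ab d0.
exists s, (nth b (a :: s)); split => // i si; split; first exact: sd.
by rewrite lexx/= -subr_ge0 step_ge0.
Qed.

Lemma rsum_norm_le f a b s xi dlt M : itv_partition a b s ->
  fine_tags a b s xi dlt -> (forall x, a <= x <= b -> `|f x| <= M) ->
  `|rsum f a b s xi| <= (b - a) * M.
Proof.
move=> ps ft fM; apply: le_trans (ler_norm_sum _ _ _) _.
rewrite -(sum_steps ps) mulr_suml big_nat [leRHS]big_nat.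
apply: ler_sum => i /andP[_ si].
rewrite normrZ ger0_norm ?(step_ge0 ps)// ler_wpM2l ?(step_ge0 ps)//.
by apply: fM; exact: (tag_in ps ft si).
Qed.

Lemma rsumB f g a b s xi :
  rsum f a b s xi - rsum g a b s xi = rsum (fun x => f x - g x) a b s xi.
Proof. by rewrite -sumrB; apply: eq_bigr => i _; rewrite scalerBr. Qed.

Lemma rsum_eq f g a b s xi dlt : itv_partition a b s -> fine_tags a b s xi dlt ->
  (forall x, a <= x <= b -> f x = g x) -> rsum f a b s xi = rsum g a b s xi.
Proof.
move=> ps ft fg; apply: eq_big_nat => i /andP[_ si]; congr (_ *: _).
by apply: fg; exact: (tag_in ps ft si).
Qed.

Lemma rsum_cat f a b c s1 s2 xi1 xi2 : itv_partition a b s1 ->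
  rsum f a c (s1 ++ s2) (fun i => if (i < size s1)%N then xi1 i else xi2 (i - size s1)%N) =
  rsum f a b s1 xi1 + rsum f b c s2 xi2.
Proof.
move=> ps; rewrite /rsum size_cat (@big_cat_nat _ _ _ (size s1))//= ?leq_addr//.
congr (_ + _).
  apply: eq_big_nat => i /andP[_ si]; rewrite si -cat_cons !nth_cat si /= ltnS (ltnW si).
  rewrite (set_nth_default b)//; congr ((_ - _) *: _).
  by rewrite (set_nth_default b)//= ltnS ltnW.
rewrite -{1}[size s1]add0n big_addn addKn; apply: eq_big_nat => i /andP[_ si].
rewrite ltnNge leq_addl/= addnK -cat_cons !nth_cat ltnNge leq_addl/= addnK.
congr ((_ - _) *: _).
(* The first step of s2 starts at the last entry of [a :: s1], which is b. *)
case: i si => [|i] si; first by rewrite add0n ltnSn (itv_partition_nth_size _ ps).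
by rewrite addSn ltnS ltnNge leq_addl/= subSS addnK.
Qed.

Lemma fine_tags_cat a b c s1 s2 xi1 xi2 dlt : itv_partition a b s1 ->
  fine_tags a b s1 xi1 dlt -> fine_tags b c s2 xi2 dlt ->
  fine_tags a c (s1 ++ s2)
    (fun i => if (i < size s1)%N then xi1 i else xi2 (i - size s1)%N) dlt.
Proof.
move=> ps f1 f2 i; rewrite size_cat -cat_cons !nth_cat /= ltnS.
have [i1 _|i1 i2] := ltnP i (size s1).
  rewrite (ltnW i1) (set_nth_default b c i1).
  rewrite (@set_nth_default _ (a :: s1) b c i)/= ?ltnS ?(ltnW i1)//.
  exact: f1.
have si : (i - size s1 < size s2)%N by rewrite ltn_subLR.
have [] := f2 _ si.
case: (ltngtP i (size s1)) i1 => // [i1|->] _.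
  by rewrite -(subnSK i1).
by rewrite subnn (itv_partition_nth_size _ ps).
Qed.

Lemma ri_approx f a b w eps : is_Riemann_integral f a b w -> a <= b -> 0 < eps ->
  exists s xi dlt, [/\ itv_partition a b s, fine_tags a b s xi dlt,
    (forall i, xi i = nth b (a :: s) i) & `|rsum f a b s xi - w| < eps].
Proof.
move=> fw ab e0; have [dlt d0 dP] := fw eps e0.
have [s [xi [ps ft xl]]] := left_tags ab d0.
by exists s, xi, dlt; split => //; exact: dP.
Qed.

Lemma ri_norm_le f a b w M : is_Riemann_integral f a b w -> a <= b ->
  (forall x, a <= x <= b -> `|f x| <= M) -> `|w| <= (b - a) * M.
Proof.
move=> fw ab fM; apply/ler_addgt0Pr => eps e0.
have [s [xi [dlt [ps ft _ h]]]] := ri_approx fw ab e0.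
rewrite -(subrK (rsum f a b s xi) w) addrC (le_trans (ler_normD _ _))// lerD//.
  exact: rsum_norm_le ft fM.
by rewrite distrC ltW.
Qed.

Lemma ri_near f g a b w w' M : is_Riemann_integral f a b w ->
  is_Riemann_integral g a b w' -> a <= b ->
  (forall x, a <= x <= b -> `|f x - g x| <= M) -> `|w - w'| <= (b - a) * M.
Proof.
move=> fw gw ab fgM; apply/ler_addgt0Pr => eps e0.
have e2 : 0 < eps / 2 by rewrite divr_gt0.
have [d1 d10 P1] := fw _ e2; have [d2 d20 P2] := gw _ e2.
have m0 : 0 < Num.min d1 d2 by rewrite lt_min d10.
have [s [xi [ps ft _]]] := left_tags ab m0.
have h1 : `|rsum f a b s xi - w| < eps / 2.
  apply: P1 => // i si; have [h ?] := ft i si; split=> //.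
  by move: h; rewrite lt_min => /andP[].
have h2 : `|rsum g a b s xi - w'| < eps / 2.
  apply: P2 => // i si; have [h ?] := ft i si; split=> //.
  by move: h; rewrite lt_min => /andP[].
have := rsum_norm_le ps ft fgM; rewrite -rsumB => h3.
have -> : w - w' = (rsum f a b s xi - rsum g a b s xi) -
    ((rsum f a b s xi - w) - (rsum g a b s xi - w')).
  by rewrite opprB opprB addrA subrKA addrC subrKA.
rewrite (le_trans (ler_normB _ _))// lerD// (le_trans (ler_normB _ _))//.
by rewrite (splitr eps) lerD// ltW.
Qed.

Lemma ri_eq f g a b w : (forall x, a <= x <= b -> f x = g x) ->
  is_Riemann_integral f a b w -> is_Riemann_integral g a b w.
Proof.
move=> fg fw eps /fw[dlt d0 dP]; exists dlt => // s xi ps ft.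
by rewrite -/(rsum g a b s xi) -(rsum_eq ps ft fg); exact: dP.
Qed.

Lemma ri_linear (L : H -> H) f a b w : linear L -> continuous L ->
  is_Riemann_integral f a b w -> is_Riemann_integral (fun x => L (f x)) a b (L w).
Proof.
move=> lL cL fw eps e0; have [M M0 MP] := linear_bounded_norm lL cL.
have [dlt d0 dP] := fw _ (divr_gt0 e0 M0); exists dlt => // s xi ps ft.
have L0 : L 0 = 0 by have := lL (-1) 0 0; rewrite scaler0 addr0 scaleN1r addNr.
have LD u v : L (u + v) = L u + L v by rewrite -[u]scale1r lL !scale1r.
have LZ c u : L (c *: u) = c *: L u by rewrite -[c *: u]addr0 lL L0 addr0.
under eq_bigr do rewrite -LZ.
rewrite -(big_morph L LD L0) -scaleN1r -LZ -LD scaleN1r.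
by rewrite (le_lt_trans (MP _))// mulrC -ltr_pdivlMr//; exact: dP.
Qed.

(** Integrability on [b, c] is part of the conclusion: a fine sum there is completed, by one fixed
    fine sum on [a, b], to a fine sum on [a, c]. *)
Lemma ri_split f a b c w w1 : a <= b -> b <= c -> is_Riemann_integral f a c w ->
  is_Riemann_integral f a b w1 -> is_Riemann_integral f b c (w - w1).
Proof.
move=> ab bc fw fw1 eps e0; have e2 : 0 < eps / 2 by rewrite divr_gt0.
have [d1 d10 P1] := fw _ e2; have [d2 d20 P2] := fw1 _ e2.
have m0 : 0 < Num.min d1 d2 by rewrite lt_min d10.
exists (Num.min d1 d2) => // s2 xi2 ps2 ft2.
have [s1 [xi1 [ps1 ft1 _]]] := left_tags ab m0.
have ft := fine_tags_cat ps1 ft1 ft2.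
have h1 : `|rsum f a b s1 xi1 - w1| < eps / 2.
  apply: P2 => // i si; have [h ?] := ft1 i si; split=> //.
  by move: h; rewrite lt_min => /andP[].
have h2 : `|rsum f a b s1 xi1 + rsum f b c s2 xi2 - w| < eps / 2.
  rewrite -(rsum_cat f c s2 xi1 xi2 ps1).
  apply: P1 => [|i si]; first exact: itv_partition_cat ps2.
  have [h ?] := ft i si; split=> //.
  by move: h; rewrite lt_min => /andP[].
have -> : \sum_(0 <= i < size s2) (nth c s2 i - nth c (b :: s2) i) *: f (xi2 i) - (w - w1) =
   (rsum f a b s1 xi1 + rsum f b c s2 xi2 - w) - (rsum f a b s1 xi1 - w1).
  rewrite -/(rsum f b c s2 xi2) [rsum f a b s1 xi1 + _]addrC.
  rewrite opprB opprB -!addrA; congr (_ + _).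
  by rewrite [RHS]addrC -[RHS]addrA subrK addrC.
by rewrite (le_lt_trans (ler_normB _ _))// (splitr eps) ltrD.
Qed.

Lemma ri_shift f a b w c : is_Riemann_integral f a b w ->
  is_Riemann_integral (fun x => f (x + c)) (a - c) (b - c) w.
Proof.
move=> fw eps /fw[dlt d0 dP]; exists dlt => // s xi [ps /eqP sl] ft.
pose s' := map (+%R^~ c) s.
have ns i : (i < size s)%N -> nth b s' i = nth (b - c) s i + c.
  by move=> si; rewrite (nth_map (b - c)).
have ns' i : (i < size s)%N -> nth b (a :: s') i = nth (b - c) (a - c :: s) i + c.
  by case: i => [|i] si /=; [rewrite subrK|rewrite ns// ltnW].
have := dP s' (fun i => xi i + c); rewrite size_map.
have -> : \sum_(0 <= i < size s) (nth b s' i - nth b (a :: s') i) *: f (xi i + c) =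
  \sum_(0 <= i < size s) (nth (b - c) s i - nth (b - c) (a - c :: s) i) *: f (xi i + c).
  by apply: eq_big_nat => i /andP[_ si]; rewrite ns// ns'// opprD addrACA subrr addr0.
apply => [|i si]; last first.
  have [h1 h2] := ft i si; rewrite ns// ns'// opprD addrACA subrr addr0; split => //.
  by rewrite !lerD2r.
rewrite -[a](subrK c); split.
  have -> : path <%R (a - c + c) s' = path (relpre (+%R^~ c) <%R) (a - c) s.
    by rewrite /s' -path_map.
  by apply: sub_path ps => x y /=; rewrite ltrD2r.
by apply/eqP; rewrite -[RHS](subrK c) -sl; exact: (last_map (+%R^~ c)).
Qed.

Lemma ri_uniform_limit f a b w : a <= b ->
  (forall eps, 0 < eps -> exists g w', [/\ is_Riemann_integral g a b w',
     `|w - w'| <= eps & forall x, a <= x <= b -> `|f x - g x| <= eps]) ->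
  is_Riemann_integral f a b w.
Proof.
move=> ab h eps e0.
(* The three errors add up to b - a + 2 units; the third unit keeps the final inequality strict. *)
have c0 : 0 < b - a + 3 by rewrite ltr_wpDl// subr_ge0.
have [g [w' [gw ww fg]]] := h _ (divr_gt0 e0 c0).
have [dlt d0 dP] := gw _ (divr_gt0 e0 c0); exists dlt => // s xi ps ft.
rewrite -/(rsum f a b s xi).
have -> : rsum f a b s xi - w = (rsum f a b s xi - rsum g a b s xi) +
   ((rsum g a b s xi - w') - (w - w')).
  by rewrite opprB addrA subrKA subrKA.
rewrite rsumB (le_lt_trans (ler_normD _ _))//.
have h1 := rsum_norm_le ps ft fg; have h2 := dP _ _ ps ft.
have h3 := le_trans (ler_normB (rsum g a b s xi - w') (w - w')) (lerD (ltW h2) ww).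
apply: le_lt_trans (lerD h1 h3) _.
have -> : (b - a) * (eps / (b - a + 3)) + (eps / (b - a + 3) + eps / (b - a + 3)) =
   eps - eps / (b - a + 3) by field; rewrite gt_eqF.
by rewrite ltrBlDr ltrDl divr_gt0.
Qed.

End riemann.

Section riemann_energy.
Context d (T : measurableType d) (R : realType).
Variable mu : {measure set T -> \bar R}.
Local Notation H := (L2 mu).
Variables (A : unbounded_op mu) (E : R -> H -> H).
Hypothesis genE : generated_by_opp A E.
Variables (e : nat -> H) (lam : nat -> R).
Hypothesis eb : eigenbasis A e lam.
Hypothesis lam0 : forall k, 0 < lam k.

(* e^{2 lam D} - 1 >= lam D makes the left Riemann sum of lam e^{-2 lam (t - s)}
   telescope. *)
Lemma left_sum_exp_le (a t l : R) (s : seq R) : 0 < l -> itv_partition a t s ->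
  \sum_(0 <= i < size s) (nth t s i - nth t (a :: s) i) *
    (l * expR (- l * (t - nth t (a :: s) i)) ^+ 2) <= 1.
Proof.
move=> l0 ps.
pose F x := expR (- l * (t - x)) ^+ 2.
apply: (@le_trans _ _ (\sum_(0 <= i < size s) (F (nth t s i) - F (nth t (a :: s) i)))).
  rewrite big_nat [leRHS]big_nat; apply: ler_sum => i /andP[_ si].
  have := step_ge0 ps si; rewrite /F.
  set x := nth t s i; set y := nth t (a :: s) i => xy.
  have -> : - l * (t - x) = - l * (t - y) + l * (x - y) by ring.
  rewrite expRD; have := expR_gt0 (- l * (t - y)).
  have lxy : 0 <= l * (x - y) by rewrite mulr_ge0// ltW.
  have := expR_ge1Dx (l * (x - y)); move: (expR _) (expR _) => q p pq q0.
  have -> : (x - y) * (l * q ^+ 2) = l * (x - y) * q ^+ 2 by ring.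
  move: lxy pq; set z := l * (x - y) => z0 pz.
  have q2 : 0 < q ^+ 2 by rewrite exprn_gt0.
  rewrite exprMn -[X in _ <= _ - X]mulr1 -mulrBr mulrC ler_pM2l//; nra.
rewrite (telescope_sumr_eq (fun i => F (nth t (a :: s) i)))// (itv_partition_nth_size _ ps).
rewrite /F subrr mulr0 expR0 expr1n lerBlDr lerDl sqr_ge0//.
Qed.

(** For each mode, Cauchy-Schwarz bounds lam times the square of the sum of e^{-lam (t-s)} g_k by
    the product of the sum of lam e^{-2 lam (t-s)}, at most 1, and the sum of g_k^2. Summation over
    k uses Bessel's inequality, and [energy_closed] passes from the sums to the integral. *)
Lemma ri_energy g a t w M n : a <= t ->
  is_Riemann_integral (fun s => E (t - s) (g s)) a t w ->
  (forall s, a <= s <= t -> `|g s| <= M) ->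
  energy e lam n w <= (t - a) * M ^+ 2.
Proof.
move=> at_ gw gM; apply: energy_closed => eps eps0.
have [s [xi [dlt [ps ft xl h]]]] := ri_approx gw at_ eps0.
exists (rsum (fun s => E (t - s) (g s)) a t s xi); first by rewrite distrC.
pose D i := nth t s i - nth t (a :: s) i.
pose p k i := expR (- lam k * (t - xi i)).
pose q k i := L2dot (g (xi i)) (e k).
have D0 i : (i < size s)%N -> 0 <= D i by exact: step_ge0.
have dotE k : L2dot (rsum (fun s => E (t - s) (g s)) a t s xi) (e k) =
    \sum_(0 <= i < size s) D i * (p k i * q k i).
  rewrite L2dot_suml; apply: eq_big_nat => i /andP[_ si].
  rewrite L2dotZl (dot_E genE eb lam0)// subr_ge0.
  by have /andP[] := tag_in ps ft si.
apply: (@le_trans _ _ (\sum_(0 <= k < n) \sum_(0 <= i < size s) D i * q k i ^+ 2)).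
  apply: ler_sum => k _; rewrite dotE.
  apply: le_trans (ler_wpM2l (ltW (lam0 k)) (weighted_cauchy_schwarz (p k) (q k) D0)) _.
  rewrite mulrA ler_piMl//.
    by rewrite big_nat sumr_ge0// => i /andP[_ si]; rewrite mulr_ge0 ?D0 ?sqr_ge0.
  apply: le_trans (left_sum_exp_le (lam0 k) ps); rewrite mulr_sumr le_eqVlt.
  by apply/orP; left; apply/eqP; apply: eq_bigr => i _; rewrite mulrCA /p xl.
rewrite exchange_big/= -(sum_steps ps) mulr_suml big_nat [leRHS]big_nat.
apply: ler_sum => i /andP[_ si]; rewrite -mulr_sumr ler_wpM2l ?D0//.
apply: le_trans (bessel (eb_orthonormal eb) _ _) _.
have gx := gM _ (tag_in ps ft si).
by rewrite lerXn2r ?nnegrE// (le_trans _ gx).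
Qed.

End riemann_energy.

Section uniform_continuity.
Variables (R : realType) (V : normedModType R).

Definition cts_on (f : R -> V) (a b : R) := forall x, a <= x <= b ->
  forall eps, 0 < eps -> exists2 dlt : R, 0 < dlt &
    forall y, a <= y <= b -> `|x - y| < dlt -> `|f x - f y| < eps.

Lemma cts_onP (f : R -> V) a b : {within `[a, b], continuous f} <-> cts_on f a b.
Proof.
split=> [/subspace_continuousP h x xab eps eps0|h].
  have /cvgrPdist_lt/(_ eps eps0)/nbhs_ballP[dlt /= d0 dP] :=
    h x (ltac:(by rewrite /= in_itv)).
  exists dlt => // y yab xy; apply: (dP y xy).
  by rewrite /= in_itv.
apply/subspace_continuousP => x /=; rewrite in_itv/= => xab.
apply/cvgrPdist_lt => eps /(h x xab)[dlt d0 dP]; apply/nbhs_ballP.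
by exists dlt => //= y xy /=; rewrite in_itv/= => yab; apply: dP.
Qed.

Lemma cts_onW f a b c d : a <= c -> d <= b -> cts_on f a b -> cts_on f c d.
Proof.
move=> ac db h x /andP[cx xd] eps /(h x _)[|dlt d0 dP].
  by rewrite (le_trans ac)//= (le_trans xd).
by exists dlt => // y /andP[cy yd]; apply: dP; rewrite (le_trans ac)//= (le_trans yd).
Qed.

Lemma cts_on_unif f a b eps : cts_on f a b -> 0 < eps ->
  exists2 dlt : R, 0 < dlt & forall x y, a <= x <= b -> a <= y <= b ->
    `|x - y| < dlt -> `|f x - f y| < eps.
Proof.
move=> fc eps0; have e2 : 0 < eps / 2 by rewrite divr_gt0.
have := (compact_near_coveringP (`[a, b]%classic : set R)).1 (@segment_compact R a b).
move=> /(_ R (0 : R)^'+ (fun dlt x => forall y, a <= x <= b -> a <= y <= b ->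
    `|x - y| < dlt -> `|f x - f y| < eps)).
case=> [x /=|dlt d0 dP].
  rewrite in_itv/= => xab; have [dlt d0 dP] := fc x xab _ e2.
  exists (ball x (dlt / 2), [set t | 0 < t < dlt / 2]).
    split; first by apply: nbhsx_ballx; rewrite divr_gt0.
    by apply/near_right0P; exists (dlt / 2); rewrite ?divr_gt0.
  move=> [z t] /= [xz /andP[t0 td]] y zab yab zy; rewrite /ball/= in xz.
  rewrite -(subrKA (f x)) (le_lt_trans (ler_normD _ _))// (splitr eps) ltrD//.
    rewrite distrC; apply: dP => //; apply: lt_trans xz _.
    by rewrite ltr_pdivrMr// ltr_pMr// ltr1n.
  apply: dP => //; rewrite -(subrKA z) (le_lt_trans (ler_normD _ _))//.
  by rewrite (splitr dlt) ltrD// (lt_trans zy).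
have d2 : 0 < dlt / 2 by rewrite divr_gt0.
exists (dlt / 2) => // x y xab yab.
have bd : ball_ (fun z : R => `|z|) 0 dlt (dlt / 2).
  by rewrite /= sub0r normrN gtr0_norm// ltr_pdivrMr// ltr_pMr// ltr1n.
by apply: (dP _ bd d2) => //; rewrite /= in_itv.
Qed.

Lemma cts_on_bounded f a b : a <= b -> cts_on f a b ->
  exists M, forall x, a <= x <= b -> `|f x| <= M.
Proof.
move=> ab fc; have [dlt d0 dP] := cts_on_unif fc ltr01.
have [c cab cmax] : exists2 c, c \in `[a, b] &
    forall x, x \in `[a, b] -> `|f x| <= `|f c|.
  apply: (@EVT_max R (fun x => `|f x|)) => //.
  apply/subspace_continuousP => x /=; rewrite in_itv/= => xab.
  apply/cvgrPdist_lt => eps /(fc x xab)[e1 e10 e1P]; apply/nbhs_ballP.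
  exists e1 => //= y xy /=; rewrite in_itv/= => yab.
  by apply: le_lt_trans (ler_dist_dist _ _) _; exact: e1P.
by exists `|f c| => x xab; apply: cmax; rewrite in_itv.
Qed.

End uniform_continuity.

(** * The history space *)

Section history_space.
Variables (R : realType) (V : normedModType R) (r : R).
Local Notation I := (set_type `[- r, 0]%classic).
Local Notation C := (Cspace r V).
Implicit Types (phi psi : C) (th : I).

Lemma Cball phi psi e : ball phi e psi <-> forall th, `|phi th - psi th| < e.
Proof.
have -> : ball phi e psi = (forall th, ball (phi th) e (psi th)) by [].
by split=> h th; have := h th; rewrite -ball_normE.
Qed.

Lemma Cnbhs phi (U : set C) : nbhs phi U <->
  exists2 e, 0 < e & forall psi, (forall th, `|phi th - psi th| < e) -> U psi.
Proof.
split=> [/nbhs_ballP[e /= e0 eU]|[e e0 eU]].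
  by exists e => // psi /Cball; exact: eU.
by apply/nbhs_ballP; exists e => // psi /Cball; exact: eU.
Qed.

Lemma Ccts phi th e : 0 < e -> exists2 dlt : R, 0 < dlt &
  forall th', `|val th - val th'| < dlt -> `|phi th - phi th'| < e.
Proof.
move=> e0; have /cvgrPdist_lt/(_ e e0)/nbhs_ballP[dlt /= d0 dP] := @cts_fun _ _ phi th.
by exists dlt => // th' h; exact: dP.
Qed.

Lemma Cmk (f : I -> V) : (forall th e, 0 < e -> exists2 dlt : R, 0 < dlt &
    forall th', `|val th - val th'| < dlt -> `|f th - f th'| < e) ->
  exists phi : C, forall th, phi th = f th.
Proof.
move=> fc; have cf : continuous f.
  move=> th; apply/(@cvgrPdist_lt _ _ I (nbhs th) _ f (f th)) => e e0.
  have [dlt d0 dP] := fc th e e0.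
  by apply/nbhs_ballP; exists dlt => // th' h; exact: dP.
by exists (mkcts cf : continuousType _ _).
Qed.

Lemma C_ext phi psi : (forall th, phi th = psi th) -> phi = psi.
Proof. by move=> h; apply/continuousEP. Qed.

Lemma val_itv th : - r <= val th <= 0.
Proof. by have := set_valP th; rewrite /= in_itv. Qed.

Lemma itv_val s : - r <= s <= 0 -> exists th : I, val th = s.
Proof.
move=> h; have sI : s \in `[- r, 0]%classic by apply/mem_set; rewrite /= in_itv.
by exists (exist _ s sI).
Qed.

Lemma Cfun_cts (W : normedModType R) (F : C -> W) : continuous F ->
  forall phi e, 0 < e -> exists2 dlt : R, 0 < dlt &
  forall psi, (forall th, `|phi th - psi th| < dlt) -> `|F phi - F psi| < e.
Proof. by move=> cF phi e e0; have /cvgrPdist_lt/(_ e e0)/Cnbhs := cF phi. Qed.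

End history_space.

Section segments.
Context d (T : measurableType d) (R : realType).
Variable mu : {measure set T -> \bar R}.
Variable r : R.
Hypothesis r0 : 0 < r.
Local Notation H := (L2 mu).
Local Notation I := (set_type `[- r, 0]%classic).
Local Notation C := (Cspace r H).
Implicit Types (phi psi : C) (th : I) (u v : R -> H).

Lemma Ceval_val phi th : Ceval phi (val th) = phi th.
Proof. by rewrite /Ceval valK. Qed.

Lemma cts_on_Ceval phi : cts_on (Ceval phi) (- r) 0.
Proof.
move=> x /itv_val[th <-] e /(Ccts phi th)[dlt d0 dP]; exists dlt => // y.
by move=> /itv_val[th' <-]; rewrite !Ceval_val; exact: dP.
Qed.

Lemma C_bounded phi : exists M, forall th, `|phi th| <= M.
Proof.
have [|M MP] := cts_on_bounded _ (@cts_on_Ceval phi); first by rewrite oppr_le0 ltW.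
by exists M => th; rewrite -Ceval_val; apply: MP; exact: val_itv.
Qed.

Let th0 : exists th : I, val th = 0.
Proof. by apply: itv_val; rewrite oppr_le0 ltW/=. Qed.

Lemma normC_ub phi th : `|phi th| <= normC phi.
Proof.
apply: sup_upper_bound; last by exists th.
have [th1 _] := th0; split; first by exists `|phi th1|, th1.
by have [M MP] := C_bounded phi; exists M => _ [th2 _ <-].
Qed.

Lemma distC_le phi psi M : (forall th, `|phi th - psi th| <= M) -> distC phi psi <= M.
Proof.
have [th1 _] := th0; move=> h; apply: ge_sup; first by exists `|phi th1 - psi th1|, th1.
by move=> _ [th2 _ <-].
Qed.

(** The sets from which [segment] chooses coincide, so the equality covers its default value as
    well. *)
Lemma segment_eq u v s t : (forall x, - r <= x <= 0 -> u (s + x) = v (t + x)) ->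
  segment r u s = segment r v t.
Proof.
move=> h; rewrite /segment; congr xget; apply/funext => phi; apply/propext.
by split=> e th; rewrite e h// val_itv.
Qed.

Lemma segmentE u t : cts_on u (t - r) t ->
  forall th, segment r u t th = u (t + val th).
Proof.
move=> uc; have [phi phiE] : exists phi : C, forall th, phi th = u (t + val th).
  apply: Cmk => th e e0.
  have tin th' : t - r <= t + val th' <= t.
    by have /andP[h1 h2] := val_itv th'; rewrite lerD2l h1 gerDl.
  have [dlt d0 dP] := uc _ (tin th) _ e0; exists dlt => // th' h.
  by apply: dP => //; rewrite opprD addrACA subrr add0r.
exact: (@xgetPex _ _ [set phi : C | forall th, phi th = u (t + val th)]
  (ex_intro _ phi phiE)).
Qed.

Lemma Ceval_segment u t s : cts_on u (t - r) t -> - r <= s <= 0 ->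
  Ceval (segment r u t) s = u (t + s).
Proof. by move=> uc /itv_val[th <-]; rewrite Ceval_val segmentE. Qed.

Lemma segment_Ceval phi u : (forall th, u (val th) = phi th) -> segment r u 0 = phi.
Proof.
move=> h; apply: C_ext => th; rewrite segmentE ?add0r ?h//.
move=> x /itv_val[th1 <-] e /(Ccts phi th1)[dlt d0 dP]; exists dlt => // y.
by move=> /itv_val[th' <-]; rewrite !h; exact: dP.
Qed.

End segments.

(** * Mild solutions *)

(** Induction along an interval: the supremum of the t up to which P holds satisfies P by the limit
    clause, and the step clause forbids it to lie below b. *)
Lemma real_induction (R : realType) (a b : R) (P : R -> Prop) :
  P a ->
  (forall t, a <= t < b -> (forall s, a <= s <= t -> P s) ->
     exists2 dlt, 0 < dlt & forall s, t < s < t + dlt -> s <= b -> P s) ->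
  (forall t, a < t <= b -> (forall s, a <= s < t -> P s) -> P t) ->
  forall t, a <= t <= b -> P t.
Proof.
move=> Pa Pstep Plim t0 /andP[at0 t0b].
pose X := [set t | a <= t <= b /\ forall s, a <= s <= t -> P s].
have Xa : X a.
  split; first by rewrite lexx (le_trans at0).
  by move=> s /andP[h1 h2]; have -> : s = a by apply/le_anti; rewrite h1 h2.
have hsX : has_sup X by split; [exists a|exists b => t [/andP[]]].
pose sg := sup X.
have asg : a <= sg by exact: sup_upper_bound.
have sgb : sg <= b by apply: ge_sup; [exists a|move=> t [/andP[]]].
have Plt s : a <= s < sg -> P s.
  move=> /andP[as_ ssg]; have sg0 : 0 < sg - s by rewrite subr_gt0.
  have [t [_ Pt] st] := sup_adherent sg0 hsX.
  by apply: Pt; rewrite as_/= ltW//; move: st; rewrite -/sg; lra.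
have Psg : P sg.
  move: asg; rewrite le_eqVlt => /predU1P[<-//|asg].
  by apply: Plim => //; rewrite asg.
have Ple s : a <= s <= sg -> P s.
  move=> /andP[as_]; rewrite le_eqVlt => /predU1P[->//|ssg].
  by apply: Plt; rewrite as_.
have [bsg|sgltb] := leP b sg; first by apply: Ple; rewrite at0 (le_trans t0b).
have [|dlt d0 dP] := Pstep sg _ Ple; first by rewrite asg.
pose t1 := Num.min (sg + dlt / 2) b.
have sgt1 : sg < t1 by rewrite lt_min sgltb andbT ltrDl divr_gt0.
have : X t1.
  split; first by rewrite ge_min lexx orbT andbT (le_trans asg)// ltW.
  move=> s /andP[as_ st1]; have [ssg|sgs] := leP s sg; first by apply: Ple; rewrite as_.
  have [h1 h2] : s <= sg + dlt / 2 /\ s <= b.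
    by move: st1; rewrite le_min => /andP[].
  apply: dP => //; rewrite sgs/= (le_lt_trans h1)// ltrD2l ltr_pdivrMr//.
  by rewrite ltr_pMr// ltr1n.
by move=> /(sup_upper_bound hsX); rewrite leNgt sgt1.
Qed.

(** The step hypothesis says that the upper right Dini derivative is nonpositive, a condition that a
    merely continuous function can meet. An arbitrarily small slope q absorbs the error terms. *)
Lemma dini_nonincreasing (R : realType) (f : R -> R) (a b : R) : a <= b ->
  cts_on f a b ->
  (forall t, a <= t < b -> forall eps, 0 < eps -> exists2 dlt, 0 < dlt &
     forall h, 0 < h < dlt -> t + h <= b -> f (t + h) <= f t + eps * h) ->
  f b <= f a.
Proof.
move=> ab fc fstep; apply/ler_addgt0Pr => eps eps0.
have c0 : 0 < b - a + 1 by rewrite ltr_wpDl// subr_ge0.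
pose q := eps / (b - a + 1); have q0 : 0 < q by rewrite divr_gt0.
suff : forall t, a <= t <= b -> f t <= f a + q * (t - a).
  move=> /(_ b); rewrite lexx ab => /(_ isT) /le_trans; apply.
  rewrite lerD2l /q mulrAC ler_pdivrMr// ler_pM2l//; lra.
apply: real_induction; first by rewrite subrr mulr0 addr0.
  move=> t tab IH; have [dlt d0 dP] := fstep t tab q q0; exists dlt => // s.
  move=> /andP[ts std] sb; have := dP (s - t).
  rewrite subr_gt0 ts ltrBlDl std (addrC t) subrK => /(_ isT sb).
  have := IH t; rewrite lexx; have /andP[-> _] := tab => /(_ isT); lra.
move=> t /andP[at_ tb] IH; apply/ler_addgt0Pr => z z0.
have tab : a <= t <= b by rewrite (ltW at_).
have [dlt d0 dP] := fc t tab z z0.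
pose s := Num.max a (t - dlt / 2).
have st : s < t by rewrite gt_max at_ gtrBl divr_gt0.
have as_ : a <= s by rewrite le_max lexx.
have := dP s; rewrite as_ (ltW (lt_le_trans st tb)) => /(_ isT).
have sd : t - dlt / 2 <= s by rewrite le_max lexx orbT.
have -> : `|t - s| < dlt by rewrite gtr0_norm ?subr_gt0//; lra.
move=> /(_ isT) /(le_lt_trans (ler_norm _)).
have := IH s; rewrite as_ st => /(_ isT).
have : q * (s - a) <= q * (t - a) by rewrite ler_pM2l// lerD2r ltW.
lra.
Qed.

Section solutions.
Context d (T : measurableType d) (R : realType).
Variable mu : {measure set T -> \bar R}.
Local Notation H := (L2 mu).
Variables (A : unbounded_op mu) (E : R -> H -> H).
Hypothesis genE : generated_by_opp A E.
Variables (e : nat -> H) (lam : nat -> R).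
Hypothesis eb : eigenbasis A e lam.
Hypothesis lam0 : forall k, 0 < lam k.
Variable l0 : R.
Hypothesis l00 : 0 < l0.
Hypothesis l0P : forall k, l0 <= lam k.
Variables (r c : R) (r0 : 0 < r) (c0 : 0 <= c).
Local Notation I := (set_type `[- r, 0]%classic).
Local Notation C := (Cspace r H).
Variables (B : H -> H) (LB MB : R).
Hypothesis LB0 : 0 <= LB.
Hypothesis BL : forall v w, `|B v - B w| <= LB * `|v - w|.
Hypothesis Bb : forall v, `|B v| <= MB.
Variables (eta : C -> R).
Hypothesis eta_cts : continuous eta.
Hypothesis eta_r : forall phi, 0 <= eta phi <= r.
Implicit Types (u v : R -> H) (phi psi : C) (th : I).

Local Notation delay := (delay_term B eta).
Definition forcing u s := delay (segment r u s) - c *: u s.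
Local Notation G := forcing.

(* Duhamel's formula is required between any two times [a <= t], not only from 0,
   which makes the notion stable under time shifts. *)
Definition sol u tmax := cts_on u (- r) tmax /\
  forall a t, 0 <= a -> a <= t -> t <= tmax ->
    is_Riemann_integral (fun s => E (t - s) (G u s)) a t (u t - E (t - a) (u a)).

Lemma MB0 : 0 <= MB. Proof. exact: le_trans (normr_ge0 _) (Bb 0). Qed.

Lemma sol_le u t1 t2 : t1 <= t2 -> sol u t2 -> sol u t1.
Proof.
move=> t12 [uc ui]; split; first exact: cts_onW uc.
by move=> a t a0 at_ tt; apply: ui => //; exact: le_trans tt t12.
Qed.

(** Apply [E (t - a)] to the formula at time a and subtract it from the formula at time t: by the
    semigroup law only the integral over [a, t] remains. *)
Lemma mild_sol phi tmax u : mild_solution E B eta c phi tmax u ->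
  sol u tmax /\ forall th, u (val th) = phi th.
Proof.
move=> [uc uphi ui]; split=> //; split; first exact/cts_onP.
have phi0 : Ceval phi 0 = u 0.
  have [|th th0] := @itv_val R r 0; first by rewrite lexx oppr_le0 ltW.
  by rewrite -th0 Ceval_val uphi.
move=> a t a0 at_ tt.
have [|w wi wE] := ui t; first by rewrite (le_trans a0).
have [|wa wai waE] := ui a; first by rewrite a0 (le_trans at_).
have ta0 : 0 <= t - a by rewrite subr_ge0.
have h := ri_linear (E_linear genE ta0) (E_continuous genE ta0) wai.
have h2 : is_Riemann_integral (fun s => E (t - s) (G u s)) 0 a (E (t - a) wa).
  apply: ri_eq h => s /andP[s0 sa]; rewrite -(E_add genE) ?subr_ge0//.
  by rewrite addrA subrK.
have -> : u t - E (t - a) (u a) = w - E (t - a) wa.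
  rewrite wE waE (ED genE)// -(E_add genE)// subrK opprD addrACA subrr add0r//.
exact: ri_split a0 at_ wi h2.
Qed.

Lemma cts_on_history u tmax t : cts_on u (- r) tmax -> 0 <= t <= tmax ->
  cts_on u (t - r) t.
Proof.
move=> uc /andP[t0 tt]; apply: cts_onW uc => //.
by rewrite lerDr.
Qed.

Lemma segmentP u tmax t th : cts_on u (- r) tmax -> 0 <= t <= tmax ->
  segment r u t th = u (t + val th).
Proof. by move=> us tt; rewrite segmentE//; exact: cts_on_history us tt. Qed.

Lemma delayE u tmax t : cts_on u (- r) tmax -> 0 <= t <= tmax ->
  delay (segment r u t) = B (u (t - eta (segment r u t))).
Proof.
move=> us tt; rewrite /delay_term (Ceval_segment (cts_on_history us tt))//.
by have /andP[h1 h2] := eta_r (segment r u t); rewrite lerN2 h2 oppr_le0.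
Qed.

(** Two changes are controlled separately: that of the evaluation point, through continuity of eta
    and of phi itself, and that of the function at a fixed point. The radius thus depends on the
    modulus of continuity of phi. *)
Lemma delay_cts phi eps : 0 < eps -> exists2 dlt, 0 < dlt &
  forall psi, (forall th, `|phi th - psi th| < dlt) -> `|delay phi - delay psi| < eps.
Proof.
move=> eps0; have L1 : 0 < LB + 1 by rewrite ltr_wpDl.
pose z := eps / (LB + 1) / 2; have z0 : 0 < z by rewrite !divr_gt0.
have Cin psi : - r <= - eta psi <= 0.
  by have /andP[h1 h2] := eta_r psi; rewrite lerN2 h2 oppr_le0.
have [d1 d10 P1] := @cts_on_Ceval _ _ _ _ _ phi _ (Cin phi) _ z0.
have [d2 d20 P2] := Cfun_cts (W := R) eta_cts phi d10.
exists (Num.min d2 z); first by rewrite lt_min d20.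
move=> psi h; have h2 th : `|phi th - psi th| < d2.
  by have := h th; rewrite lt_min => /andP[].
have h1 : `|Ceval phi (- eta phi) - Ceval phi (- eta psi)| < z.
  apply: P1; first exact: Cin.
  by rewrite opprK addrC distrC; exact: P2.
have h3 : `|Ceval phi (- eta psi) - Ceval psi (- eta psi)| < z.
  have [th <-] := itv_val (Cin psi); rewrite !Ceval_val.
  by have := h th; rewrite lt_min => /andP[].
apply: le_lt_trans (BL _ _) _.
have h4 : `|Ceval phi (- eta phi) - Ceval psi (- eta psi)| < eps / (LB + 1).
  rewrite -(subrKA (Ceval phi (- eta psi))) (le_lt_trans (ler_normD _ _))//.
  by rewrite (splitr (eps / _)) ltrD.
move: h4; rewrite ltr_pdivlMr// mulrC; apply: le_lt_trans.
by rewrite ler_wpM2r// lerDl.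
Qed.

Lemma segment_cts u tmax s eps : cts_on u (- r) tmax -> 0 <= s <= tmax -> 0 < eps ->
  exists2 dlt, 0 < dlt & forall s', 0 <= s' <= tmax -> `|s - s'| < dlt ->
    forall th, `|segment r u s th - segment r u s' th| < eps.
Proof.
move=> us ss eps0; have [dlt d0 dP] := cts_on_unif us eps0.
exists dlt => // s' ss' h th; rewrite !(segmentP _ us)//.
have tin x : 0 <= x <= tmax -> - r <= x + val th <= tmax.
  move=> /andP[x0 xt]; have /andP[h1 h2] := val_itv th.
  by apply/andP; split; lra.
by apply: dP; rewrite ?tin// opprD addrACA subrr addr0.
Qed.

Lemma forcing_cts u tmax : sol u tmax -> cts_on (G u) 0 tmax.
Proof.
move=> us s ss eps eps0; have e2 : 0 < eps / 2 by rewrite divr_gt0.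
have [d1 d10 P1] := delay_cts (segment r u s) e2.
have [d2 d20 P2] := segment_cts us.1 ss d10.
have c1 : 0 < c + 1 by rewrite ltr_wpDl.
have ss' : - r <= s <= tmax.
  by have /andP[h1 ->] := ss; rewrite andbT (le_trans _ h1)// oppr_le0 ltW.
have [d3 d30 P3] := us.1 s ss' _ (divr_gt0 e2 c1).
exists (Num.min d2 d3); first by rewrite lt_min d20.
move=> y yt; rewrite lt_min => /andP[y2 y3].
have h1 := P1 _ (P2 y yt y2).
have h3 : `|u s - u y| < eps / 2 / (c + 1).
  apply: P3 => //; have /andP[y0 ->] := yt.
  by rewrite andbT (le_trans _ y0)// oppr_le0 ltW.
have -> : G u s - G u y =
  (delay (segment r u s) - delay (segment r u y)) - c *: (u s - u y).
  by rewrite /forcing scalerBr !opprD opprK addrACA.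
apply: le_lt_trans (ler_normB _ _) _; rewrite (splitr eps) ltrD//.
rewrite normrZ ger0_norm//; move: h3; rewrite ltr_pdivlMr// mulrC.
by apply: le_lt_trans; rewrite ler_wpM2r// lerDl.
Qed.

Lemma forcing_bound u s rho : `|u s| <= rho -> `|G u s| <= MB + c * rho.
Proof.
move=> us; apply: le_trans (ler_normB _ _) _; rewrite lerD//; first exact: Bb.
by rewrite normrZ ger0_norm// ler_wpM2l.
Qed.

Lemma ri_cst (v : H) (a b : R) : is_Riemann_integral (fun=> v) a b ((b - a) *: v).
Proof.
move=> eps eps0; exists 1 => // s xi ps _.
by rewrite -scaler_suml (sum_steps ps) subrr normr0.
Qed.

(** One Euler step for the forcing. The semigroup term is kept whole, since u t need not lie in the
    domain of A. *)
Lemma sol_step u tmax t eps : sol u tmax -> 0 <= t < tmax -> 0 < eps ->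
  exists2 dlt, 0 < dlt & forall h, 0 < h < dlt -> t + h <= tmax ->
    `|u (t + h) - (E h (u t) + h *: G u t)| <= eps * h.
Proof.
move=> us /andP[t0 tt] eps0; have e2 : 0 < eps / 2 by rewrite divr_gt0.
have ttT : 0 <= t <= tmax by rewrite t0 ltW.
have [d1 d10 P1] := forcing_cts us ttT e2.
have [d2 d20 P2] := E_right0 genE (G u t) e2.
exists (Num.min d1 d2); first by rewrite lt_min d10.
move=> h /andP[h0]; rewrite lt_min => /andP[h1 h2] hT.
have tth : t <= t + h by rewrite lerDl ltW.
have i1 := us.2 t (t + h) t0 tth hT.
have i2 := ri_cst (G u t) t (t + h).
have hh : t + h - t = h by rewrite addrAC subrr add0r.
have -> : eps * h = (t + h - t) * eps by rewrite hh mulrC.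
rewrite hh in i1 i2; rewrite opprD addrA.
apply: (ri_near i1 i2 tth) => s /andP[ts sth].
have sh : 0 <= t + h - s by rewrite subr_ge0.
rewrite -(subrKA (E (t + h - s) (G u t))) -(EB genE)//.
apply: le_trans (ler_normD _ _) _; rewrite (splitr eps) lerD//.
  apply: le_trans (E_contract genE eb lam0 _ sh) _; rewrite distrC ltW//.
  apply: P1; first by rewrite (le_trans t0)//= (le_trans sth).
  by rewrite distrC ger0_norm ?subr_ge0//; lra.
by rewrite distrC ltW//; apply: P2; rewrite sh/=; lra.
Qed.

(** The k-th coefficient is multiplied by e^{-lam_k h} - c h, which lies between - e^{-l0 h} and
    e^{-l0 h}. So the damping term can be merged with the semigroup without harming the decay. *)
Lemma damped_step h (v : H) : 0 <= h -> c * h <= expR (- l0 * h) ->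
  `|E h v - (c * h) *: v| <= expR (- l0 * h) * `|v|.
Proof.
move=> h0 ch; apply: (norm_coef_le eb) => [|k]; first exact: expR_ge0.
rewrite L2dotBl (dot_E genE eb lam0)// L2dotZl -mulrBl exprMn.
rewrite ler_wpM2r ?sqr_ge0//.
have : expR (- lam k * h) <= expR (- l0 * h).
  by rewrite ler_expR !mulNr lerN2 ler_wpM2r.
have := expR_gt0 (- lam k * h); have : 0 <= c * h by rewrite mulr_ge0.
move: (expR (- lam k * h)) (expR (- l0 * h)) (c * h) ch => x y z zy z0 x0 xy.
rewrite -subr_ge0.
have -> : y ^+ 2 - (x - z) ^+ 2 = (y - (x - z)) * (y + (x - z)) by ring.
by rewrite mulr_ge0//; lra.
Qed.

Lemma expR_le1D2x (x : R) : 0 <= x <= 2^-1 -> expR x <= 1 + 2 * x.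
Proof.
move=> /andP[x0 x2]; have := expR_ge1Dx (- x).
have : expR x * expR (- x) = 1 by rewrite -expRD subrr expR0.
have := expR_gt0 x; move: (expR x) (expR (- x)) => p q p0 pq hq.
have h : p * (1 - x) <= p * q by rewrite ler_pM2l.
rewrite pq in h.
have h2 : 1 <= (1 + 2 * x) * (1 - x) by nra.
rewrite -(@ler_pM2r _ (1 - x)); last lra.
exact: le_trans h h2.
Qed.

(** The function e^{l0 s} (|u s| - MB/l0) has nonpositive upper Dini derivative: [sol_step] gives
    the increment, [damped_step] disposes of the semigroup and the damping, and only the bound MB on
    B is left. *)
Lemma sol_bound u tmax a t : sol u tmax -> 0 <= a -> a <= t -> t <= tmax ->
  `|u t| <= expR (- l0 * (t - a)) * `|u a| + MB / l0.
Proof.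
move=> us a0 at_ tT; pose K := MB / l0.
have K0 : 0 <= K by rewrite divr_ge0 ?MB0// ltW.
have KM : K * l0 = MB by rewrite /K divfK// gt_eqF.
suff : expR (l0 * t) * (`|u t| - K) <= expR (l0 * a) * (`|u a| - K).
  have -> : - l0 * (t - a) = - (l0 * t) + l0 * a by ring.
  rewrite expRD; have := expR_gt0 (l0 * t); have := expR_gt0 (l0 * a).
  have : expR (- (l0 * t)) * expR (l0 * t) = 1 by rewrite -expRD addNr expR0.
  have : expR (- (l0 * t)) * expR (l0 * a) <= 1.
    by rewrite -expRD expR_le1 addrC subr_le0 ler_pM2l.
  have := expR_gt0 (- (l0 * t)).
  move: (expR (- (l0 * t))) (expR (l0 * t)) (expR (l0 * a)) => z p q z0 zq1 zp q0 p0 h.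
  have : z * (p * (`|u t| - K)) <= z * (q * (`|u a| - K)) by rewrite ler_pM2l.
  rewrite !mulrA zp mul1r -/K; have : 0 <= z * q by rewrite mulr_ge0 ?ltW.
  by move: (z * q) zq1 => w w1 w0; nra.
have tT' x : a <= x <= t -> - r <= x <= tmax.
  move=> /andP[ax xt]; rewrite (le_trans xt)// andbT.
  by rewrite (le_trans _ (le_trans a0 ax))// oppr_le0 ltW.
apply: (@dini_nonincreasing _ (fun s => expR (l0 * s) * (`|u s| - K))) => //.
  apply/(@cts_onP R R); apply/subspace_continuousP => x /=; rewrite in_itv/= => xat.
  apply: cvgM.
    apply: cvg_within_filter; apply: continuous_comp; last exact: continuous_expR.
    exact: mulrl_continuous.
  apply: cvgB; last exact: cvg_cst.
  apply/cvgrPdist_lt => eps /(us.1 x (tT' x xat))[dlt d0 dP]; apply/nbhs_ballP.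
  exists dlt => //= y xy /=; rewrite in_itv/= => yat.
  by apply: le_lt_trans (ler_dist_dist _ _) _; apply: dP => //; exact: tT'.
move=> s /andP[as_ st] eps eps0.
have ex0 : 0 < expR (l0 * s) by exact: expR_gt0.
pose eps1 := eps / expR (l0 * s).
have eps10 : 0 < eps1 by rewrite divr_gt0.
have [|dlt d0 dP] := @sol_step u tmax s (eps1 / 4) us _ (divr_gt0 eps10 (ltr0n _ 4)).
  by rewrite (le_trans a0)//= (lt_le_trans st).
(* If l0 h <= 1/2 then e^{l0 h} <= 1 + 2 l0 h <= 2; the other entry makes (e^{l0 h} - 1) MB at most
   [eps1 / 2]. The bound on h by 1/(4(c+1)) gives c h <= 1/4, below e^{- l0 h}. *)
pose eta1 := Num.min 2^-1 (eps1 / (4 * (MB + 1))).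
have M1 : 0 < 4 * (MB + 1) by rewrite mulr_gt0// ltr_wpDl// MB0.
have eta10 : 0 < eta1 by rewrite lt_min invr_gt0 ltr0n/= divr_gt0.
exists (Num.min dlt (Num.min (eta1 / l0) (4 * (c + 1))^-1)).
  by rewrite !lt_min d0 divr_gt0//= invr_gt0 mulr_gt0// ltr_wpDl.
move=> h /andP[h0]; rewrite !lt_min => /and3P[h1 h2 h3] sh.
have hT : s + h <= tmax by exact: le_trans tT.
have := dP h; rewrite h0 => /(_ h1 hT) st1.
have lh0 : 0 <= l0 * h by rewrite mulr_ge0 ?ltW.
have lh1 : l0 * h <= eta1 by move: h2; rewrite ltr_pdivlMr// mulrC => /ltW.
have [lh2 lh4] : l0 * h <= 2^-1 /\ l0 * h <= eps1 / (4 * (MB + 1)).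
  by move: lh1; rewrite le_min => /andP[].
have q1 : expR (l0 * h) <= 1 + 2 * (l0 * h) by apply: expR_le1D2x; rewrite lh0.
have q2 := expR_ge1Dx (l0 * h).
have qN : expR (- l0 * h) * expR (l0 * h) = 1 by rewrite -expRD mulNr addNr expR0.
have qp := expR_gt0 (- l0 * h).
have ch : c * h <= expR (- l0 * h).
  have c1 : 0 < 4 * (c + 1) by rewrite mulr_gt0// ltr_wpDl.
  move: h3; rewrite -div1r ltr_pdivlMr// => h3.
  have : c * h <= 4^-1 by have : 0 <= c * h := mulr_ge0 c0 (ltW h0); nra.
  by move: (expR (l0 * h)) (expR (- l0 * h)) q1 q2 qN qp => p q *; nra.
have dmp := damped_step (u s) (ltW h0) ch.
have b1 : `|u (s + h)| <= expR (- l0 * h) * `|u s| + h * MB + eps1 / 4 * h.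
  have -> : u (s + h) = (u (s + h) - (E h (u s) + h *: G u s)) +
     ((E h (u s) - (c * h) *: u s) + h *: delay (segment r u s)).
    have -> : E h (u s) - (c * h) *: u s + h *: delay (segment r u s) =
        E h (u s) + h *: G u s.
      by rewrite /forcing scalerBr scalerA (mulrC h c) addrAC -addrA.
    by rewrite subrK.
  rewrite addrC (le_trans (ler_normD _ _))// lerD//.
  rewrite (le_trans (ler_normD _ _))// lerD// normrZ gtr0_norm// ler_pM2l//.
  exact: Bb.
have eh : expR (l0 * (s + h)) = expR (l0 * s) * expR (l0 * h) by rewrite mulrDr expRD.
rewrite eh.
have -> : eps * h = expR (l0 * s) * (eps1 * h).
  by rewrite /eps1 mulrA [_ * (eps / _)]mulrC divfK ?gt_eqF.
rewrite -mulrA -mulrDr ler_pM2l//.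
have m4 : l0 * h * (4 * (MB + 1)) <= eps1 by rewrite -ler_pdivlMr.
have M0 := MB0.
have p0 : 0 < expR (l0 * h) by exact: expR_gt0.
have : expR (l0 * h) * (`|u (s + h)| - K) <=
   expR (l0 * h) * (expR (- l0 * h) * `|u s| + h * MB + eps1 / 4 * h - K).
  by rewrite ler_pM2l// lerD2r.
move/le_trans; apply; rewrite -addrA -addrA mulrDr mulrA (mulrC (expR (l0 * h))) qN mul1r.
rewrite -!addrA lerD2l.
move: (expR (l0 * h)) q1 q2 p0 => p q1 q2 p0.
have : K * (l0 * h) <= K * (p - 1) by rewrite ler_wpM2l//; lra.
rewrite mulrA KM => K1.
have h4 : (p - 1) * MB <= eps1 / 2.
  have : (p - 1) * MB <= 2 * (l0 * h) * MB by rewrite ler_wpM2r//; lra.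
  nra.
have h5 : p * (eps1 / 4) <= eps1 / 2 by nra.
have : h * ((p - 1) * MB + p * (eps1 / 4)) <= h * eps1 by rewrite ler_pM2l//; lra.
lra.
Qed.

Lemma sol_energy u tmax a t rho c1 n : sol u tmax -> 0 <= a -> a <= t -> t <= tmax ->
  (forall s, a <= s <= t -> `|u s| <= rho) ->
  energy e lam n (E (t - a) (u a)) <= c1 ->
  energy e lam n (u t) <= 2 * (c1 + (t - a) * (MB + c * rho) ^+ 2).
Proof.
move=> us a0 at_ tT ub ec.
have h := ri_energy genE eb lam0 n at_ (us.2 a t a0 at_ tT)
  (fun s sat => forcing_bound (ub s sat)).
rewrite -[u t](subrK (E (t - a) (u a))) addrC.
apply: le_trans (energyD _ lam0 _ _ _) _.
by rewrite ler_pM2l// lerD.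
Qed.

Lemma sol_holder u tmax t h rho c1 : sol u tmax -> 0 <= t -> 0 <= h -> t + h <= tmax ->
  (forall s, t <= s <= t + h -> `|u s| <= rho) ->
  (forall n, energy e lam n (u t) <= c1) ->
  `|u (t + h) - u t| <= Num.sqrt (h * c1) + h * (MB + c * rho).
Proof.
move=> us t0 h0 tT ub ec; have tth : t <= t + h by rewrite lerDl.
have := us.2 t (t + h) t0 tth tT.
have hh : t + h - t = h by rewrite addrAC subrr add0r.
rewrite hh => i1; rewrite -(subrKA (E h (u t))) addrC.
rewrite (le_trans (ler_normD _ _))// lerD ?(E_holder genE eb lam0)//.
have := ri_norm_le i1 tth _; rewrite hh; apply => s /andP[ts sth].
apply: le_trans (E_contract genE eb lam0 _ _) _; first by rewrite subr_ge0.
by apply: forcing_bound; apply: ub; rewrite ts.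
Qed.

Lemma forcing_shift u s x : G (fun y => u (y + s)) x = G u (x + s).
Proof.
rewrite /forcing; congr (delay _ - _); apply: segment_eq => y _.
by rewrite addrAC.
Qed.

Lemma sol_shift u tmax s : sol u tmax -> 0 <= s -> s <= tmax ->
  sol (fun x => u (x + s)) (tmax - s).
Proof.
move=> [uc ui] s0 sT; split.
  move=> x /andP[x1 x2] eps eps0.
  have [|dlt d0 dP] := uc (x + s) _ eps eps0.
    by rewrite -lerBrDr x2 andbT (le_trans x1)// lerDl.
  exists dlt => // y /andP[y1 y2] xy; apply: dP.
    by rewrite -lerBrDr y2 andbT (le_trans y1)// lerDl.
  by rewrite opprD addrACA subrr addr0.
move=> a t a0 at_ tT.
have := ui (a + s) (t + s); rewrite addr_ge0// lerD2r at_ -lerBrDr tT => /(_ isT isT isT).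
move=> i1; have := @ri_shift _ _ _ _ _ _ _ _ s i1; rewrite !addrK.
have -> : t + s - (a + s) = t - a by rewrite opprD addrACA subrr addr0.
apply: ri_eq => x _; rewrite forcing_shift.
by rewrite opprD addrACA subrr addr0.
Qed.

(** The delay term is continuous at each history of v with a radius depending on it; compactness of
    the time interval makes the radius uniform along v. *)
Lemma delay_uniform v tmax eps : cts_on v (- r) tmax -> 0 < eps ->
  exists2 dlt, 0 < dlt & forall u, cts_on u (- r) tmax ->
    (forall x, - r <= x <= tmax -> `|v x - u x| < dlt) ->
    forall s, 0 <= s <= tmax ->
      `|delay (segment r v s) - delay (segment r u s)| < eps.
Proof.
move=> vc eps0; have e2 : 0 < eps / 2 by rewrite divr_gt0.
have := (compact_near_coveringP (`[0, tmax]%classic : set R)).1 (@segment_compact R 0 tmax).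
move=> /(_ R (0 : R)^'+ (fun dlt s => 0 <= s <= tmax -> forall u, cts_on u (- r) tmax ->
    (forall x, - r <= x <= tmax -> `|v x - u x| < dlt) ->
      `|delay (segment r v s) - delay (segment r u s)| < eps)).
case=> [s /=|dlt d0 dP].
  rewrite in_itv/= => sT.
  have [d1 d10 P1] := delay_cts (segment r v s) e2.
  have d12 : 0 < d1 / 2 by rewrite divr_gt0.
  have [d2 d20 P2] := segment_cts vc sT d12.
  exists (ball s d2, [set t | 0 < t < d1 / 2]).
    split; first exact: nbhsx_ballx.
    by apply/near_right0P; exists (d1 / 2).
  move=> [z t] /= [sz /andP[t0 td]] zT u uc uv; rewrite /ball/= in sz.
  rewrite -(subrKA (delay (segment r v s))) (le_lt_trans (ler_normD _ _))//.
  rewrite (splitr eps) ltrD//.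
    rewrite distrC; apply: P1 => th; apply: lt_trans (P2 z zT sz th) _.
    by rewrite ltr_pdivrMr// ltr_pMr// ltr1n.
  apply: P1 => th; rewrite -(subrKA (segment r v z th)).
  rewrite (le_lt_trans (ler_normD _ _))// (splitr d1) ltrD ?P2//.
  rewrite (segmentP _ vc)// (segmentP _ uc)//; apply: lt_trans td; apply: uv.
  have /andP[h1 h2] := val_itv th; have /andP[z0 z1] := zT.
  by apply/andP; split; lra.
have d2 : 0 < dlt / 2 by rewrite divr_gt0.
exists (dlt / 2) => // u uc uv s sT.
have bd : ball_ (fun z : R => `|z|) 0 dlt (dlt / 2).
  by rewrite /= sub0r normrN gtr0_norm// ltr_pdivrMr// ltr_pMr// ltr1n.
by apply: (dP _ bd d2 s) => //; rewrite /= in_itv.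
Qed.

Lemma cts_on_uniform_limit (v : R -> H) a b :
  (forall eps, 0 < eps -> exists2 u, cts_on u a b &
     forall x, a <= x <= b -> `|v x - u x| < eps) -> cts_on v a b.
Proof.
move=> h x xab eps eps0; have e3 : 0 < eps / 3 by rewrite divr_gt0.
have [u uc uv] := h _ e3; have [dlt d0 dP] := uc x xab _ e3.
exists dlt => // y yab xy; have := dP y yab xy; have := uv x xab; have := uv y yab.
rewrite distrC => h1 h2 h3.
rewrite -(subrKA (u x)) (le_lt_trans (ler_normD _ _))//.
rewrite -[u x - v y](subrKA (u y)).
have := ler_normD (u x - u y) (u y - v y); lra.
Qed.

(** Uniform closeness of u to v makes their forcings uniformly close by [delay_uniform]; the
    integral for v then exists, with the right value, by [ri_uniform_limit]. *)
Lemma sol_limit v tmax :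
  (forall eps, 0 < eps -> exists2 u, sol u tmax &
     forall x, - r <= x <= tmax -> `|v x - u x| < eps) -> sol v tmax.
Proof.
move=> h; have vc : cts_on v (- r) tmax.
  by apply: cts_on_uniform_limit => eps /h[u [uc _] uv]; exists u.
split=> // a t a0 at_ tT; apply: ri_uniform_limit => // eps eps0.
have e2 : 0 < eps / 2 by rewrite divr_gt0.
have [dlt d0 dP] := delay_uniform vc e2.
have c1 : 0 < c + 1 by rewrite ltr_wpDl.
have m0 : 0 < Num.min dlt (Num.min (eps / 2) (eps / 2 / (c + 1))).
  by rewrite !lt_min d0 e2 divr_gt0.
have [u us uv] := h _ m0.
have uv' x : - r <= x <= tmax ->
    [/\ `|v x - u x| < dlt, `|v x - u x| < eps / 2 & `|v x - u x| < eps / 2 / (c + 1)].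
  by move=> /uv; rewrite !lt_min => /and3P[].
have tin s : 0 <= s -> s <= tmax -> - r <= s <= tmax.
  by move=> s0 ->; rewrite andbT (le_trans _ s0)// oppr_le0 ltW.
exists (fun s => E (t - s) (G u s)), (u t - E (t - a) (u a)); split.
- exact: us.2.
- have -> : v t - E (t - a) (v a) - (u t - E (t - a) (u a)) =
      (v t - u t) - E (t - a) (v a - u a).
    rewrite (EB genE) ?subr_ge0// !opprB addrACA [RHS]addrACA.
    by rewrite [- E _ _ - _]addrC.
  rewrite (le_trans (ler_normB _ _))// (splitr eps) lerD//.
    have [_ /ltW] := uv' t (tin t (le_trans a0 at_) tT); exact.
  apply: le_trans (E_contract genE eb lam0 _ _) _; first by rewrite subr_ge0.
  have [_ /ltW] := uv' a (tin a a0 (le_trans at_ tT)); exact.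
- move=> s /andP[as_ st].
  have s0 := le_trans a0 as_; have sT := le_trans st tT.
  rewrite -(EB genE) ?subr_ge0//.
  apply: le_trans (E_contract genE eb lam0 _ _) _; first by rewrite subr_ge0.
  have -> : G v s - G u s =
    (delay (segment r v s) - delay (segment r u s)) - c *: (v s - u s).
    by rewrite /forcing scalerBr !opprD opprK addrACA.
  rewrite (le_trans (ler_normB _ _))// (splitr eps) lerD//.
    apply/ltW/dP; [exact: us.1|by move=> x /uv'[]|by rewrite s0].
  rewrite normrZ ger0_norm//.
  have [_ _] := uv' s (tin s s0 sT); rewrite ltr_pdivlMr// => /ltW.
  apply: le_trans; rewrite mulrC ler_wpM2l// lerDl//.
Qed.

End solutions.

(** * Uniqueness *)

Section window_arithmetic.
Variable R : realType.
Implicit Types r s t x y q a b : R.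

Lemma window_shift r s x : 0 <= s -> - r <= x <= 0 -> - r <= s + x <= s.
Proof. by move=> s0 /andP[x1 x2]; apply/andP; split; lra. Qed.

Lemma window_past r s t x y q : 0 <= s -> - r <= x -> x <= - y -> q < y -> s < t + q ->
  - r <= s + x <= t.
Proof. by move=> *; apply/andP; split; lra. Qed.

Lemma window_delay r s t y q : t <= s -> y <= r -> q < y -> s < t + q ->
  - r <= s - y - t <= 0.
Proof. by move=> *; apply/andP; split; lra. Qed.

Lemma half_lt a b : a - b < a / 2 -> a / 2 < b. Proof. by lra. Qed.

Lemma le2_of_lt1 a b x : x <= a + b -> a < 1 -> b < 1 -> x <= 2. Proof. by lra. Qed.

Lemma half_step q x y : 0 <= q -> 0 <= x -> x <= y -> y * (2 * (q + 1)) < 1 -> x * q <= 2^-1.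
Proof. by move=> *; nra. Qed.

End window_arithmetic.

Section uniqueness.
Context d (T : measurableType d) (R : realType).
Variable mu : {measure set T -> \bar R}.
Local Notation H := (L2 mu).
Variables (A : unbounded_op mu) (E : R -> H -> H).
Hypothesis genE : generated_by_opp A E.
Variables (e : nat -> H) (lam : nat -> R).
Hypothesis eb : eigenbasis A e lam.
Hypothesis lam0 : forall k, 0 < lam k.
Variable l0 : R.
Hypothesis l00 : 0 < l0.
Hypothesis l0P : forall k, l0 <= lam k.
Variables (r c : R) (r0 : 0 < r) (c0 : 0 <= c).
Local Notation I := (set_type `[- r, 0]%classic).
Local Notation C := (Cspace r H).
Variables (B : H -> H) (LB MB : R).
Hypothesis LB0 : 0 <= LB.
Hypothesis BL : forall v w, `|B v - B w| <= LB * `|v - w|.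
Hypothesis Bb : forall v, `|B v| <= MB.
Variables (eta : C -> R).
Hypothesis eta_cts : continuous eta.
Hypothesis eta_r : forall phi, 0 <= eta phi <= r.
Implicit Types (u v : R -> H) (phi psi : C) (th : I).

Local Notation delay := (delay_term B eta).
Local Notation G := (forcing c B eta).

Local Notation sol := (sol E c B eta).

Variables (Thu Thl : C -> R).
Hypothesis Thl_cts : continuous Thl.
Hypothesis Th_r : forall phi, [/\ 0 <= Thl phi, Thl phi <= Thu phi & Thu phi <= r].
Hypothesis eta_Th : forall phi psi,
  (forall th, - Thu phi <= val th <= - Thl phi -> psi th = phi th) ->
  eta psi = eta phi.
Hypothesis Hab : (forall phi, 0 < Thl phi) \/ delay_condition_b Thl eta.

Lemma Cfun_segment (F : C -> R) u tmax t eps : continuous F ->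
  cts_on u (- r) tmax -> 0 <= t <= tmax -> 0 < eps ->
  exists2 dlt, 0 < dlt & forall s, 0 <= s <= tmax -> `|t - s| < dlt ->
    `|F (segment r u t) - F (segment r u s)| < eps.
Proof.
move=> cF uc tT eps0; have [d1 d10 P1] := Cfun_cts (W := R) cF (segment r u t) eps0.
have [d2 d20 P2] := segment_cts uc tT d10.
by exists d2 => // s sT ts; apply: P1 => th; exact: P2.
Qed.

(* If Thl > 0 at the current state, then for a short time eta only sees the
   common past, so eta(u_s) = eta(v_s); if Thl = 0, condition (b) makes the
   common past Lipschitz and keeps the delay away from 0. *)
Lemma delay_locally_lipschitz u v tmax t : cts_on u (- r) tmax -> cts_on v (- r) tmax ->
  0 <= t <= tmax -> (forall x, - r <= x <= t -> u x = v x) ->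
  exists dlt Lam, [/\ 0 < dlt, 0 <= Lam &
    forall s m, t <= s -> s < t + dlt -> s <= tmax ->
      (forall x, t <= x <= s -> `|u x - v x| <= m) ->
      `|delay (segment r u s) - delay (segment r v s)| <= Lam * m].
Proof.
move=> uc vc tT uv; have /andP[t0 tT'] := tT.
have segE : segment r u t = segment r v t.
  apply: segment_eq => x xr; apply: uv; exact: window_shift.
set psi := segment r u t in segE.
have m_ge0 s m : t <= s -> (forall x, t <= x <= s -> `|u x - v x| <= m) -> 0 <= m.
  by move=> ts /(_ t); rewrite lexx ts => /(_ isT); exact: le_trans.
have uv_le s m x : t <= s -> (forall x, t <= x <= s -> `|u x - v x| <= m) ->
    - r <= x <= s -> `|u x - v x| <= m.
  move=> ts h /andP[x1 x2]; have [xt|tx] := leP x t.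
    by rewrite uv ?x1// subrr normr0; exact: m_ge0 ts h.
  by apply: h; rewrite (ltW tx).
have [Thl0|Thl0] := ltP 0 (Thl psi).
  have [d1 d10 P1] := Cfun_segment Thl_cts uc tT (divr_gt0 Thl0 (ltr0n _ 2)).
  exists (Num.min d1 (Thl psi / 2)), LB; split => //; first by rewrite lt_min d10 divr_gt0.
  move=> s m ts std sT h; have sT' : 0 <= s <= tmax by rewrite (le_trans t0).
  have [sd1 sd2] : s < t + d1 /\ s < t + Thl psi / 2.
    by move: std; rewrite -ltrBlDl lt_min !ltrBlDl => /andP[].
  have ThlS : Thl psi / 2 < Thl (segment r u s).
    have := P1 s sT'; rewrite distrC ger0_norm ?subr_ge0// ltrBlDl => /(_ sd1).
    by move=> /(le_lt_trans (ler_norm _)); lra.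
  have etaE : eta (segment r v s) = eta (segment r u s).
    apply: eta_Th => th /andP[h1 h2].
    rewrite (segmentP _ vc)// (segmentP _ uc)// uv//.
    have /andP[v1 _] := val_itv th.
    by apply: window_past v1 h2 ThlS sd2; exact: le_trans ts.
  rewrite (delayE B eta_r uc)// (delayE B eta_r vc)// etaE (le_trans (BL _ _))// ler_wpM2l//.
  apply: uv_le ts h _; have /andP[h1 h2] := eta_r (segment r u s).
  by apply/andP; split; lra.
have {}Thl0 : Thl psi = 0 by apply/le_anti; rewrite Thl0/=; have [] := Th_r psi.
case: Hab => [/(_ psi)|[[L LP] eta0 [om [Le [om0 Le0 Lip]]]]]; first by rewrite Thl0 ltxx.
have e0 := eta0 psi Thl0.
have e2 : 0 < eta psi / 2 by rewrite divr_gt0.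
have [d1 d10 P1] := Cfun_segment eta_cts uc tT e2.
have [d2 d20 P2] := Cfun_segment eta_cts vc tT e2.
have [d3 d30 P3] := segment_cts uc tT om0.
have [d4 d40 P4] := segment_cts vc tT om0.
pose L1 := Num.max L 0.
have L10 : 0 <= L1 by rewrite le_max lexx orbT.
have psiL th th' : `|psi th - psi th'| <= L1 * `|val th - val th'|.
  have [->|tt'] := eqVneq th th'; first by rewrite !subrr !normr0 mulr0.
  have tv : 0 < `|val th - val th'|.
    by rewrite normr_gt0 subr_eq0; apply: contra_neq tt'; exact: val_inj.
  rewrite -ler_pdivrMr//; apply: le_trans (LP psi Thl0 th th' tt') _.
  by rewrite le_max lexx.
exists (Num.min (Num.min d1 d2) (Num.min (Num.min d3 d4) (eta psi / 2))), (LB * (L1 * Le)).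
split; first by rewrite !lt_min d10 d20 d30 d40.
  by rewrite !mulr_ge0// ltW.
move=> s m ts; rewrite -ltrBlDl !lt_min !ltrBlDl.
move=> /andP[/andP[sd1 sd2] /andP[/andP[sd3 sd4] sd5]] sT h.
have sT' : 0 <= s <= tmax by rewrite (le_trans t0).
have m0 := m_ge0 _ _ ts h.
have ets dd : s < t + dd -> `|t - s| < dd.
  by rewrite distrC ger0_norm ?subr_ge0// ltrBlDl.
have eu : eta psi / 2 < eta (segment r u s).
  by have := P1 s sT' (ets _ sd1) => /(le_lt_trans (ler_norm _)) /half_lt.
have ev : eta psi / 2 < eta (segment r v s).
  by have := P2 s sT' (ets _ sd2) => /(le_lt_trans (ler_norm _)); rewrite -segE => /half_lt.
(* Both segments are within [om] of psi, which belongs to Z, so the local Lipschitz bound on eta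
   applies to them. *)
have etaL : `|eta (segment r u s) - eta (segment r v s)| <= Le * m.
  apply: (@le_trans _ _ (Le * distC (segment r u s) (segment r v s))).
    apply: Lip; exists psi => //; apply: (distC_le r0) => // th; rewrite distrC ltW//.
      by apply: P3 => //; exact: ets.
    by rewrite segE; apply: P4 => //; exact: ets.
  rewrite ler_pM2l//; apply: (distC_le r0) => // th.
  rewrite (segmentP _ uc)// (segmentP _ vc)//; apply: (uv_le _ _ _ ts h).
  by apply: window_shift; [exact: le_trans ts|exact: val_itv].
have /andP[eu1 eu2] := eta_r (segment r u s).
have /andP[ev1 ev2] := eta_r (segment r v s).
(* Both delays exceed [eta psi / 2] and s < t + [eta psi / 2], so the delayed times fall into the
   common window [t - r, t], on which psi is Lipschitz. *)
have [|th thE] := @itv_val R r (s - eta (segment r u s) - t).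
  exact: window_delay ts eu2 eu sd5.
have [|th' thE'] := @itv_val R r (s - eta (segment r v s) - t).
  exact: window_delay ts ev2 ev sd5.
have uE : u (s - eta (segment r u s)) = psi th.
  by rewrite (segmentP _ uc)// thE [t + _]addrC subrK.
have vE : v (s - eta (segment r v s)) = psi th'.
  by rewrite segE (segmentP _ vc)// thE' [t + _]addrC subrK.
rewrite (delayE B eta_r uc)// (delayE B eta_r vc)// uE vE (le_trans (BL _ _))// -mulrA ler_wpM2l//.
apply: le_trans (psiL _ _) _; rewrite -mulrA ler_wpM2l// thE thE'.
apply: le_trans etaL; rewrite distrC le_eqVlt; apply/orP; left; apply/eqP; congr `|_|.
by ring.
Qed.

(** Real induction in time: once u and v agree up to t, [delay_locally_lipschitz] makes Duhamel's
    formula a contraction for their difference on a short interval after t. The limit clause is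
    continuity. *)
Lemma sol_unique u v tmax : sol u tmax -> sol v tmax ->
  (forall x, - r <= x <= 0 -> u x = v x) -> forall x, - r <= x <= tmax -> u x = v x.
Proof.
move=> us vs uv0 x /andP[x1 x2]; have [x0|x0] := leP x 0; first by rewrite uv0 ?x1.
suff : forall t, 0 <= t <= tmax -> u t = v t by apply; rewrite (ltW x0).
apply: real_induction; first by apply: uv0; rewrite lexx oppr_le0 ltW.
  move=> t /andP[t0 tT] IH.
  have uv y : - r <= y <= t -> u y = v y.
    by move=> /andP[y1 y2]; have [y0|y0] := leP y 0; [rewrite uv0 ?y1|rewrite IH ?(ltW y0)].
  have tT' : 0 <= t <= tmax by rewrite t0 ltW.
  have [dlt [Lam [d0 Lam0 dP]]] := delay_locally_lipschitz us.1 vs.1 tT' uv.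
  have tr : - r <= t <= tmax by rewrite (ltW tT) andbT (le_trans _ t0)// oppr_le0 ltW.
  have [d1 d10 P1] := us.1 t tr 1 ltr01; have [d2 d20 P2] := vs.1 t tr 1 ltr01.
  have Lc : 0 < 2 * (Lam + c + 1) by rewrite mulr_gt0// ltr_wpDl// addr_ge0.
  pose h := Num.min (Num.min dlt (2 * (Lam + c + 1))^-1) (Num.min d1 d2).
  have h0 : 0 < h by rewrite !lt_min d0 invr_gt0 Lc d10.
  exists h => // s /andP[ts]; rewrite -ltrBlDl !lt_min !ltrBlDl.
  move=> /andP[/andP[s1 s2] /andP[s3 s4]] sT.
  have utv : u t = v t by apply: uv; rewrite lexx; case/andP: tr => ->.
  (* The initial bound 2 comes from continuity of u and v at t; each pass through Duhamel's formula
     halves it, as (Lam + c) (s - t) <= 1/2. *)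
  have small n : forall y, t <= y <= s -> `|u y - v y| <= 2 * 2^-1 ^+ n.
    elim: n => [|n IHn] y /andP[ty ys].
      rewrite expr0 mulr1 -(subrKA (u t)).
      have yT : - r <= y <= tmax by rewrite (le_trans _ ty)/= ?(le_trans ys)//; case/andP: tr.
      have h1 : `|t - y| < d1 by rewrite distrC ger0_norm ?subr_ge0// ltrBlDl (le_lt_trans ys).
      have h2 : `|t - y| < d2 by rewrite distrC ger0_norm ?subr_ge0// ltrBlDl (le_lt_trans ys).
      apply: (le2_of_lt1 (ler_normD _ _)); first by rewrite distrC; exact: P1.
      by rewrite utv; exact: P2.
    have yT := le_trans ys sT.
    have i1 := us.2 t y t0 ty yT; have i2 := vs.2 t y t0 ty yT.
    rewrite utv in i1.
    have -> : u y - v y = (u y - E (y - t) (v t)) - (v y - E (y - t) (v t)).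
      by rewrite opprB subrKA.
    have m0 : 0 <= 2 * 2^-1 ^+ n :> R by rewrite mulr_ge0// exprn_ge0// invr_ge0.
    apply: (@le_trans _ _ ((y - t) * ((Lam + c) * (2 * 2^-1 ^+ n)))).
      apply: (ri_near i1 i2 ty) => z /andP[tz zy].
      rewrite -(EB genE) ?subr_ge0//.
      apply: le_trans (E_contract genE eb lam0 _ _) _; first by rewrite subr_ge0.
      have -> : G u z - G v z =
        (delay (segment r u z) - delay (segment r v z)) - c *: (u z - v z).
        by rewrite /forcing scalerBr !opprD opprK addrACA.
      rewrite (le_trans (ler_normB _ _))// mulrDl lerD//.
        apply: dP => //; first exact: le_lt_trans (le_trans zy ys) s1.
          exact: le_trans zy yT.
        move=> x' /andP[tx' xz]; apply: IHn; rewrite tx'.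
        exact: le_trans xz (le_trans zy ys).
      by rewrite normrZ ger0_norm// ler_wpM2l// IHn// tz (le_trans zy).
    rewrite [leLHS]mulrA exprS [leRHS]mulrCA ler_wpM2r//.
    have : s - t < (2 * (Lam + c + 1))^-1 by rewrite ltrBlDl.
    rewrite -div1r ltr_pdivlMr// => st.
    have yt : y - t <= s - t by rewrite lerD2r.
    have yt0 : 0 <= y - t by rewrite subr_ge0.
    have Lc0 : 0 <= Lam + c by rewrite addr_ge0.
    exact: half_step Lc0 yt0 yt st.
  apply/eqP; rewrite -subr_eq0; apply/eqP; apply: normr_le_eps => eps eps0.
  have : (2 * 2^-1 ^+ n : R) @[n --> \oo] --> 0.
    by apply: (@cvg_geometric _ 2 2^-1); rewrite ger0_norm// invf_lt1// ltr1n.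
  move=> /cvgrPdist_lt/(_ _ eps0)[N _ /(_ N (leqnn _))] /=.
  rewrite sub0r normrN => /(le_lt_trans (ler_norm _)) /ltW; apply: le_trans.
  by apply: small; rewrite (ltW ts) lexx.
move=> t /andP[t0 tT] IH.
apply/eqP; rewrite -subr_eq0; apply/eqP; apply: normr_le_eps => eps eps0.
have tr : - r <= t <= tmax by rewrite tT andbT (le_trans _ (ltW t0))// oppr_le0 ltW.
have e2 : 0 < eps / 2 by rewrite divr_gt0.
have [d1 d10 P1] := us.1 t tr _ e2; have [d2 d20 P2] := vs.1 t tr _ e2.
pose dd := Num.min d1 d2.
have dd0 : 0 < dd by rewrite lt_min d10.
pose s := Num.max 0 (t - dd / 2).
have s0 : 0 <= s by rewrite le_max lexx.
have st : s < t by rewrite gt_max t0 gtrBl divr_gt0.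
have sr : - r <= s <= tmax.
  by rewrite (ltW (lt_le_trans st tT)) andbT (le_trans _ s0)// oppr_le0 ltW.
have : `|t - s| < dd.
  have : t - dd / 2 <= s by rewrite le_max lexx orbT.
  by rewrite gtr0_norm ?subr_gt0//; lra.
rewrite lt_min => /andP[h1 h2].
have := P1 s sr h1; have := P2 s sr h2.
rewrite -(subrKA (u s)) [in X in _ -> _ -> _ <= X](splitr eps) => h3 h4.
rewrite (le_trans (ler_normD _ _))// lerD ?(ltW h4)//.
by rewrite IH ?s0// distrC ltW.
Qed.

End uniqueness.

(** * Compactness *)

(** Ultrafilters replace the extraction of subsequences: a cluster point of an ultrafilter is its
    limit. *)
Lemma ultra_bounded_cvg (R : realType) (I : Type) (F : set_system I) (f : I -> R) M :
  UltraFilter F -> F [set i | `|f i| <= M] ->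
  exists a, forall eps, 0 < eps -> F [set i | `|f i - a| < eps].
Proof.
move=> FU FM; have FF : ProperFilter F := @ultra_proper _ F FU.
have FMM : F [set i | `[- M, M]%classic (f i)].
  by apply: filterS FM => i /= fM; rewrite in_itv/= -ler_norml.
have [|a [_ ac]] := @segment_compact R (- M) M (f i @[i --> F]) _; first exact: FMM.
exists a => eps eps0.
have [//|nF] := in_ultra_setVsetC [set i | `|f i - a| < eps] FU.
have fF : (f i @[i --> F]) [set f i | i in ~` [set i | `|f i - a| < eps]].
  have : F [set i | [set f i | i in ~` [set i | `|f i - a| < eps]] (f i)].
    by apply: filterS nF => i ni; exists i.
  exact.
have [_ [[i ni <-]]] := ac _ (ball a eps) fF (nbhsx_ballx a eps eps0).
by rewrite /ball/= distrC => h; exfalso; exact: ni.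
Qed.

Lemma complete_norm_limit (R : realType) (V : normedModType R) (F : set_system V) :
  (forall G : set_system V, ProperFilter G -> cauchy G -> cvg G) -> ProperFilter F ->
  (forall eps, 0 < eps -> exists v, F [set w | `|w - v| < eps]) ->
  exists v, forall eps, 0 < eps -> F [set w | `|w - v| < eps].
Proof.
move=> Vc FF h; have /cvg_ex[v Fv] : cvg F.
  apply: Vc; apply: cauchy_exP => eps /h[v Fv]; exists v.
  by apply: filterS Fv => w /=; rewrite -ball_normE/= distrC.
exists v => eps eps0; have /cvgrPdist_lt/(_ eps eps0) := Fv.
by apply: filterS => w /=; rewrite distrC.
Qed.

Lemma quarters_lt (R : realType) (V : normedModType R) (w x y z p : V) (eps : R) :
  `|w| < eps / 4 -> `|x| < eps / 4 -> `|y| < eps / 4 -> `|z| < eps / 4 ->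
  `|p| < eps / 4 -> `|w + (x + (y + (z + p)))| < 2 * eps.
Proof.
move=> *; have := ler_normD w (x + (y + (z + p))).
have := ler_normD x (y + (z + p)); have := ler_normD y (z + p).
have := ler_normD z p; have := normr_ge0 w; lra.
Qed.

Section compactness.
Context d (T : measurableType d) (R : realType).
Variable mu : {measure set T -> \bar R}.
Local Notation H := (L2 mu).
Variables (A : unbounded_op mu) (e : nat -> H) (lam : nat -> R).
Hypothesis eb : eigenbasis A e lam.
Hypothesis lam0 : forall k, 0 < lam k.
Hypothesis lamoo : forall M, exists N, forall n, (N <= n)%N -> M <= lam n.

(** On the modes from N on, each squared coefficient is at most 1/M times its share of the
    energy. *)
Lemma oproj_tail_le N M c v : 0 < M -> (forall n, (N <= n)%N -> M <= lam n) ->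
  (forall n, energy e lam n v <= c) -> `|v - oproj e N v| <= Num.sqrt (c / M).
Proof.
move=> M0 NM vc.
have c0 : 0 <= c by apply: le_trans (vc 0%N); rewrite /energy big_geq.
apply: (norm_le_coef eb) => [|n]; first exact: sqrtr_ge0.
have cM : 0 <= c / M by rewrite divr_ge0// ltW.
rewrite sqr_sqrtr// ler_pdivlMr//; apply: le_trans (vc n).
rewrite mulr_suml; apply: ler_sum => k _.
rewrite L2dotBl (dot_oproj (eb_orthonormal eb)) mulrC.
have [kN|Nk] := ltnP k N.
  by rewrite subrr expr0n/= mulr0 mulr_ge0 ?sqr_ge0// ltW.
by rewrite subr0 ler_wpM2r ?sqr_ge0// NM.
Qed.

(** Bounded energy gives compactness in L^2: each coefficient converges along the ultrafilter, the
    tails are uniformly small because lam -> oo, and so the image filter is Cauchy. *)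
Lemma energy_ultra_cvg (I : Type) (F : set_system I) (x : I -> H) rho c :
  UltraFilter F -> F [set i | `|x i| <= rho /\ forall n, energy e lam n (x i) <= c] ->
  exists v, forall eps, 0 < eps -> F [set i | `|x i - v| < eps].
Proof.
move=> FU Fx; have FF : ProperFilter F := @ultra_proper _ F FU.
have /choice[a aP] : forall k, exists a : R, forall eps, 0 < eps ->
    F [set i | `|L2dot (x i) (e k) - a| < eps].
  move=> k; apply: (ultra_bounded_cvg (M := rho)).
  apply: filterS Fx => i [xr _] /=; apply: le_trans (L2dot_le _ _) _.
  have -> : `|e k| = 1.
    apply/eqP; rewrite -(@eqrXn2 _ 2)// -L2dotE (eb_orthonormal eb).
    by rewrite eqxx expr1n.
  by rewrite mulr1.
pose G : set_system H := x i @[i --> F].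
have GF : ProperFilter G by exact: fmap_proper_filter.
suff [v vP] : exists v, forall eps, 0 < eps -> G [set w | `|w - v| < eps] by exists v.
apply: (@complete_norm_limit R H G (@L2_cauchy_cvg _ T R mu) GF).
move=> eps eps0.
pose c1 := `|c| + 1.
have c10 : 0 < c1 by rewrite ltr_wpDl.
have e4 : 0 < (eps / 4) ^+ 2 by rewrite exprn_gt0// divr_gt0.
(* With this threshold for lam, [oproj_tail_le] bounds the tail by sqrt (c1 / M) = eps / 4 at
   most. *)
have M0 : 0 < c1 / (eps / 4) ^+ 2 by rewrite divr_gt0.
have [N NP] := lamoo (c1 / (eps / 4) ^+ 2).
exists (\sum_(0 <= k < N) a k *: e k).
pose q := eps / 2 / (N.+1%:R).
have q0 : 0 < q by rewrite !divr_gt0.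
have Fk : F [set i | forall k : 'I_N, `|L2dot (x i) (e k) - a k| < q].
  by apply: filter_forall => k; exact: aP.
suff : F [set i | `|x i - \sum_(0 <= k < N) a k *: e k| < eps] by [].
apply: filterS2 Fx Fk => i [_ xc] xk /=.
rewrite -(subrKA (oproj e N (x i))) (le_lt_trans (ler_normD _ _))//.
rewrite (splitr eps) ltr_leD//.
  have xc1 n : energy e lam n (x i) <= c1.
    by apply: le_trans (xc n) _; apply: le_trans (ler_norm _) _; rewrite lerDl.
  apply: le_lt_trans (oproj_tail_le M0 NP xc1) _.
  rewrite invf_div mulrCA mulfV ?gt_eqF// mulr1 sqrtr_sqr ger0_norm ?divr_ge0 ?ltW//.
  by rewrite ltr_pM2l// ltf_pV2 ?posrE// ltr_nat.
rewrite /oproj -sumrB (le_trans (ler_norm_sum _ _ _))//.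
apply: (@le_trans _ _ (\sum_(0 <= k < N) q)).
  rewrite big_nat [leRHS]big_nat; apply: ler_sum => k /andP[_ kN].
  rewrite -scalerBl normrZ.
  have -> : `|e k| = 1.
    apply/eqP; rewrite -(@eqrXn2 _ 2)// -L2dotE (eb_orthonormal eb).
    by rewrite eqxx expr1n.
  by rewrite mulr1 ltW//; exact: (xk (Ordinal kN)).
have e20 : 0 <= eps / 2 by rewrite divr_ge0// ltW.
rewrite sumr_const_nat subn0 /q; move: (eps / 2) e20 => z z0.
rewrite -[leLHS]mulr_natr -mulrA ler_piMr//.
by rewrite mulrC ler_pdivrMr// mul1r ler_nat.
Qed.

Lemma ascoli_ultra (I : Type) (F : set_system I) (u : I -> R -> H) (a b rho c : R)
    (Q : set I) : UltraFilter F -> F Q ->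
  (forall i t, Q i -> a <= t <= b ->
     `|u i t| <= rho /\ forall n, energy e lam n (u i t) <= c) ->
  (forall eps, 0 < eps -> exists2 dlt : R, 0 < dlt & forall i s t, Q i ->
     a <= s <= b -> a <= t <= b -> `|s - t| < dlt -> `|u i s - u i t| < eps) ->
  exists v : R -> H, forall eps, 0 < eps ->
    F [set i | forall t, a <= t <= b -> `|u i t - v t| < eps].
Proof.
move=> FU FQ ub equi; have FF : ProperFilter F := @ultra_proper _ F FU.
have /choice[v vP] : forall t, exists v, a <= t <= b -> forall eps, 0 < eps ->
    F [set i | `|u i t - v| < eps].
  move=> t; have [tab|ntab] := boolP (a <= t <= b); last by exists 0.
  have [|v vP] := @energy_ultra_cvg I F (fun i => u i t) rho c FU.
    by apply: filterS FQ => i Qi; exact: ub.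
  by exists v.
exists v => eps2 eps20; have [eps -> eps0] : exists2 eps, eps2 = 2 * eps & 0 < eps.
  by exists (eps2 / 2); rewrite ?divr_gt0// mulrC divfK.
have e4 : 0 < eps / 4 by rewrite divr_gt0.
have [dlt d0 dP] := equi _ e4.
have := (compact_near_coveringP (`[a, b]%classic : set R)).1 (@segment_compact R a b).
move=> /(_ I F (fun i t => a <= t <= b -> `|u i t - v t| < 2 * eps) FF).
move=> nc.
suff Fh : F [set i | `[a, b]%classic `<=` (fun t => a <= t <= b -> `|u i t - v t| < 2 * eps)].
  by apply: filterS Fh => i h' t tab; apply: h' => //; rewrite /= in_itv.
apply: nc => t /=.
rewrite in_itv/= => tab.
exists (ball t dlt, [set i | Q i /\ `|u i t - v t| < eps / 4]).
  split; first exact: nbhsx_ballx.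
  by apply: filterI => //; exact: vP.
move=> [s i] /= [ts [Qi ut]] sab; rewrite /ball/= in ts.
(* The auxiliary index j depends on s and serves only to compare v t with v s, whose continuity is
   not yet known. The five differences add up to less than 5/4 eps, hence to less than [2 * eps]. *)
have [j [Qj [vj vsj]]] := filter_ex (filterI FQ (filterI (vP t tab _ e4) (vP s sab _ e4))).
have h1 := dP i s t Qi sab tab _; have h2 := dP j t s Qj tab sab ts.
rewrite distrC in h1; have {}h1 := h1 ts.
rewrite /= in vj vsj.
have -> : u i s - v s = (u i s - u i t) + ((u i t - v t) + ((v t - u j t) +
   ((u j t - u j s) + (u j s - v s)))) by rewrite !subrKA.
by apply: quarters_lt => //; rewrite distrC.
Qed.

End compactness.

(** * The omega-limit set of a map on a compact set *)

Section iterates.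
Variables (X : topologicalType) (f : X -> X) (BB : set X).
Hypothesis hX : hausdorff_space X.
Hypothesis cBB : compact BB.
Hypothesis fBB : forall x, BB x -> BB (f x).
Hypothesis fcts : {within BB, continuous f}.

Definition omega_set : set X := \bigcap_n (iter n f @` BB).

Lemma image_iter_sub n m : (n <= m)%N -> iter m f @` BB `<=` iter n f @` BB.
Proof.
move=> nm _ [x Bx <-]; exists (iter (m - n) f x).
  by elim: (m - n)%N => //= k IH; exact: fBB.
by rewrite -iterD subnKC.
Qed.

Lemma image_iter_compact n : compact (iter n f @` BB).
Proof.
elim: n => [|n IH]; first by rewrite image_id.
have -> : iter n.+1 f @` BB = f @` (iter n f @` BB).
  by rewrite image_comp.
apply: continuous_compact => //; apply: continuous_subspaceW fcts => y.
by move=> /(image_iter_sub (leq0n n)); rewrite image_id.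
Qed.

Lemma omega_set_compact : compact omega_set.
Proof.
apply: (@subclosed_compact _ _ (iter 0 f @` BB)).
- by apply: closed_bigI => n _; apply: compact_closed => //; exact: image_iter_compact.
- exact: image_iter_compact.
- by move=> x; apply.
Qed.

(** Each image is compact, hence closed, and contains a tail of y. Invariance and attraction both
    follow by applying this to points chosen one in each image. *)
Lemma omega_set_cluster (y : nat -> X) : (forall n, (iter n f @` BB) (y n)) ->
  exists2 p, omega_set p & cluster (y n @[n --> \oo]) p.
Proof.
move=> yn.
have [|p [_ pc]] := @image_iter_compact 0 (y n @[n --> \oo]) _.
  exists 0%N => // n _; exact: image_iter_sub (yn n).
exists p => // n _; apply: (compact_closed hX (image_iter_compact (n := n))).
move=> W Wp; have [|_ [[m nm <-] Wm]] := pc [set y m | m in [set m | (n <= m)%N]] W _ Wp.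
  by exists n => // m nm; exists m.
by exists (y m); split => //; exact: image_iter_sub nm _ (yn m).
Qed.

Lemma omega_set_sub : omega_set `<=` BB.
Proof. by move=> x /(_ 0%N Logic.I)[y By <-]. Qed.

(** For x in the omega-limit set, choose y_n in the n-th image with f y_n = x. A cluster point p of
    these lies in the set, and continuity of f on BB forces f p = x. *)
Lemma omega_set_invariant : f @` omega_set = omega_set.
Proof.
apply/seteqP; split=> [_ [x Kx <-] n _|x Kx].
  case: n => [|n]; first by exists (f x) => //; apply: fBB; exact: omega_set_sub.
  by have [z Bz zx] := Kx n Logic.I; exists z => //=; rewrite zx.
have /choice[y yP] : forall n, exists y, (iter n f @` BB) y /\ f y = x.
  move=> n; have [z Bz zx] := Kx n.+1 Logic.I.
  by exists (iter n f z); split => //; exists z.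
have [p Kp pc] := omega_set_cluster (fun n => (yP n).1).
exists p => //; apply: contrapT => fpx.
have Bp := omega_set_sub Kp.
have nfp : nbhs (f p) (~` [set x]).
  apply: open_nbhs_nbhs; split => //; apply: closed_openC.
  exact: (accessible_closed_set1 (hausdorff_accessible hX)).
have /subspace_continuousP/(_ p Bp) fp := fcts.
have := fp _ nfp; rewrite /fmap/= /nbhs/= /within/= => np.
have [|_ [[m _ <-] h]] := pc (range y) _ _ np; first by exists 0%N => // n _; exists n.
apply: h; last by have [] := yP m.
have [[z Bz <-] _] := yP m.
by elim: {+}m => //= k IH; exact: fBB.
Qed.

End iterates.

(** * Compact sets of Hoelder histories with bounded energy *)

Section holder_ball.
Context d (T : measurableType d) (R : realType).
Variable mu : {measure set T -> \bar R}.
Local Notation H := (L2 mu).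
Variables (A : unbounded_op mu) (e : nat -> H) (lam : nat -> R).
Hypothesis eb : eigenbasis A e lam.
Hypothesis lam0 : forall k, 0 < lam k.
Hypothesis lamoo : forall M, exists N, forall n, (N <= n)%N -> M <= lam n.
Variable r : R.
Hypothesis r0 : 0 < r.
Local Notation C := (Cspace r H).

(** The modulus of continuity is the one that [sol_holder] provides: a square root from the
    semigroup and a linear part from the forcing. *)
Definition holder_ball (rho c g : R) : set C := [set phi |
  [/\ forall th, `|phi th| <= rho, forall th n, energy e lam n (phi th) <= c &
      forall th th', `|phi th - phi th'| <=
        Num.sqrt (`|val th - val th'| * c) + `|val th - val th'| * g]].

Lemma holder_modulus (c g eps : R) : 0 <= c -> 0 <= g -> 0 < eps ->
  exists2 dlt : R, 0 < dlt & forall h, 0 <= h < dlt -> Num.sqrt (h * c) + h * g < eps.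
Proof.
move=> c0 g0 eps0; have e2 : 0 < eps / 2 by rewrite divr_gt0.
have e22 : 0 < (eps / 2) ^+ 2 by rewrite exprn_gt0.
have c1 : 0 < c + 1 by rewrite ltr_wpDl.
have g1 : 0 < g + 1 by rewrite ltr_wpDl.
exists (Num.min ((eps / 2) ^+ 2 / (c + 1)) (eps / 2 / (g + 1))).
  by rewrite lt_min !divr_gt0.
move=> h /andP[h0]; rewrite lt_min !ltr_pdivlMr// => /andP[h1 h2].
rewrite (splitr eps) ltrD//.
  rewrite -[ltRHS]ger0_norm ?(ltW e2)// -sqrtr_sqr ltr_sqrt//.
  by apply: le_lt_trans h1; rewrite ler_wpM2l// lerDl.
by rewrite ltr_pdivlMr//; apply: le_lt_trans h2; rewrite ler_pM2r// ler_wpM2l// lerDl.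
Qed.

Lemma holder_ball_compact rho c g : 0 <= c -> 0 <= g -> compact (holder_ball rho c g).
Proof.
move=> c0 g0; rewrite compact_ultra => F FU FB.
have FF : ProperFilter F := @ultra_proper _ F FU.
have [||v vP] := @ascoli_ultra _ _ _ _ _ _ _ eb lam0 lamoo C F (fun phi => Ceval phi)
   (- r) 0 rho c (holder_ball rho c g) FU FB.
- by move=> phi t [h1 h2 _] /itv_val[th <-]; rewrite Ceval_val; split.
- move=> eps eps0; have [dlt d0 dP] := holder_modulus c0 g0 eps0.
  exists dlt => // phi s t [_ _ h3] /itv_val[th <-] /itv_val[th' <-] st.
  by rewrite !Ceval_val (le_lt_trans (h3 _ _))// dP// normr_ge0.
have near_phi eps : 0 < eps -> exists2 phi, holder_ball rho c g phi &
    forall th, `|phi th - v (val th)| < eps.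
  move=> /vP Fe; have [phi [Bphi phiv]] := filter_ex (filterI FB Fe).
  exists phi => // th; rewrite -(Ceval_val phi th).
  by apply: phiv; exact: val_itv.
have vc : cts_on v (- r) 0.
  apply: cts_on_uniform_limit => eps /near_phi[phi _ phiv].
  exists (Ceval phi); first exact: cts_on_Ceval.
  by move=> x /itv_val[th <-]; rewrite Ceval_val distrC.
have [psi psiE] : exists psi : C, forall th, psi th = v (val th).
  apply: Cmk => th eps eps0; have [dlt d0 dP] := vc (val th) (val_itv th) eps eps0.
  by exists dlt => // th'; apply: dP; exact: val_itv.
exists psi; split.
  split=> [th|th n|th th'].
  - apply/ler_addgt0Pr => eps /near_phi[phi [h1 _ _] phiv].
    rewrite -(subrK (phi th) (psi th)) addrC (le_trans (ler_normD _ _))// lerD//.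
    by rewrite psiE distrC ltW.
  - apply: (energy_closed (lam := lam)) => eps /near_phi[phi [_ h2 _] phiv].
    by exists (phi th) => //; rewrite psiE distrC.
  - apply/ler_addgt0Pr => eps eps0.
    have [phi [_ _ h3] phiv] := near_phi _ (divr_gt0 eps0 (ltr0n _ 2)).
    have h1 := phiv th; have h2 := phiv th'.
    have -> : psi th - psi th' = (phi th - phi th') - ((phi th - psi th) - (phi th' - psi th')).
      by rewrite opprB opprB addrA subrKA addrC subrKA.
    rewrite (le_trans (ler_normB _ _))// lerD// (le_trans (ler_normB _ _))//.
    by rewrite (splitr eps) lerD// ltW// psiE.
move=> W /Cnbhs[eps eps0 eW]; apply: filterS (vP _ eps0) => phi phiv; apply: eW => th.
by rewrite psiE distrC -(Ceval_val phi th); apply: phiv; exact: val_itv.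
Qed.

Lemma C_hausdorff : hausdorff_space C.
Proof.
move=> p q pq; apply: C_ext => th; apply/eqP; rewrite -subr_eq0; apply/eqP.
apply: normr_le_eps => eps eps0; have e2 : 0 < eps / 2 by rewrite divr_gt0.
have [z [/Cball zp /Cball zq]] := pq _ _ (nbhsx_ballx p _ e2) (nbhsx_ballx q _ e2).
rewrite -(subrKA (z th)) (le_trans (ler_normD _ _))// (splitr eps) lerD ?ltW//.
by rewrite distrC.
Qed.

End holder_ball.

(** * The attractor *)

Lemma expR_decay (R : realType) (l M : R) : 0 < l ->
  exists2 t0 : R, 1 <= t0 & forall t, t0 <= t -> expR (- l * t) * M <= 1.
Proof.
move=> l0; exists (Num.max 1 (`|M| / l)); first by rewrite le_max lexx.
move=> t; rewrite ge_max => /andP[_]; rewrite ler_pdivrMr// mulrC => Mt.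
apply: (@le_trans _ _ (expR (- l * t) * expR (l * t))); last first.
  by rewrite -expRD mulNr addNr expR0.
rewrite ler_wpM2l ?expR_ge0// (le_trans (ler_norm M))// (le_trans Mt)//.
by apply: le_trans (expR_ge1Dx _); rewrite lerDr.
Qed.

Lemma min0_dist (R : realType) (s t : R) : `|Num.min s 0 - Num.min t 0| <= `|s - t|.
Proof.
rewrite ler_norml; apply/andP; split; rewrite !minElt; case: (ltP s 0) => ?; case: (ltP t 0) => ?;
  case: (ger0P (s - t)) => ?; lra.
Qed.

Lemma max0_dist (R : realType) (s t : R) : `|Num.max s 0 - Num.max t 0| <= `|s - t|.
Proof.
rewrite ler_norml; apply/andP; split; rewrite !maxElt; case: (ltP s 0) => ?; case: (ltP t 0) => ?;
  case: (ger0P (s - t)) => ?; lra.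
Qed.

(** An increment is split at 0, where the history ends and Duhamel's formula begins. By [min0_dist]
    and [max0_dist] neither part covers more than |s - t|. *)
Lemma min_max0E (R : realType) (V : zmodType) (f : R -> V) s t :
  f s - f t = (f (Num.min s 0) - f (Num.min t 0)) + (f (Num.max s 0) - f (Num.max t 0)).
Proof.
have mm x : f (Num.min x 0) + f (Num.max x 0) = f x + f 0.
  by rewrite minElt maxElt; case: (ltP x 0) => // _; rewrite addrC.
by rewrite addrACA mm -opprD mm opprD addrACA subrr addr0.
Qed.

Section dynamics.
Context d (T : measurableType d) (R : realType).
Variable mu : {measure set T -> \bar R}.
Local Notation H := (L2 mu).
Variables (A : unbounded_op mu) (E : R -> H -> H).
Hypothesis genE : generated_by_opp A E.
Variables (e : nat -> H) (lam : nat -> R).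
Hypothesis eb : eigenbasis A e lam.
Hypothesis lam0 : forall k, 0 < lam k.
Hypothesis lamoo : forall M, exists N, forall n, (N <= n)%N -> M <= lam n.
Variable l0 : R.
Hypothesis l00 : 0 < l0.
Hypothesis l0P : forall k, l0 <= lam k.
Variables (r c : R) (r0 : 0 < r) (c0 : 0 <= c).
Local Notation I := (set_type `[- r, 0]%classic).
Local Notation C := (Cspace r H).
Variables (B : H -> H) (LB MB : R).
Hypothesis LB0 : 0 <= LB.
Hypothesis BL : forall v w, `|B v - B w| <= LB * `|v - w|.
Hypothesis Bb : forall v, `|B v| <= MB.
Variables (eta : C -> R).
Hypothesis eta_cts : continuous eta.
Hypothesis eta_r : forall phi, 0 <= eta phi <= r.
Local Notation sol := (sol E c B eta).
Hypothesis sol_uniq : forall (u v : R -> H) tmax, sol u tmax -> sol v tmax ->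
  (forall x, - r <= x <= 0 -> u x = v x) -> forall x, - r <= x <= tmax -> u x = v x.
Variables (S : R -> C -> C) (U : C -> R -> H).
Hypothesis U_sol : forall phi tmax, sol (U phi) tmax.
Hypothesis U_hist : forall phi (th : I), U phi (val th) = phi th.
Hypothesis SE : forall t phi, 0 <= t -> S t phi = segment r (U phi) t.
Implicit Types (phi psi : C) (th : I).

Lemma val_zero : exists th : I, val th = 0.
Proof. by apply: itv_val; rewrite lexx oppr_le0 (ltW r0). Qed.

Lemma S_val t phi th : 0 <= t -> S t phi th = U phi (t + val th).
Proof.
by move=> t0; rewrite SE// (segmentP th (U_sol phi t).1)// t0 lexx.
Qed.

Lemma S_add s t phi : 0 <= s -> 0 <= t -> S t (S s phi) = S (t + s) phi.
Proof.
move=> s0 t0; apply: C_ext => th; rewrite !S_val ?addr_ge0//.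
have sts : s <= t + s by rewrite lerDr.
have := sol_shift (U_sol phi (t + s)) s0 sts; rewrite addrK => vs.
have /andP[th1 th2] := val_itv th.
rewrite (sol_uniq (U_sol _ t) vs).
- by rewrite addrAC.
- move=> x /itv_val[th' <-]; rewrite U_hist S_val//; congr (U _ _); exact: addrC.
- by rewrite -(lerD2l t) in th2; rewrite addr0 in th2; rewrite th2 andbT (le_trans th1)// lerDr.
Qed.

Local Notation K0 := (MB / l0).
Lemma K0_ge0 : 0 <= K0.
Proof. by rewrite divr_ge0 ?(MB0 Bb)// ltW. Qed.

Lemma U_decay phi M t : (forall th, `|phi th| <= M) -> 0 <= t ->
  `|U phi t| <= expR (- l0 * t) * M + K0.
Proof.
move=> phiM t0.
have := sol_bound genE eb lam0 l00 l0P r0 c0 LB0 BL Bb eta_cts eta_r (U_sol phi t)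
  (lexx 0) t0 (lexx t).
rewrite subr0 => h; apply: le_trans h _; rewrite lerD2r ler_wpM2l ?expR_ge0//.
have [th <-] := val_zero.
by rewrite U_hist.
Qed.

Lemma U_bounded phi M t : (forall th, `|phi th| <= M) -> - r <= t ->
  `|U phi t| <= M + K0.
Proof.
move=> phiM rt; have [t0|t0] := leP 0 t.
  apply: le_trans (U_decay phiM t0) _; rewrite lerD2r ler_piMl//.
    have [th _] := val_zero.
    exact: le_trans (normr_ge0 _) (phiM th).
  by rewrite expR_le1 mulNr oppr_le0 mulr_ge0// ltW.
have [|th <-] := @itv_val _ r t; first by rewrite rt ltW.
by rewrite U_hist (le_trans (phiM th))// lerDl K0_ge0.
Qed.

(* [rho] is the radius of an absorbing ball; [rho1], [g] and [c1] bound solutions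
   starting in it, their forcing, and their energy at times at least 1. *)
Local Notation rho := (K0 + 1).
Local Notation rho1 := (rho + K0).
Local Notation g := (MB + c * rho1).
Local Notation c1 := (2 * (rho1 ^+ 2 + g ^+ 2)).

Lemma rho1_ge0 : 0 <= rho1.
Proof. by rewrite !addr_ge0 ?K0_ge0. Qed.

Lemma g_ge0 : 0 <= g.
Proof. by rewrite addr_ge0 ?(MB0 Bb)// mulr_ge0// rho1_ge0. Qed.

Lemma c1_ge0 : 0 <= c1.
Proof. by rewrite mulr_ge0// addr_ge0// sqr_ge0. Qed.

(** Duhamel's formula over the last unit of time: smoothing of u (t - 1) contributes rho1^2, the
    integral g^2, and [energyD] the factor 2. This is the origin of [c1]. *)
Lemma U_energy phi t n : (forall th, `|phi th| <= rho) -> 1 <= t ->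
  energy e lam n (U phi t) <= c1.
Proof.
move=> phir t1; have t10 : 0 <= t - 1 by rewrite subr_ge0.
have rs s : 0 <= s -> - r <= s by apply: le_trans; rewrite oppr_le0 ltW.
have tt : t - (t - 1) = 1 by rewrite opprB addrCA subrr addr0.
have t1t : t - 1 <= t by rewrite gerBl.
have := @sol_energy _ _ _ _ _ _ genE _ _ eb lam0 _ _ c0 _ _ Bb _ _ t (t - 1) t rho1
  (rho1 ^+ 2) n (U_sol phi t) t10 t1t (lexx t); rewrite tt mul1r; apply.
  by move=> s /andP[s1 _]; apply: U_bounded => //; apply: rs; exact: le_trans s1.
apply: le_trans (energy_smoothing genE eb lam0 _ _ ltr01) _; rewrite divr1.
by rewrite lerXn2r// ?nnegrE ?rho1_ge0// U_bounded// rs.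
Qed.

Lemma sol_holder_sym phi a c2 s t : (forall th, `|phi th| <= rho) -> 0 <= a ->
  a <= s -> a <= t ->
  (forall x n, a <= x -> x <= Num.max s t -> energy e lam n (U phi x) <= c2) ->
  `|U phi s - U phi t| <= Num.sqrt (`|s - t| * c2) + `|s - t| * g.
Proof.
move=> phir a0; wlog st : s t / s <= t => [hw|] as_ at_ ec.
  have [/hw|/ltW/hw] := leP s t; first exact.
  by rewrite distrC (distrC t s); apply => // x n; rewrite maxC; exact: ec.
have h0 : 0 <= t - s by rewrite subr_ge0.
rewrite distrC (distrC s t) (ger0_norm h0) -[in leLHS](subrKC s t).
have s0 := le_trans a0 as_.
apply: (sol_holder genE eb lam0 c0 Bb (U_sol phi (s + (t - s)))) => //.
  move=> x /andP[sx _]; apply: U_bounded => //; rewrite (le_trans _ (le_trans s0 sx))//.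
  by rewrite oppr_le0 ltW.
by move=> n; apply: ec => //; rewrite le_max lexx.
Qed.

Local Notation BB := (holder_ball e lam rho c1 g : set C).

Lemma S_absorb : exists2 t0 : R, 1 <= t0 & forall t phi,
  (forall th, `|phi th| <= rho) -> t0 <= t -> BB (S t phi).
Proof.
(* The length r is added so that the whole history window lies after t1; t1 >= 1 makes [U_energy]
   applicable on it. *)
have [t1 t11 t1P] := expR_decay rho l00; exists (t1 + r).
  by rewrite (le_trans t11)// lerDl ltW.
move=> t phi phir tt.
have t0 : 0 <= t.
  by rewrite (le_trans _ tt)// addr_ge0 ?(ltW r0)// (le_trans ler01).
have tth th : t1 <= t + val th.
  have /andP[+ _] := val_itv th; rewrite lerNl => thr.
  by rewrite -lerBlDr (le_trans _ tt)// lerD2l.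
have t1th th : 1 <= t + val th := le_trans t11 (tth th).
split=> [th|th n|th th']; rewrite !S_val//.
- rewrite (le_trans (U_decay phir _)) ?(le_trans ler01)//.
  by rewrite addrC lerD2l t1P.
- exact: U_energy.
- have -> : val th - val th' = (t + val th) - (t + val th') by rewrite opprD addrACA subrr add0r.
  apply: (@sol_holder_sym _ 1) => // x n x1 _; exact: U_energy.
Qed.

Lemma S_bounded_enter M : exists2 t0 : R, 0 <= t0 & forall t phi,
  (forall th, `|phi th| <= M) -> t0 <= t -> forall th, `|S t phi th| <= rho.
Proof.
have [t1 t11 t1P] := expR_decay M l00.
have t10 : 0 <= t1 := le_trans ler01 t11.
exists (t1 + r); first by rewrite addr_ge0 ?(ltW r0).
move=> t phi phiM tt th.
have t0 : 0 <= t by rewrite (le_trans _ tt)// addr_ge0 ?(ltW r0).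
have tth : t1 <= t + val th.
  have /andP[+ _] := val_itv th; rewrite lerNl => thr.
  by rewrite -lerBlDr (le_trans _ tt)// lerD2l.
rewrite S_val// (le_trans (U_decay phiM _)) ?(le_trans t10)//.
by rewrite addrC lerD2l t1P.
Qed.

(** Histories in BB already have bounded energy, which the semigroup does not increase. So the bound
    holds on all of [-r, tm], without waiting for the smoothing; equicontinuity up to the initial
    time relies on this. *)
Lemma U_energy_BB phi x tm n : BB phi -> - r <= x -> x <= tm -> 0 <= tm ->
  energy e lam n (U phi x) <= 2 * (c1 + tm * g ^+ 2).
Proof.
move=> [phir phie _] x1 xtm tm0.
have [x0|x0] := leP 0 x; last first.
  have [|th <-] := @itv_val _ r x; first by rewrite x1 ltW.
  rewrite U_hist (le_trans (phie th n))// -[leLHS]mul1r ler_pM ?c1_ge0 ?ler1n//.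
  by rewrite lerDl mulr_ge0// sqr_ge0.
apply: (@le_trans _ _ (2 * (c1 + x * g ^+ 2))); last first.
  by rewrite ler_pM2l// lerD2l ler_wpM2r// sqr_ge0.
have := @sol_energy _ _ _ _ _ _ genE _ _ eb lam0 _ _ c0 _ _ Bb _ _ x 0 x rho1 c1 n
  (U_sol phi x) (lexx 0) x0 (lexx x); rewrite subr0; apply.
  move=> y /andP[y0 _]; apply: U_bounded => //; apply: le_trans y0.
  by rewrite oppr_le0 ltW.
apply: le_trans (energy_E genE eb lam0 _ _ x0) _.
by have [th <-] := val_zero; rewrite U_hist.
Qed.

Lemma U_equicontinuous tm eps : 0 <= tm -> 0 < eps -> exists2 dlt : R, 0 < dlt &
  forall phi s t, BB phi -> - r <= s <= tm -> - r <= t <= tm -> `|s - t| < dlt ->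
    `|U phi s - U phi t| < eps.
Proof.
move=> tm0 eps0; have e2 : 0 < eps / 2 by rewrite divr_gt0.
pose c2 := 2 * (c1 + tm * g ^+ 2).
have c20 : 0 <= c2 by rewrite mulr_ge0// addr_ge0 ?c1_ge0// mulr_ge0// sqr_ge0.
have c12 : c1 <= c2.
  by rewrite -[leLHS]mul1r ler_pM ?c1_ge0 ?ler1n// lerDl mulr_ge0// sqr_ge0.
have [dlt d0 dP] := holder_modulus c20 g_ge0 e2; exists dlt => // phi s t.
move=> Bphi /andP[s1 s2] /andP[t1 t2] st.
rewrite (@min_max0E R) (splitr eps) (le_lt_trans (ler_normD _ _))// ltrD//.
  have [_ _ phih] := Bphi; have mst := min0_dist s t.
  have [|th thE] := @itv_val _ r (Num.min s 0).
    by rewrite le_min s1 oppr_le0 (ltW r0) ge_min lexx orbT.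
  have [|th' thE'] := @itv_val _ r (Num.min t 0).
    by rewrite le_min t1 oppr_le0 (ltW r0) ge_min lexx orbT.
  rewrite -thE -thE' in mst *; rewrite !U_hist (le_lt_trans (phih _ _))//.
  apply: le_lt_trans (dP `|val th - val th'| _); last first.
    by rewrite normr_ge0 (le_lt_trans mst st).
  by rewrite lerD2r ler_wsqrtr// ler_wpM2l.
have mst := max0_dist s t.
apply: le_lt_trans (dP `|Num.max s 0 - Num.max t 0| _); last first.
  by rewrite normr_ge0 (le_lt_trans mst st).
apply: (@sol_holder_sym _ 0) => //; first (by case: Bphi); rewrite ?le_max ?lexx ?orbT// => x n x0.
move=> xm.
have xtm : x <= tm by apply: le_trans xm _; rewrite !ge_max s2 t2 tm0.
apply: U_energy_BB => //; apply: le_trans x0; by rewrite oppr_le0 ltW.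
Qed.

(* Along solutions with histories in BB tending to phi, every ultrafilter limit is a
   solution with history phi, hence the one of phi. *)
Lemma S_cts t phi eps : 0 <= t -> BB phi -> 0 < eps -> exists2 dlt : R, 0 < dlt &
  forall psi, BB psi -> (forall th, `|phi th - psi th| < dlt) ->
    forall th, `|S t phi th - S t psi th| < eps.
Proof.
move=> t0 Bphi eps0; apply: contrapT => nex.
have /choice[psi psiP] : forall n : nat, exists psi, [/\ BB psi,
    forall th, `|phi th - psi th| < n.+1%:R^-1 &
    ~ forall th, `|S t phi th - S t psi th| < eps].
  move=> n; apply: contrapT => npsi; apply: nex; exists n.+1%:R^-1 => //.
  move=> psi Bpsi close; apply: contrapT => far.
  by apply: npsi; exists psi.
have [F [FU Foo]] := ultraFilterLemma (@eventually_filter).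
have FF : ProperFilter F := @ultra_proper _ F FU.
have rt : - r <= t by rewrite (le_trans _ t0)// oppr_le0 ltW.
have [|||v vP] := @ascoli_ultra _ _ _ _ _ _ _ eb lam0 lamoo nat F (fun n => U (psi n))
    (- r) t rho1 (2 * (c1 + t * g ^+ 2)) setT FU.
- exact: filterT.
- move=> n x _ /andP[x1 x2]; split; first by have [[h _ _] _ _] := psiP n; exact: U_bounded.
  by move=> k; have [h _ _] := psiP n; exact: U_energy_BB.
- move=> eps' eps'0; have [dlt d0 dP] := U_equicontinuous t0 eps'0.
  exists dlt => // n x y _ xt yt xy; have [h _ _] := psiP n; exact: dP.
have vs : sol v t.
  apply: (sol_limit genE eb lam0 r0 c0 LB0 BL eta_cts eta_r) => eps' /vP /filter_ex[n nP].
  by exists (U (psi n)) => // x xt; rewrite distrC nP.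
have vphi x : - r <= x <= 0 -> v x = U phi x.
  move=> /itv_val[th <-]; rewrite U_hist; apply/eqP; rewrite -subr_eq0; apply/eqP.
  apply: normr_le_eps => eps' eps'0; have e2 : 0 < eps' / 2 by rewrite divr_gt0.
  have Fn : F [set n | n.+1%:R^-1 < eps' / 2].
    by apply: Foo; apply: (near_infty_natSinv_lt (PosNum e2)).
  have [n [/= nP nlt]] := filter_ex (filterI (vP _ e2) Fn).
  have [_ h _] := psiP n.
  rewrite -(subrKA (psi n th)) (le_trans (ler_normD _ _))// (splitr eps') lerD//.
    rewrite distrC -U_hist ltW// nP//.
    by have /andP[-> th2] := val_itv th; rewrite (le_trans th2).
  by rewrite distrC ltW// (lt_trans (h th)).
have vU := sol_uniq vs (U_sol phi t) vphi.
have [n nP] := filter_ex (vP _ eps0); have [_ _ h] := psiP n; apply: h => th.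
have tth : - r <= t + val th <= t.
  have /andP[th1 th2] := val_itv th.
  by rewrite (le_trans th1) ?lerDr//= gerDl.
by rewrite !S_val// -vU// distrC nP.
Qed.

(** [K] is the omega-limit set of [S T0] on BB. Compactness and invariance under [S T0] come from
    the section on iterates; the remaining work is invariance under every [S t] and attraction. *)
Lemma attractor : exists K : set C, K `<=` BB /\ compact_global_attractor S K.
Proof.
have [T0 T01 T0P] := S_absorb.
have T00 : 0 <= T0 := le_trans ler01 T01.
have BBr phi : BB phi -> forall th, `|phi th| <= rho by case.
have BBc : compact BB by apply: (holder_ball_compact eb lam0 lamoo c1_ge0 g_ge0).
have BBS phi : BB phi -> BB (S T0 phi) by move=> /BBr h; exact: (T0P T0 phi h (lexx T0)).
have Scts : {within BB, continuous (S T0)}.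
  apply/subspace_continuousP => phi Bphi W /Cnbhs[eps eps0 WP].
  have [dlt d0 dP] := S_cts T00 Bphi eps0.
  suff : nbhs phi [set psi | BB psi -> W (S T0 psi)] by [].
  by apply/Cnbhs; exists dlt => // psi close Bpsi; apply: WP; exact: dP.
pose K := omega_set (S T0) BB; exists K.
have KBB : K `<=` BB := @omega_set_sub _ _ _.
split => //.
have C_h := @C_hausdorff _ _ _ mu r.
have iterE n phi : iter n (S T0) phi = S (n%:R * T0) phi.
  elim: n => [|n IH].
    by rewrite mul0r SE// (segment_Ceval (U_hist phi)).
  by rewrite /= IH S_add// ?mulr_ge0// -natr1 mulrDl mul1r addrC.
have nT0 n : 0 <= n%:R * T0 by rewrite mulr_ge0.
have KS : S T0 @` K = K by exact: omega_set_invariant.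
have KSn n : S (n%:R * T0) @` K = K.
  have -> : S (n%:R * T0) = iter n (S T0) by apply/funext => phi; rewrite iterE.
  elim: n => [|n IH]; first exact: image_id.
  have -> : iter n.+1 (S T0) = S T0 \o iter n (S T0) by [].
  by rewrite -image_comp IH.
(* For t >= T0 the map [S t] sends BB into BB and commutes with the iterates, hence preserves each
   image of BB under inclusion. Smaller t are reached by writing a point of K as [S T0 y] with y in
   K. *)
have Klate t : T0 <= t -> S t @` K `<=` K.
  move=> tT _ [x Kx <-] n _; have t0 := le_trans T00 tT.
  have [y By <-] := Kx n Logic.I; exists (S t y); first by apply: T0P => //; exact: BBr.
  by rewrite !iterE !S_add// addrC.
have Ksub t : 0 <= t -> S t @` K `<=` K.
  move=> t0 _ [x Kx <-]; have : K x by []; rewrite -[in X in X -> _]KS => -[y Ky <-].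
  rewrite S_add//; apply: (Klate (t + T0)); first by rewrite lerDr.
  by exists y.
(* Since T0 >= 1, some n T0 exceeds t. A point of K is S_{n T0} y with y in K, hence the image under
   [S t] of S_{n T0 - t} y. *)
have Kinv t : 0 <= t -> S t @` K = K.
  move=> t0; apply/seteqP; split; first exact: Ksub.
  move=> x Kx; pose n := (Num.truncn t).+1.
  have tn : t <= n%:R * T0.
    rewrite (le_trans (ltW (truncnS_gt t)))//.
    by rewrite -[leLHS]mulr1 ler_wpM2l.
  have : K x by []; rewrite -[in X in X -> _](KSn n) => -[y Ky <-].
  exists (S (n%:R * T0 - t) y); first by apply: (Ksub (n%:R * T0 - t)); [rewrite subr_ge0|exists y].
  by rewrite S_add ?subr_ge0// subrKC.
split => //; first exact: omega_set_compact.
move=> D [M DM] eps eps0.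
(* Otherwise every image contains a point farther than eps from K, and these points cluster at a
   point of K. *)
have [N NP] : exists N, forall y, (iter N (S T0) @` BB) y ->
    exists2 k, K k & forall th, `|y th - k th| <= eps.
  apply: contrapT => nN.
  have /choice[y yP] : forall n, exists y, (iter n (S T0) @` BB) y /\
      ~ exists2 k, K k & forall th, `|y th - k th| <= eps.
    move=> n; apply: contrapT => ny; apply: nN; exists n => y yn.
    by apply: contrapT => nk; apply: ny; exists y.
  have [p Kp pc] := omega_set_cluster C_h BBc BBS Scts (fun n => (yP n).1).
  have yr : (y n @[n --> \oo]) (range y) by exists 0%N => // n _; exists n.
  have np : nbhs p [set z | forall th, `|p th - z th| < eps] by apply/Cnbhs; exists eps.
  have [_ [[n _ <-] h]] := pc _ _ yr np.
  apply: (yP n).2; exists p => // th; rewrite distrC ltW//; exact: h.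
have [s0 s00 s0P] := S_bounded_enter M.
exists (s0 + T0 + N%:R * T0); split; first exact: num_real.
move=> t tt; apply: ge_ereal_sup => _ [phi Dphi <-].
(* The time t is spent in three stages: s0 to enter the ball of radius rho, s >= T0 to enter BB, and
   N iterates of [S T0] to come within eps of K. *)
pose s := t - N%:R * T0 - s0.
have sT : T0 <= s by rewrite !lerBrDr (addrC T0) ltW.
have s'0 := le_trans T00 sT.
have StE : S t phi = iter N (S T0) (S s (S s0 phi)).
  by rewrite iterE (S_add _ s00 s'0) (S_add _ (addr_ge0 s'0 s00) (nT0 N)) /s subrK subrKC.
have [|k Kk kP] := NP (S t phi).
  exists (S s (S s0 phi)); last by rewrite StE.
  apply: T0P => //; apply: s0P => // th.
  exact: le_trans (normC_ub r0 phi th) (DM _ Dphi).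
apply: (@ge_ereal_inf _ _ (eps%:E)); exists (distC (S t phi) k)%:E; first by exists k.
by rewrite lee_fin; exact: distC_le.
Qed.

End dynamics.

(** * Compactness in C([-r,0]; D(A^delta)) *)

(** For x <= M the first term dominates by monotonicity; for x > M write x^{2 delta} = x^{2 delta -
    1} x, where the exponent 2 delta - 1 is negative. *)
Lemma powR_interpolation (R : realType) (delta M x : R) : 0 <= delta < 2^-1 -> 0 < M -> 0 < x ->
  (x `^ delta) ^+ 2 <= (M `^ delta) ^+ 2 + M `^ (2 * delta - 1) * x.
Proof.
move=> /andP[d0 d1] M0 x0.
have pE y : (y `^ delta) ^+ 2 = y `^ (2 * delta).
  by rewrite -powR_mulrn ?powR_ge0// -powRrM mulrC.
have [xM|Mx] := leP x M.
  rewrite (@le_trans _ _ ((M `^ delta) ^+ 2))//; last first.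
    by rewrite lerDl mulr_ge0 ?powR_ge0// ltW.
  by rewrite lerXn2r ?nnegrE ?powR_ge0// ge0_ler_powR// nnegrE ltW.
rewrite (@le_trans _ _ (M `^ (2 * delta - 1) * x))//; last by rewrite lerDr sqr_ge0.
have x_neq0 : x != 0 by rewrite gt_eqF.
rewrite pE -[X in X * x]invrK -powRN opprB.
rewrite -[in leLHS](subrK 1 (2 * delta)) powRD ?x_neq0 ?implybT// powRr1 ?(ltW x0)//.
rewrite ler_wpM2r ?(ltW x0)// -[leLHS]invrK -powRN opprB lef_pV2 ?posrE ?powR_gt0//.
apply: ge0_ler_powR; rewrite ?nnegrE ?(ltW x0) ?(ltW M0) ?(ltW Mx)//.
by rewrite subr_ge0 mulrC -ler_pdivlMr// mul1r ltW.
Qed.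

Section fractional_powers.
Context d (T : measurableType d) (R : realType).
Variable mu : {measure set T -> \bar R}.
Local Notation H := (L2 mu).
Variables (A : unbounded_op mu).
Hypothesis Asa : self_adjoint A.
Variables (e : nat -> H) (lam : nat -> R).
Hypothesis eb : eigenbasis A e lam.
Hypothesis lam0 : forall k, 0 < lam k.
Let eo := eb_orthonormal eb.

(** It produces the value A^delta v from a bound on its coefficients: the partial sums are Cauchy
    because the sums of squares increase to a limit. *)
Lemma riesz_fischer (a : nat -> R) b :
  (forall n, \sum_(0 <= k < n) a k ^+ 2 <= b) ->
  exists w : H, ((\sum_(0 <= k < n) a k *: e k : H) @[n --> \oo] --> w).
Proof.
move=> ab; pose s n : H := \sum_(0 <= k < n) a k *: e k.
pose q n : R := \sum_(0 <= k < n) a k ^+ 2.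
have qmon m n : (m <= n)%N -> q m <= q n.
  move=> mn; rewrite /q (big_cat_nat (leq0n m) mn)/= lerDl.
  by apply: sumr_ge0 => k _; exact: sqr_ge0.
have q_cvg : cvgn q by apply: nondecreasing_is_cvgn; [exact: qmon|exists b => _ [n _ <-]; exact: ab].
have snm m n : (m <= n)%N -> `|s n - s m| ^+ 2 = q n - q m.
  move=> mn; rewrite L2norm_sqB !(norm_osum eo) -/(q n) -/(q m).
  have -> : L2dot (s n) (s m) = q m.
    rewrite /s [in LHS]L2dot_sumr; apply: eq_big_nat => k /andP[_ km].
    by rewrite L2dotZr (dot_osum eo) (leq_trans km mn) expr2.
  by ring.
have /cvg_ex[w sw] : cvg (s n @[n --> \oo]); last by exists w.
apply: L2_cauchy_cvg; apply: cauchy_exP => eps eps0.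
have e20 : 0 < eps ^+ 2 by rewrite exprn_gt0.
have /cvgrPdist_lt/(_ _ e20)[N _ NP] := q_cvg.
exists (s N); exists N => // n /= Nn; rewrite -ball_normE/= distrC.
rewrite -(@ltr_pXn2r _ 2)// ?nnegrE ?(ltW eps0)// snm//.
have := NP N (leqnn N); rewrite /= ltr_norml => /andP[_]; apply: le_lt_trans.
by rewrite lerD2r; exact: (nondecreasing_cvgn_le qmon q_cvg).
Qed.

Section delta.
Variable delta : R.
Hypothesis deltaP : 0 <= delta < 2^-1.
Local Notation Afrac := (frac_op A delta).

(* An eigenvector of another basis is orthogonal to [e j] unless it belongs to
   the eigenvalue [lam j], so the coefficients of A^delta v do not depend on the
   eigenbasis. *)
Lemma frac_power_coef v w j : frac_power A delta v w ->
  L2dot w (e j) = lam j `^ delta * L2dot v (e j).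
Proof.
move=> [e' [lam' [eb' sw]]].
have orth k : lam' k `^ delta * L2dot v (e' k) * L2dot (e' k) (e j) =
    lam j `^ delta * (L2dot v (e' k) * L2dot (e' k) (e j)).
  have [/(_ k)[D' Ae'] _ _] := eb'; have [/(_ j)[D Ae] _ _] := eb.
  have := self_adjoint_sym Asa D' D; rewrite Ae' Ae L2dotZl L2dotZr => /eqP.
  rewrite -subr_eq0 -mulrBl mulf_eq0 subr_eq0 => /orP[/eqP->|/eqP->]; first by rewrite mulrA.
  by rewrite !mulr0.
have [_ _ /(_ v) vs] := eb'.
have h1 := @L2dot_cvgl _ _ _ _ _ (e j) _ sw.
have h2 := @cvgMl_tmp R _ _ _ _ (lam j `^ delta) _ (@L2dot_cvgl _ _ _ _ _ (e j) _ vs).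
have hE : (fun n => L2dot (\sum_(0 <= k < n) (lam' k `^ delta * L2dot v (e' k)) *: e' k) (e j)) =
    (fun n => lam j `^ delta * L2dot (\sum_(0 <= k < n) L2dot v (e' k) *: e' k) (e j)).
  apply/funext => n; rewrite !L2dot_suml mulr_sumr; apply: eq_bigr => k _.
  by rewrite !L2dotZl orth.
move: h1; rewrite hE => /(@cvg_lim _ (@Rhausdorff R)) <-.
by apply: (@cvg_lim _ (@Rhausdorff R)); exact: h2.
Qed.

Lemma frac_op_coef v j : (exists w, frac_power A delta v w) ->
  L2dot (Afrac v) (e j) = lam j `^ delta * L2dot v (e j).
Proof. by move=> /(xgetPex 0); exact: frac_power_coef. Qed.

Lemma coef_interpolation n M v b : 0 < M -> energy e lam n v <= b ->
  \sum_(0 <= k < n) (lam k `^ delta * L2dot v (e k)) ^+ 2 <=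
    (M `^ delta) ^+ 2 * `|v| ^+ 2 + M `^ (2 * delta - 1) * b.
Proof.
move=> M0 eb'; apply: (@le_trans _ _ ((M `^ delta) ^+ 2 *
    \sum_(0 <= k < n) L2dot v (e k) ^+ 2 + M `^ (2 * delta - 1) * energy e lam n v)).
  rewrite !mulr_sumr -big_split/=; apply: ler_sum => k _.
  by rewrite exprMn mulrA -mulrDl ler_wpM2r ?sqr_ge0// powR_interpolation.
by rewrite lerD// ler_wpM2l ?powR_ge0 ?sqr_ge0// (bessel eo).
Qed.

Lemma frac_dom_energy v b : (forall n, energy e lam n v <= b) ->
  exists w, frac_power A delta v w.
Proof.
move=> vb; have [w sw] := riesz_fischer (fun n => coef_interpolation ltr01 (vb n)).
by exists w, e, lam.
Qed.

(** On a set of bounded energy, the energy term of the interpolation is made small by a large M;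
    with M fixed, the L^2 term is made small by the closeness of v and v'. *)
Lemma frac_op_unif_cts b eps : 0 <= b -> 0 < eps -> exists2 dlt : R, 0 < dlt &
  forall v v', (forall n, energy e lam n v <= b) -> (forall n, energy e lam n v' <= b) ->
    `|v - v'| < dlt -> `|Afrac v - Afrac v'| < eps.
Proof.
move=> b0 eps0; have e2 : 0 < eps / 2 by rewrite divr_gt0.
have e22 : 0 < (eps / 2) ^+ 2 by rewrite exprn_gt0.
have b4 : 0 < 2 * (b + b) + 1 by rewrite ltr_wpDl// mulr_ge0// addr_ge0.
have y0 : 0 < (eps / 2) ^+ 2 / (2 * (b + b) + 1) by rewrite divr_gt0.
(* M solves M^{2 delta - 1} (2 (b + b) + 1) = (eps / 2)^2, where 2 (b + b) bounds the energy of v -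
   v'. *)
pose M := ((eps / 2) ^+ 2 / (2 * (b + b) + 1)) `^ (2 * delta - 1)^-1.
have M0 : 0 < M by exact: powR_gt0.
have ME : M `^ (2 * delta - 1) * (2 * (b + b)) <= (eps / 2) ^+ 2.
  rewrite /M -powRrM mulVf ?powRr1 ?(ltW y0)//; last first.
    move: deltaP => /andP[_ d1]; rewrite lt_eqF// subr_lt0 mulrC -ltr_pdivlMr//.
    by rewrite mul1r.
  by rewrite mulrAC ler_pdivrMr// ler_wpM2l ?(ltW e22)// lerDl.
have Md0 : 0 < M `^ delta by exact: powR_gt0.
exists (eps / 2 / M `^ delta); first by rewrite divr_gt0.
move=> v v' vb v'b; rewrite ltr_pdivlMr// => vv'.
(* Two contributions of (eps / 2)^2 give a norm of at most eps / sqrt 2, and 3/4 eps lies between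
   this and eps. *)
have [x xeps x0] : exists2 x, x < eps & (eps / 2) ^+ 2 + (eps / 2) ^+ 2 <= x ^+ 2 /\ 0 <= x.
  by exists (3 / 4 * eps); [lra|split; nra].
apply: le_lt_trans xeps; case: x0 => xe x0.
apply: (norm_le_coef eb) => // n; apply: le_trans xe.
have vdom := frac_dom_energy vb; have v'dom := frac_dom_energy v'b.
have en : energy e lam n (v - v') <= 2 * (b + b).
  apply: le_trans (energyB_le _ lam0 _ _ _) _; by rewrite ler_pM2l// lerD.
apply: le_trans (le_trans (coef_interpolation M0 en) _).
  apply: ler_sum => k _.
  by rewrite L2dotBl !frac_op_coef// L2dotBl mulrBr.
apply: lerD => //; rewrite -exprMn lerXn2r ?nnegrE//.
- by rewrite mulr_ge0// ltW.
- exact: ltW.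
- by rewrite mulrC ltW.
Qed.

Variable r : R.
Local Notation I := (set_type `[- r, 0]%classic).
Local Notation C := (Cspace r H).
Local Notation Cd := (Cspace r (frac_dom A delta)).

Lemma lift_Cdelta b (phi : C) : 0 <= b -> (forall th n, energy e lam n (phi th) <= b) ->
  exists psi : Cd, forall th, sval (psi th) = phi th.
Proof.
move=> b0 phib.
pose f th : frac_dom A delta := exist _ (phi th) (frac_dom_energy (phib th)).
have cf : continuous f.
  move=> th W /nbhs_ballP[eps /= eps0 WP].
  have [dlt d0 dP] := frac_op_unif_cts b0 eps0.
  have [dlt' d'0 d'P] := Ccts phi th d0.
  apply/nbhs_ballP; exists dlt' => // th' h; apply: WP.
  have -> : ball (f th) eps (f th') = ball (Afrac (phi th)) eps (Afrac (phi th')) by [].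
  by rewrite -ball_normE; apply: dP => //; exact: d'P.
by exists (mkcts cf : continuousType _ _).
Qed.

(** The set in C_delta is the image of K under the lift [G], which is continuous on K by
    [frac_op_unif_cts]. *)
Lemma energy_compact_in_Cdelta (K : set C) b : 0 <= b ->
  (forall phi, K phi -> forall th n, energy e lam n (phi th) <= b) ->
  compact K -> compact_in_Cdelta A delta K.
Proof.
move=> b0 Kb Kc; have lift phi : K phi -> exists psi : Cd, forall th, sval (psi th) = phi th.
  by move=> /Kb; exact: lift_Cdelta.
(* An element of K is wanted because its lift serves as the value of [G] outside K; for empty K the
   lifted set is empty. *)
split => //; have [[phi0 K0]|nK] := pselect (exists phi, K phi); last first.
  rewrite (_ : [set _ | _] = set0); first exact: compact0.
  by rewrite -subset0 => psi [phi Kphi _]; apply: nK; exists phi.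
have [psi0 _] := lift _ K0.
have /choice[G GP] : forall phi, exists psi : Cd, K phi -> forall th, sval (psi th) = phi th.
  move=> phi; have [/lift[psi h]|nKphi] := pselect (K phi); first by exists psi.
  by exists psi0.
have -> : [set psi : Cd | exists2 phi, K phi & forall th, sval (psi th) = phi th] = G @` K.
  apply/seteqP; split => [psi [phi Kphi h]|_ [phi Kphi <-]]; last by exists phi => //; exact: GP.
  exists phi => //; apply/continuousEP => th.
  by apply: eq_sig_hprop => [x|]; [exact: Prop_irrelevance|rewrite h GP].
apply: continuous_compact => //; apply/subspace_continuousP => phi Kphi W.
move=> /nbhs_ballP[eps /= eps0 WP]; have e2 : 0 < eps / 2 by rewrite divr_gt0.
have [dlt d0 dP] := frac_op_unif_cts b0 eps0.
suff : nbhs phi [set psi | K psi -> W (G psi)] by [].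
apply/Cnbhs; exists dlt => // psi close Kpsi; apply: WP.
have -> : ball (G phi) eps (G psi) = (forall th, ball (G phi th) eps (G psi th)) by [].
move=> th; have -> : ball (G phi th) eps (G psi th) =
    ball (Afrac (sval (G phi th))) eps (Afrac (sval (G psi th))) by [].
by rewrite -ball_normE !GP//; apply: dP; [exact: Kb|exact: Kb|exact: close].
Qed.

End delta.
End fractional_powers.

Theorem theorem3 (R : realType) (n0 : nat) (Omega : smooth_bounded_domain R n0)
    (r d : R) (A : unbounded_op (lebesgue_dom Omega))
    (E : R -> L2dom Omega -> L2dom Omega)
    (B : L2dom Omega -> L2dom Omega)
    (Thu Thl eta : Cspace r (L2dom Omega) -> R)
    (S : R -> Cspace r (L2dom Omega) ->
         Cspace r (L2dom Omega)) :
  (0 < n0)%N -> 0 < r -> 0 <= d ->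
  linear_op A -> densely_defined A -> self_adjoint A -> positive_op A ->
  compact_resolvent A ->
  generated_by_opp A E ->
  (exists LB : R, forall v w, `|B v - B w| <= LB * `|v - w|) ->
  (exists MB : R, forall v, `|B v| <= MB) ->
  continuous Thu -> continuous Thl -> continuous eta ->
  (forall phi, [/\ 0 <= Thl phi, Thl phi <= Thu phi & Thu phi <= r]) ->
  (forall phi, 0 <= eta phi <= r) ->
  (forall phi psi : Cspace r (L2dom Omega),
     (forall th, - Thu phi <= val th <= - Thl phi -> psi th = phi th) ->
     eta psi = eta phi) ->
  (forall phi, 0 < Thl phi) \/ delay_condition_b Thl eta ->
  solution_operator E B eta d S ->
  exists K : set (Cspace r (L2dom Omega)),
    compact_global_attractor S K /\
    forall delta : R, 0 <= delta < 2^-1 -> compact_in_Cdelta A delta K.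
Proof.
move=> n0_gt0 r0 d0 Alin Aden Asa Apos Acr genE [LB BL] [MB Bb] _ Thl_cts eta_cts
  Th_r eta_r eta_Th Hab SO.
have [e [lam [eb lam0 lamoo]]] := exists_eigenbasis Alin Aden Asa Apos Acr
  (@dom_infinite_dimension _ _ Omega n0_gt0).
have [l0 l00 l0P] := spectral_gap lam0 lamoo.
have LB0 : 0 <= Num.max LB 0 by rewrite le_max lexx orbT.
have BL' v w : `|B v - B w| <= Num.max LB 0 * `|v - w|.
  by rewrite (le_trans (BL v w))// ler_wpM2r// le_max lexx.
have /choice[U UP] := SO.
have Umild phi tmax : 0 < tmax -> mild_solution E B eta d phi tmax (U phi).
  by have [[_]] := UP phi; move=> + _; apply.
have Usol phi tmax : sol E d B eta (U phi) tmax.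
  (* A global solution is given on positive horizons; the others are covered by restriction from a
     larger one. *)
  have m0 : 0 < Num.max tmax 1 by rewrite lt_max ltr01 orbT.
  have [us _] := mild_sol genE r0 (Umild phi _ m0).
  by apply: sol_le us; rewrite le_max lexx.
have Uhist phi th : U phi (val th) = phi th.
  by have [_] := mild_sol genE r0 (Umild phi 1 ltr01); exact.
have SE t phi : 0 <= t -> S t phi = segment r (U phi) t.
  by have [_] := UP phi; exact.
have uniq := sol_unique genE eb lam0 r0 d0 LB0 BL' eta_cts eta_r Thl_cts Th_r eta_Th Hab.
have [K [KB Katt]] := attractor genE eb lam0 lamoo l00 l0P r0 d0 LB0 BL' Bb eta_cts eta_r
  uniq Usol Uhist SE.
exists K; split=> // delta deltaP; case: Katt => Kc _ _.
apply: (energy_compact_in_Cdelta Asa eb lam0 deltaP (c1_ge0 l0 d MB) _ Kc) => phi /KB[].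
by [].
Qed.
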